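(* Let $\mathcal{H}$ be a complex separable infinite-dimensional Hilbert space and let $T$ be a contraction on $\mathcal{H}$. Then $T$ has the joint strong stability property if and only if there exist a separable Hilbert space $\mathcal{K}$ and a model space $N\subseteq H^2_{\mathcal{K}}$ such that $H^2_{\mathcal{K}}\ominus N$ is full range and $T$ is similar to $A_N$.
   Context: A contraction is a bounded operator with norm at most $1$. A bounded operator $T$ is strongly stable if $T^nv\to0$ as $n\to+\infty$ for every $v$; $T$ has the joint strong stability property if both $T$ and $T^*$ are strongly stable. Operators $T_1$ on $\mathcal{H}_1$ and $T_2$ on $\mathcal{H}_2$ are similar if $VT_1V^{-1}=T_2$ for some bounded invertible $V:\mathcal{H}_1\to\mathcal{H}_2$. Let $\mathbb{T}$ be the unit circle with normalized Lebesgue measure. For a separable Hilbert space $\mathcal{K}$, $H^2_{\mathcal{K}}\subseteq L^2(\mathbb{T},\mathcal{K})$ is the Hardy space of square-integrable $\mathcal{K}$-valued functions whose Fourier coefficients of negative index vanish, and $S:H^2_{\mathcal{K}}\to H^2_{\mathcal{K}}$, $Sf(z)=zf(z)$, is the unilateral shift. A model space is a closed $S^*$-invariant subspace $N\subseteq H^2_{\mathcal{K}}$; $A_N:N\to N$, $A_Nf=P_NSf$, is the shift compression, with $P_N$ the orthogonal projection onto $N$. For a closed $S$-invariant subspace $M\subseteq H^2_{\mathcal{K}}$ and an orthonormal basis $\{E_j\}_j$ of $W=M\ominus S(M)$, set $J(z)=\overline{\mathrm{span}}\{E_j(z)\}_j\subseteq\mathcal{K}$ for almost every $z\in\mathbb{T}$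 (independent of the basis, up to null sets). $M$ is full range if $J(z)=\mathcal{K}$ for almost every $z\in\mathbb{T}$. *)

(* Defs.v *)
From HB Require Import structures.
From mathcomp Require Import all_boot all_order all_algebra.
From mathcomp Require Import all_classical all_reals all_analysis.
From mathcomp Require Import measurable_realfun complex ring lra.
Import Order.TTheory GRing.Theory Num.Theory.
Import numFieldNormedType.Exports.

Set Implicit Arguments.
Unset Strict Implicit.
Unset Printing Implicit Defensive.

Local Open Scope classical_set_scope.
Local Open Scope ring_scope.

(* Inner product, linear in the first argument; the norm of a normed module
   over R[i] takes its values in R[i], hence [`|x| ^+ 2] below. *)
HB.mixin Record NormedModule_isPreHilbert (R : realType) V
    & NormedModule R[i] V := {
  dot : V -> V -> R[i];
  dotDl : forall x y z, dot (x + y) z = dot x z + dot y z;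
  dotZl : forall a x y, dot (a *: x) y = a * dot x y;
  dotC : forall x y, dot x y = (dot y x)^*;
  dot_norm : forall x, dot x x = `|x| ^+ 2 }.

#[short(type="preHilbertType")]
HB.structure Definition PreHilbert (R : realType) :=
  {V of NormedModule R[i] V & NormedModule_isPreHilbert R V}.

#[short(type="hilbertType")]
HB.structure Definition Hilbert (R : realType) :=
  {V of PreHilbert R V & Complete V}.

HB.mixin Record isSeparable T & Topological T := {
  separable_dense : exists2 D : set T, countable D & dense D }.

#[short(type="sepHilbertType")]
HB.structure Definition SeparableHilbert (R : realType) :=
  {V of Hilbert R V & isSeparable V}.

HB.factory Record Lmodule_isPreHilbert (R : realType) V
    & GRing.Lmodule R[i] V := {
  dot : V -> V -> R[i];
  dotDl : forall x y z, dot (x + y) z = dot x z + dot y z;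
  dotZl : forall a x y, dot (a *: x) y = a * dot x y;
  dotC : forall x y, dot x y = (dot y x)^*;
  dot_ge0 : forall x, 0 <= dot x x;
  dot_eq0 : forall x, dot x x = 0 -> x = 0 }.

HB.builders Context R V & Lmodule_isPreHilbert R V.

Let dotDr x y z : dot x (y + z) = dot x y + dot x z.
Proof. by rewrite dotC dotDl rmorphD /= -!dotC. Qed.

Let dotZr a x y : dot x (a *: y) = a^* * dot x y.
Proof. by rewrite dotC dotZl rmorphM /= -dotC. Qed.

Let cauchy_schwarz x y : `|dot x y| ^+ 2 <= dot x x * dot y y.
Proof.
have [y0|yN0] := eqVneq (dot y y) 0.
  by rewrite y0 mulr0 (dot_eq0 y0) -(scale0r 0) dotZr conjC0 mul0r normr0 expr0n.
have y_gt0 : 0 < dot y y by rewrite lt_def yN0 dot_ge0.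
have := dot_ge0 (dot y y *: x + (- dot x y) *: y).
rewrite !(dotDl, dotDr, dotZl, dotZr) rmorphN /= -!dotC.
rewrite (dotC y x) normCK.
set a := dot x y; set b := dot y y; set c := dot x x.
have -> : b * (b * c) + b * (- a^* * a) + (- a * (b * a^* ) + - a * (- a^* * b))
  = b * (c * b - a * a^* ) by ring.
by rewrite pmulr_rge0// subr_ge0.
Qed.

Let norm x : R[i] := sqrtC (dot x x).

Let norm_triangle x y : norm (x + y) <= norm x + norm y.
Proof.
have n0 z : 0 <= norm z by rewrite sqrtC_ge0 dot_ge0.
rewrite -(ler_pXn2r (n := 2))// ?nnegrE ?addr_ge0//.
rewrite sqrrD !sqrtCK !(dotDl, dotDr) (dotC y x).
have : dot x y + (dot x y)^* <= (norm x * norm y) *+ 2.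
  have -> : dot x y + (dot x y)^* = 'Re (dot x y) *+ 2.
    by rewrite -mulr_natr ReE -mulrA mulVf ?mulr1// pnatr_eq0.
  rewrite lerMn2r/=; apply: (le_trans (leif_le (leif_Re_Creal _))).
  rewrite -(ler_pXn2r (n := 2))// ?nnegrE ?mulr_ge0// exprMn !sqrtCK.
  exact: cauchy_schwarz.
rewrite -(lerD2l (dot x x + dot y y)).
by congr (_ <= _); ring.
Qed.

Let normZ a x : norm (a *: x) = `|a| * norm x.
Proof.
rewrite /norm dotZl dotZr mulrA -normCK sqrtCM ?nnegrE ?exprn_ge0 ?dot_ge0//.
by rewrite sqrCK.
Qed.

Let norm_eq0 x : norm x = 0 -> x = 0.
Proof. by move=> /eqP; rewrite sqrtC_eq0 => /eqP /dot_eq0. Qed.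

HB.instance Definition _ :=
  @Lmodule_isNormed.Build R[i] V norm norm_triangle normZ norm_eq0.

Let dot_normE (x : V) : dot x x = `|x| ^+ 2.
Proof. by rewrite /Num.norm/= sqrtCK. Qed.

HB.instance Definition _ :=
  @NormedModule_isPreHilbert.Build R V dot dotDl dotZl dotC dot_normE.

HB.end.

Section InnerProductTheory.
Variables (R : realType) (V : preHilbertType R).
Implicit Types (x y z : V) (a : R[i]).

Lemma dotDr x y z : dot x (y + z) = dot x y + dot x z.
Proof. by rewrite dotC dotDl rmorphD /= -!dotC. Qed.

Lemma dotZr a x y : dot x (a *: y) = a^* * dot x y.
Proof. by rewrite dotC dotZl rmorphM /= -dotC. Qed.

Lemma dotNl x y : dot (- x) y = - dot x y.
Proof. by rewrite -scaleN1r dotZl mulN1r. Qed.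

Lemma dotNr x y : dot x (- y) = - dot x y.
Proof. by rewrite -scaleN1r dotZr rmorphN1 mulN1r. Qed.

Lemma dot0l y : dot 0 y = 0.
Proof. by rewrite -(scale0r (0 : V)) dotZl mul0r. Qed.

Lemma dot0r y : dot y 0 = 0.
Proof. by rewrite dotC dot0l conjC0. Qed.

End InnerProductTheory.

Section ComplexParts.
Variable R : realType.
Implicit Types (z w : R[i]).

Lemma cReD z w : complex.Re (z + w) = complex.Re z + complex.Re w.
Proof. by case: z w => [a b] [c d]. Qed.

Lemma cImD z w : complex.Im (z + w) = complex.Im z + complex.Im w.
Proof. by case: z w => [a b] [c d]. Qed.

Lemma cReN z : complex.Re (- z) = - complex.Re z.
Proof. by case: z. Qed.

Lemma cImN z : complex.Im (- z) = - complex.Im z.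
Proof. by case: z. Qed.

Lemma cReM z w : complex.Re (z * w) =
  complex.Re z * complex.Re w - complex.Im z * complex.Im w.
Proof. by case: z w => [a b] [c d]. Qed.

Lemma cImM z w : complex.Im (z * w) =
  complex.Re z * complex.Im w + complex.Im z * complex.Re w.
Proof. by case: z w => [a b] [c d]. Qed.

Lemma cReJ z : complex.Re z^* = complex.Re z.
Proof. by case: z. Qed.

Lemma cImJ z : complex.Im z^* = - complex.Im z.
Proof. by case: z. Qed.

End ComplexParts.

Section SquaredNorm.
Variables (R : realType) (V : preHilbertType R).
Implicit Types (x y z : V) (a : R[i]).

Definition sqnorm x : R := complex.Re (`|x| ^+ 2).

Lemma sqnormE x : (`|x| ^+ 2) = (sqnorm x)%:C%C.
Proof.
rewrite /sqnorm; have : 0 <= `|x| ^+ 2 by exact: exprn_ge0.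
by case: (`|x| ^+ 2) => a b; rewrite lecE /= => /andP[/eqP -> _].
Qed.

Lemma sqnorm_ge0 x : 0 <= sqnorm x.
Proof. by rewrite -lecR -sqnormE exprn_ge0. Qed.

Lemma sqnorm_dot x : sqnorm x = complex.Re (dot x x).
Proof. by rewrite dot_norm. Qed.

Lemma Im_dotxx x : complex.Im (dot x x) = 0.
Proof. by rewrite dot_norm sqnormE. Qed.

Lemma sqnormD x y : sqnorm (x + y) =
  sqnorm x + sqnorm y + 2 * complex.Re (dot x y).
Proof.
rewrite !sqnorm_dot !(dotDl, dotDr) (dotC y x) !cReD cReJ; ring.
Qed.

Lemma sqnormB x y : sqnorm (x - y) =
  sqnorm x + sqnorm y - 2 * complex.Re (dot x y).
Proof.
rewrite sqnormD dotNr cReN mulrN; congr (_ + _ + _).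
by rewrite !sqnorm_dot dotNl dotNr opprK.
Qed.

Lemma Im_dotE x y : complex.Im (dot x y) = complex.Re (dot x ('i *: y)).
Proof. by rewrite dotZr conjCi cReM -complexiE /=; lra. Qed.

Lemma Re_dot_le x y : `|complex.Re (dot x y)| <= sqnorm x + sqnorm y.
Proof.
have := sqnorm_ge0 (x + y); have := sqnorm_ge0 (x - y).
have := sqnorm_ge0 x; have := sqnorm_ge0 y.
rewrite sqnormB sqnormD ler_norml => *; lra.
Qed.

Lemma sqnormD_le x y : sqnorm (x + y) <= 2 * sqnorm x + 2 * sqnorm y.
Proof.
have := sqnorm_ge0 (x - y); rewrite sqnormB sqnormD => *; lra.
Qed.

Lemma sqnorm_eq0 x : sqnorm x = 0 -> x = 0.
Proof.
by move=> x0; apply/eqP; rewrite -normr_eq0 -sqrf_eq0 sqnormE x0.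
Qed.

Lemma sqnormZ (a : R[i]) x :
  sqnorm (a *: x) = (complex.Re a ^+ 2 + complex.Im a ^+ 2) * sqnorm x.
Proof.
rewrite {1}/sqnorm normrZ exprMn cReM -add_Re2_Im2 sqnormE /=.
by rewrite mul0r subr0.
Qed.

End SquaredNorm.

Section MeasurableVectorFunctions.
Context d (X : measurableType d) (R : realType).

Definition cmeasurable (f : X -> R[i]) :=
  measurable_fun [set: X] (fun x => complex.Re (f x)) /\
  measurable_fun [set: X] (fun x => complex.Im (f x)).

Lemma cmeasurableM f g : cmeasurable f -> cmeasurable g ->
  cmeasurable (fun x => f x * g x).
Proof.
move=> [f1 f2] [g1 g2]; split.
  under eq_fun do rewrite cReM.
  by apply: measurable_funB; apply: measurable_funM.
under eq_fun do rewrite cImM.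
by apply: measurable_funD; apply: measurable_funM.
Qed.

Lemma cmeasurableD f g : cmeasurable f -> cmeasurable g ->
  cmeasurable (fun x => f x + g x).
Proof.
move=> [f1 f2] [g1 g2]; split.
  by under eq_fun do rewrite cReD; exact: measurable_funD.
by under eq_fun do rewrite cImD; exact: measurable_funD.
Qed.

Lemma cmeasurable_cst (a : R[i]) : cmeasurable (fun=> a).
Proof. by split; exact: measurable_cst. Qed.

Section weak.
Variable K : sepHilbertType R.
Implicit Types f g : X -> K.

(* Weak measurability; for separable K it is equivalent to Borel or strong
   measurability by Pettis' theorem. *)
Definition vmeasurable f := forall k : K, cmeasurable (fun x => dot (f x) k).

Lemma vmeasurableD f g : vmeasurable f -> vmeasurable g ->
  vmeasurable (fun x => f x + g x).
Proof.
move=> mf mg k; under [fun x => dot _ _]eq_fun do rewrite dotDl.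
exact: cmeasurableD.
Qed.

Lemma vmeasurableM (a : X -> R[i]) f : cmeasurable a -> vmeasurable f ->
  vmeasurable (fun x => a x *: f x).
Proof.
move=> ma mf k; under [fun x => dot _ _]eq_fun do rewrite dotZl.
exact: cmeasurableM.
Qed.

Lemma vmeasurableZ (a : R[i]) f : vmeasurable f ->
  vmeasurable (fun x => a *: f x).
Proof. by apply: vmeasurableM; exact: cmeasurable_cst. Qed.

Lemma vmeasurable0 : vmeasurable (fun=> 0).
Proof. by move=> k; exact: cmeasurable_cst. Qed.

Lemma measurable_sqnorm f : vmeasurable f ->
  measurable_fun [set: X] (fun x => sqnorm (f x)).
Proof.
move=> mf; have [D cD dD] := @separable_dense R K.
have [e eD] : exists e : nat -> K, D `<=` range e.
  have /countable_injP[i iI] := cD.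
  exists (fun n => xget 0 [set k | D k /\ i k = n]) => k Dk.
  exists (i k) => //; case: xgetP => [y _ [Dy iy]|/(_ k)[]//].
  by apply: iI => //; rewrite inE.
pose h n x := 2 * complex.Re (dot (f x) (e n)) - sqnorm (e n).
have mh n : measurable_fun [set: X] (h n).
  apply: measurable_funB; last exact: measurable_cst.
  by apply: measurable_funM; [exact: measurable_cst | have [] := mf (e n)].
move=> _; apply: (measurability _ (RGenOInfty.measurableE R)) => //.
move=> _ [_ [a ->] <-].
have -> : [set: X] `&` (fun x => sqnorm (f x)) @^-1` `]a, +oo[ =
  \bigcup_n ((h n) @^-1` `]a, +oo[).
  apply/seteqP; split=> x /=.
    rewrite in_itv/= andbT => -[_ ax].
    have e0 : 0 < Num.sqrt (sqnorm (f x) - a) by rewrite sqrtr_gt0 subr_gt0.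
    have [||k []] := dD (ball (f x) (Num.sqrt (sqnorm (f x) - a))%:C%C).
    - by exists (f x); apply: ballxx; rewrite ltcR.
    - exact: ball_open.
    rewrite -ball_normE /= => xk /eD [n _ nk]; exists n => //.
    rewrite /= in_itv/= andbT /h nk.
    suff : sqnorm (f x - k) < sqnorm (f x) - a by rewrite sqnormB; lra.
    have sa : 0 <= sqnorm (f x) - a by rewrite subr_ge0 ltW.
    rewrite -ltcR -sqnormE -(sqr_sqrtr sa) rmorphXn/= ltr_pXn2r// nnegrE//.
    by rewrite lecR ltW.
  move=> [n _]; rewrite /= !in_itv/= !andbT => /lt_le_trans p; split=> //.
  apply: p; rewrite /h -subr_ge0.
  have := sqnorm_ge0 (f x - e n); rewrite sqnormB; lra.
apply: bigcup_measurable => n _; rewrite -[X in measurable X]setTI.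
by apply: mh => //; exact: measurable_itv.
Qed.

End weak.
End MeasurableVectorFunctions.

Section L2Functions.
Context d (X : measurableType d) (R : realType).
Variables (mu : {measure set X -> \bar R}) (K : sepHilbertType R).
Implicit Types (f g : X -> K) (a : R[i]).

Definition square_integrable f :=
  vmeasurable f /\ (\int[mu]_x (sqnorm (f x))%:E < +oo)%E.

Definition L2pred : {pred X -> K} := [pred f | `[< square_integrable f >]].

Let measurable_sqnormE f : vmeasurable f ->
  measurable_fun [set: X] (fun x => (sqnorm (f x))%:E).
Proof. by move=> mf; apply/measurable_EFinP; exact: measurable_sqnorm. Qed.

Lemma L2pred_submod_closed : submod_closed L2pred.
Proof.
split.
  apply/asboolP; split; first exact: vmeasurable0.
  under eq_integral do rewrite /sqnorm normr0 expr0n /=.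
  by rewrite integral0.
move=> a f g /asboolP[mf fi] /asboolP[mg gi]; apply/asboolP.
have maf := vmeasurableZ a mf.
split; first exact: vmeasurableD.
pose c := complex.Re a ^+ 2 + complex.Im a ^+ 2.
have c0 : 0 <= c by rewrite addr_ge0// sqr_ge0.
apply: (@le_lt_trans _ _ (\int[mu]_x ((2 * c)%:E * (sqnorm (f x))%:E
   + 2%:E * (sqnorm (g x))%:E))%E).
  apply: ge0_le_integral => //.
  - by move=> x _; rewrite lee_fin sqnorm_ge0.
  - by apply: measurable_sqnormE; exact: vmeasurableD.
  - apply: emeasurable_funD; apply: emeasurable_funM;
      try exact: measurable_sqnormE; exact: measurable_cst.
  - move=> x _; rewrite -!EFinM -EFinD lee_fin.
    by apply: (le_trans (sqnormD_le _ _)); rewrite sqnormZ mulrA.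
rewrite ge0_integralD//=.
- rewrite !ge0_integralZl//=;
    try by [exact: measurable_sqnormE
           |move=> x _; rewrite lee_fin sqnorm_ge0
           |rewrite lee_fin mulr_ge0].
  by rewrite lte_add_pinfty// lte_mul_pinfty// lee_fin// mulr_ge0.
- by move=> x _; rewrite -EFinM lee_fin !mulr_ge0// sqnorm_ge0.
- apply: emeasurable_funM; first exact: measurable_cst.
  exact: measurable_sqnormE.
- by move=> x _; rewrite -EFinM lee_fin !mulr_ge0// sqnorm_ge0.
- apply: emeasurable_funM; first exact: measurable_cst.
  exact: measurable_sqnormE.
Qed.

HB.instance Definition _ :=
  GRing.isSubmodClosed.Build R[i] (X -> K) L2pred L2pred_submod_closed.

Record L2fun := MkL2fun { L2fun_val :> X -> K; _ : L2fun_val \in L2pred }.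

HB.instance Definition _ := [isSub for L2fun_val].
HB.instance Definition _ := [Choice of L2fun by <:].
HB.instance Definition _ := [SubChoice_isSubLmodule of L2fun by <:].

Lemma L2funP (f : L2fun) : square_integrable f.
Proof. by apply/asboolP; have := valP f. Qed.

End L2Functions.
Arguments L2pred {d X R} mu K _.

Definition cintegral d (X : measurableType d) (R : realType)
    (mu : {measure set X -> \bar R}) (h : X -> R[i]) : R[i] :=
  Complex (\int[mu]_x complex.Re (h x)) (\int[mu]_x complex.Im (h x)).

Section L2Dot.
Context d (X : measurableType d) (R : realType).
Variables (mu : {measure set X -> \bar R}) (K : sepHilbertType R).
Local Notation L2fun := (L2fun mu K).
Implicit Types (f g h : L2fun) (a : R[i]).

Let sum2_lty f g :
  (\int[mu]_x (sqnorm (f x) + sqnorm (g x))%:E < +oo)%E.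
Proof.
have [mf fi] := L2funP f; have [mg gi] := L2funP g.
under eq_integral do rewrite EFinD.
rewrite ge0_integralD//=; first exact: lte_add_pinfty.
- by move=> x _; rewrite lee_fin sqnorm_ge0.
- by apply/measurable_EFinP; exact: measurable_sqnorm.
- by move=> x _; rewrite lee_fin sqnorm_ge0.
- by apply/measurable_EFinP; exact: measurable_sqnorm.
Qed.

Lemma integrable_Re_dot f g :
  mu.-integrable [set: X] (EFin \o (fun x => complex.Re (dot (f x) (g x)))).
Proof.
have [mf fi] := L2funP f; have [mg gi] := L2funP g.
apply/integrableP; split.
  apply/measurable_EFinP.
  rewrite (_ : (fun x => _) =
      (fun x => 2^-1 * (sqnorm (f x + g x) - (sqnorm (f x) + sqnorm (g x))))).
    apply: measurable_funM; first exact: measurable_cst.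
    apply: measurable_funB.
      by apply: measurable_sqnorm; exact: vmeasurableD.
    by apply: measurable_funD; exact: measurable_sqnorm.
  by apply/funext => x; rewrite sqnormD; lra.
apply: le_lt_trans (sum2_lty f g).
apply: ge0_le_integral => //.
- apply/measurable_EFinP; apply: measurableT_comp => //.
  rewrite (_ : (fun x => _) =
      (fun x => 2^-1 * (sqnorm (f x + g x) - (sqnorm (f x) + sqnorm (g x))))).
    apply: measurable_funM; first exact: measurable_cst.
    apply: measurable_funB.
      by apply: measurable_sqnorm; exact: vmeasurableD.
    by apply: measurable_funD; exact: measurable_sqnorm.
  by apply/funext => x; rewrite sqnormD; lra.
- by apply/measurable_EFinP; apply: measurable_funD; exact: measurable_sqnorm.
- by move=> x _; rewrite lee_fin Re_dot_le.
Qed.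

Lemma integrable_Im_dot f g :
  mu.-integrable [set: X] (EFin \o (fun x => complex.Im (dot (f x) (g x)))).
Proof.
rewrite (_ : _ \o _ =
  EFin \o (fun x => complex.Re (dot (f x) (('i *: g : L2fun) x)))).
  exact: integrable_Re_dot.
by apply/funext => x /=; rewrite Im_dotE.
Qed.

Definition idot f g := cintegral mu (fun x => dot (f x) (g x)).

Lemma idotDl f g h : idot (f + g) h = idot f h + idot g h.
Proof.
rewrite /idot /cintegral; apply/eqP; rewrite eq_complex /=; apply/andP; split.
  rewrite -RintegralD//; [|exact: integrable_Re_dot..].
  by apply/eqP; apply: eq_Rintegral => x _; rewrite dotDl cReD.
rewrite -RintegralD//; [|exact: integrable_Im_dot..].
by apply/eqP; apply: eq_Rintegral => x _; rewrite dotDl cImD.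
Qed.

Lemma idotZl a f g : idot (a *: f) g = a * idot f g.
Proof.
have iR := integrable_Re_dot f g; have iI := integrable_Im_dot f g.
have iZ (r : R) (u : X -> R) : mu.-integrable setT (EFin \o u) ->
  mu.-integrable setT (EFin \o (fun x => r * u x)).
  by move=> iu; rewrite (_ : _ \o _ = fun x => (r%:E * (EFin \o u) x)%E)//;
    exact: integrableZl.
rewrite /idot /cintegral; apply/eqP; rewrite eq_complex cReM cImM /=.
apply/andP; split.
  rewrite -!RintegralZl// -RintegralB//; [|exact: iZ..].
  by apply/eqP; apply: eq_Rintegral => x _; rewrite dotZl cReM.
rewrite -!RintegralZl// -RintegralD//; [|exact: iZ..].
by apply/eqP; apply: eq_Rintegral => x _; rewrite dotZl cImM.
Qed.

Lemma idotC f g : idot f g = (idot g f)^*.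
Proof.
rewrite /idot /cintegral; apply/eqP; rewrite eq_complex /=; apply/andP; split.
  by apply/eqP; apply: eq_Rintegral => x _; rewrite dotC cReJ.
have -> : - (\int[mu]_x complex.Im (dot (g x) (f x))) =
    -1 * \int[mu]_x complex.Im (dot (g x) (f x)) by rewrite mulN1r.
rewrite -RintegralZl//; last exact: integrable_Im_dot.
by apply/eqP; apply: eq_Rintegral => x _; rewrite dotC cImJ mulN1r.
Qed.

Lemma idot_ge0 f : 0 <= idot f f.
Proof.
rewrite /idot /cintegral lecE /=; apply/andP; split.
  under eq_Rintegral do rewrite Im_dotxx.
  by rewrite Rintegral_cst// mul0r.
by apply: Rintegral_ge0 => x _; rewrite -sqnorm_dot sqnorm_ge0.
Qed.

Lemma idot_eq0 f : idot f f = 0 -> {ae mu, forall x, f x = 0}.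
Proof.
have [mf fi] := L2funP f.
rewrite /idot /cintegral => -[+ _].
under eq_Rintegral do rewrite -sqnorm_dot.
have i0 : (0 <= \int[mu]_x (sqnorm (f x))%:E)%E.
  by apply: integral_ge0 => x _; rewrite lee_fin sqnorm_ge0.
rewrite /Rintegral => fine0.
have i0' : (\int[mu]_x (sqnorm (f x))%:E = 0)%E.
  by rewrite -[LHS]fineK ?ge0_fin_numE// fine0.
have mn : measurable_fun [set: X] (fun x => (sqnorm (f x))%:E).
  by apply/measurable_EFinP; exact: measurable_sqnorm.
have : (\int[mu]_(x in setT) `|(sqnorm (f x))%:E| = 0)%E.
  by rewrite -i0'; apply: eq_integral => x _; rewrite gee0_abs// lee_fin sqnorm_ge0.
move/(ae_eq_integral_abs _ measurableT mn).
by apply: filterS => x /(_ Logic.I)/= [] /sqnorm_eq0 ->.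
Qed.

Lemma ae_eq_idot f f' g g' : f = f' %[ae mu] -> g = g' %[ae mu] ->
  idot f g = idot f' g'.
Proof.
move=> ff gg; rewrite /idot /cintegral /Rintegral.
congr Complex; congr fine; apply: ae_eq_integral => //.
- exact: measurable_int (integrable_Re_dot f g).
- exact: measurable_int (integrable_Re_dot f' g').
- by move: ff gg; apply: filterS2 => x /= fx gx _; rewrite fx// gx.
- exact: measurable_int (integrable_Im_dot f g).
- exact: measurable_int (integrable_Im_dot f' g').
- by move: ff gg; apply: filterS2 => x /= fx gx _; rewrite fx// gx.
Qed.

End L2Dot.

Section L2Space.
Context d (X : measurableType d) (R : realType).
Variables (mu : {measure set X -> \bar R}) (K : sepHilbertType R).
Local Notation L2fun := (L2fun mu K).
Implicit Types (f g h : L2fun) (a : R[i]).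
Local Open Scope quotient_scope.

Definition L2eq f g := `[< f = g %[ae mu] >].

Let L2eq_refl : reflexive L2eq.
Proof. by move=> f; apply/asboolP; exact: ae_eq_refl. Qed.

Let L2eq_sym : symmetric L2eq.
Proof. by move=> f g; apply/idP/idP => /asboolP h; apply/asboolP/ae_eq_sym. Qed.

Let L2eq_trans : transitive L2eq.
Proof.
by move=> f g h /asboolP gf /asboolP fh; apply/asboolP/(ae_eq_trans gf fh).
Qed.

Canonical L2eq_equiv := EquivRel L2eq L2eq_refl L2eq_sym L2eq_trans.

(* Square-integrable K-valued functions modulo equality mu-almost everywhere. *)
Definition L2 : Type := {eq_quot L2eq}.
HB.instance Definition _ := Choice.on L2.
HB.instance Definition _ := EqQuotient.on L2.

Definition L2repr (F : L2) : L2fun := repr F.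
Coercion L2repr : L2 >-> L2fun.
Definition L2pi f : L2 := \pi_L2 f.

Lemma L2pi_eq f g : L2pi f = L2pi g <-> f = g %[ae mu].
Proof.
split => [/eqP|fg]; first by rewrite /L2pi eqmodE => /asboolP.
by apply/eqP; rewrite /L2pi eqmodE; apply/asboolP.
Qed.

Lemma L2reprK (F : L2) : L2pi F = F.
Proof. exact: reprK. Qed.

Lemma L2piK f : L2repr (L2pi f) = f %[ae mu].
Proof. by apply/L2pi_eq; rewrite L2reprK. Qed.

Definition L2add (F G : L2) : L2 := L2pi (L2repr F + L2repr G).
Definition L2opp (F : L2) : L2 := L2pi (- L2repr F).
Definition L2scale a (F : L2) : L2 := L2pi (a *: L2repr F).
Definition L2dot (F G : L2) : R[i] := idot (L2repr F) (L2repr G).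

Lemma L2piD f g : L2add (L2pi f) (L2pi g) = L2pi (f + g).
Proof.
apply/L2pi_eq; have := L2piK f; have := L2piK g.
by apply: filterS2 => x /= gx fx _; rewrite !fctE gx// fx.
Qed.

Lemma L2piZ a f : L2scale a (L2pi f) = L2pi (a *: f).
Proof.
apply/L2pi_eq; have := L2piK f.
by apply: filterS => x /= fx _; rewrite !fctE fx.
Qed.

Lemma L2piN f : L2opp (L2pi f) = L2pi (- f).
Proof. by rewrite -scaleN1r -L2piZ /L2opp -scaleN1r. Qed.

Let elim (P : L2 -> Prop) : (forall f, P (L2pi f)) -> forall F, P F.
Proof. by move=> h F; rewrite -(L2reprK F). Qed.

Let L2addA : associative L2add.
Proof.
by elim/elim=> f; elim/elim=> g; elim/elim=> h; rewrite !L2piD addrA.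
Qed.

Let L2addC : commutative L2add.
Proof. by elim/elim=> f; elim/elim=> g; rewrite !L2piD addrC. Qed.

Let L2add0 : left_id (L2pi 0) L2add.
Proof. by elim/elim=> f; rewrite L2piD add0r. Qed.

Let L2addN : left_inverse (L2pi 0) L2opp L2add.
Proof. by elim/elim=> f; rewrite L2piN L2piD addNr. Qed.

HB.instance Definition _ :=
  GRing.isZmodule.Build L2 L2addA L2addC L2add0 L2addN.

Let L2scaleA a b F : L2scale a (L2scale b F) = L2scale (a * b) F.
Proof. by elim/elim: F => f; rewrite !L2piZ scalerA. Qed.

Let L2scale1 : left_id 1 L2scale.
Proof. by elim/elim=> f; rewrite L2piZ scale1r. Qed.

Let L2scaleDr : right_distributive L2scale +%R.
Proof.
move=> a; elim/elim=> f; elim/elim=> g.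
by rewrite [_ + _]L2piD !L2piZ [RHS]L2piD scalerDr.
Qed.

Let L2scaleDl F : {morph L2scale^~ F : a b / a + b}.
Proof.
by elim/elim: F => f a b /=; rewrite !L2piZ [RHS]L2piD scalerDl.
Qed.

HB.instance Definition _ := GRing.Zmodule_isLmodule.Build R[i] L2
  L2scaleA L2scale1 L2scaleDr L2scaleDl.

Lemma L2dotE f g : L2dot (L2pi f) (L2pi g) = idot f g.
Proof. by apply: ae_eq_idot; exact: L2piK. Qed.

Let L2dotDl F G H : L2dot (F + G) H = L2dot F H + L2dot G H.
Proof.
elim/elim: F => f; elim/elim: G => g; elim/elim: H => h.
by rewrite [_ + _]L2piD !L2dotE idotDl.
Qed.

Let L2dotZl a F G : L2dot (a *: F) G = a * L2dot F G.
Proof.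
by elim/elim: F => f; elim/elim: G => g; rewrite [_ *: _]L2piZ !L2dotE idotZl.
Qed.

Let L2dotC F G : L2dot F G = (L2dot G F)^*.
Proof. exact: idotC. Qed.

Let L2dot_ge0 F : 0 <= L2dot F F.
Proof. exact: idot_ge0. Qed.

Let L2dot_eq0 F : L2dot F F = 0 -> F = 0.
Proof.
move=> /idot_eq0 F0; rewrite -(L2reprK F); apply/L2pi_eq.
by move: F0; apply: filterS => x /=.
Qed.

HB.instance Definition _ := Lmodule_isPreHilbert.Build R L2
  L2dotDl L2dotZl L2dotC L2dot_ge0 L2dot_eq0.

End L2Space.

Section Circle.
Variable R : realType.

Record circle_pt := CirclePt { circle_val :> R[i]; _ : `|circle_val| == 1 }.

HB.instance Definition _ := [isSub for circle_val].
HB.instance Definition _ := [Choice of circle_pt by <:].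

Lemma circle1_subproof : `|1 : R[i]| == 1. Proof. by rewrite normr1. Qed.

HB.instance Definition _ := isPointed.Build circle_pt (CirclePt circle1_subproof).

Definition circle_open : set (set circle_pt) :=
  [set A | exists2 U : set R[i]^o, open U & A = circle_val @^-1` U].

(* The unit circle with its Borel sigma-algebra. *)
Definition circle : measurableType _ := g_sigma_algebraType circle_open.

Lemma circle_exp_subproof (t : R) :
  `|Complex (cos (2 * pi * t)) (sin (2 * pi * t))| == 1.
Proof. by rewrite normc_def /= cos2Dsin2 sqrtr1. Qed.

Definition circle_exp (t : measurableTypeR R) : circle :=
  CirclePt (circle_exp_subproof t).

Lemma measurable_circle_exp : measurable_fun [set: measurableTypeR R] circle_exp.
Proof.
apply: (@measurability _ _ _ circle _ circle_exp circle_open) => //.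
move=> _ [_ [U oU ->] <-]; rewrite setTI; apply: open_measurable.
rewrite openE => t Ut.
have := oU; rewrite openE => /(_ _ Ut); rewrite /interior/= -nbhs_ballE.
move=> [e /= e0 eU].
have [r r0 re] : exists2 r : R, 0 < r & r%:C%C = e.
  move: e0; case: (e) => a b; rewrite ltcE /= => /andP[/eqP-> a0].
  by exists a.
have cc : continuous (fun t : R => cos (2 * pi * t)).
  move=> x; apply: continuous_comp; last exact: continuous_cos.
  exact: mulrl_continuous.
have cs : continuous (fun t : R => sin (2 * pi * t)).
  move=> x; apply: continuous_comp; last exact: continuous_sin.
  exact: mulrl_continuous.
have r20 : 0 < r / 2 by rewrite divr_gt0.
have /cvgrPdist_lt/(_ _ r20) nc := cc t.
have /cvgrPdist_lt/(_ _ r20) ns := cs t.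
move: nc ns; apply: filterS2 => x /= hc hs; apply: eU.
rewrite -ball_normE /= -re.
set a := cos _ - _ in hc; set b := sin _ - _ in hs.
apply: (@le_lt_trans _ _ (`|a|%:C%C + `|b|%:C%C)); last first.
  by rewrite -rmorphD/= ltcR; lra.
rewrite [X in `|X|](_ : _ = a%:C%C + 'i%C * b%:C%C); last first.
  by rewrite /a /b; apply/eqP; rewrite eq_complex /=; apply/andP; split;
     apply/eqP; ring.
apply: (le_trans (ler_normD _ _)); rewrite normrM.
have -> : `|'i%C : R[i]| = 1 by rewrite complexiE normCi.
by rewrite mul1r !normc_def /= !expr0n/= !addr0 !sqrtr_sqr.
Qed.

(* Normalized arc length: the image of Lebesgue measure on [0, 1] under
   t |-> exp (2 i pi t). *)
Definition circle_measure : set circle -> \bar R :=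
  pushforward (mrestr (@lebesgue_measure R) (measurable_itv `[0%R, 1%R]))
    circle_exp.

HB.instance Definition _ :=
  isMeasurableFun.Build _ _ _ circle circle_exp measurable_circle_exp.

Let circle_measure0 : circle_measure set0 = 0%E.
Proof. exact: measure0. Qed.

Let circle_measure_ge0 A : (0 <= circle_measure A)%E.
Proof. exact: measure_ge0. Qed.

Let circle_measure_sigma_additive : semi_sigma_additive circle_measure.
Proof.
apply: measure_semi_sigma_additive; exact: measurable_circle_exp.
Qed.

HB.instance Definition _ := isMeasure.Build _ _ _ circle_measure
  circle_measure0 circle_measure_ge0 circle_measure_sigma_additive.

Let circle_measure_setT : circle_measure [set: circle] = 1%E.
Proof.
rewrite /circle_measure /pushforward /mrestr preimage_setT setTI.
by rewrite lebesgue_measure_itv /= lte01 oppr0 adde0.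
Qed.

HB.instance Definition _ := Measure_isProbability.Build _ _ _ circle_measure
  circle_measure_setT.

End Circle.

Section Subspaces.
Variables (R : realType) (V : preHilbertType R).
Implicit Types (A M N W : set V) (x y z : V).

Definition linear_subspace N :=
  N 0 /\ forall (a : R[i]) x y, N x -> N y -> N (a *: x + y).

Definition closed_subspace N := linear_subspace N /\ closed N.

Definition lin_span A : set V :=
  [set x | exists n (c : 'I_n -> R[i]) (v : 'I_n -> V),
     (forall i, A (v i)) /\ x = \sum_(i < n) c i *: v i].

Definition closed_span A : set V := closure (lin_span A).

(* The orthogonal complement of N in M. *)
Definition ominus M N : set V :=
  [set x | M x /\ forall y, N y -> dot x y = 0].

(* (E j) indexed by j in D; D may be finite or empty. *)
Definition orthonormal_basis W (D : set nat) (E : nat -> V) :=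
  [/\ forall j, D j -> W (E j),
      forall i j, D i -> D j -> dot (E i) (E j) = (i == j)%:R
    & closed_span (E @` D) = W].

(* Orthogonal projection of x onto N, through the choice operator: the
   characterizing y is unique when N is a subspace, and exists when N is a
   complete subspace. *)
Definition orth_proj N x : V :=
  xget 0 [set y | N y /\ forall z, N z -> dot (x - y) z = 0].

(* The adjoint at x of the operator induced by A on the invariant subspace M,
   also by choice: the value is unique, and exists by Riesz' theorem when M is
   complete and A is bounded. *)
Definition adjoint_on M (A : V -> V) x : V :=
  xget 0 [set y | M y /\ forall u, M u -> dot (A u) x = dot u y].

Definition strongly_stable (T : V -> V) :=
  forall v, (fun n => iter n T v) @ \oo --> (0 : V).

Definition joint_strong_stability (T : V -> V) :=
  strongly_stable T /\ strongly_stable (adjoint_on [set: V] T).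

Definition contractive (T : V -> V) := forall x, `|T x| <= `|x|.

Definition infinite_dimensional :=
  forall n (v : 'I_n -> V), lin_span (range v) <> [set: V].

End Subspaces.

(* T on H is similar to the operator A on the subspace N of V; U' is the
   inverse of U : H -> N. *)
Definition similar_on (R : realType) (H V : preHilbertType R)
    (T : H -> H) (N : set V) (A : V -> V) :=
  exists (U : {linear H -> V}) (U' : V -> H),
    [/\ forall x, N (U x), forall x, U' (U x) = x, forall f, N f -> U (U' f) = f,
        (exists c : R[i], forall x, `|U x| <= c * `|x|)
          /\ (exists c : R[i], forall f, N f -> `|U' f| <= c * `|f|)
      & forall f, N f -> U (T (U' f)) = A f].

Notation L2circle K := (L2 (@circle_measure _) K).

Section Hardy.
Variables (R : realType) (K : sepHilbertType R).

(* c is the (weak) integral of z ^ (- n) *: f z over the circle. *)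
Definition is_fourier_coef (f : L2circle K) (n : int) (c : K) :=
  forall k : K, dot c k =
    cintegral (@circle_measure R) (fun z => circle_val z ^ (- n) * dot (f z) k).

Definition hardy : set (L2circle K) :=
  [set f | forall n : int, n < 0 -> is_fourier_coef f n 0].

Lemma cmeasurable_circle_val : cmeasurable (@circle_val R : circle R -> R[i]).
Proof.
have m (p : R[i] -> R) : (forall z w, `|p z - p w|%:C%C <= `|z - w|) ->
    measurable_fun [set: circle R] (p \o @circle_val R).
  move=> pl; apply: (measurability _ (RGenOInfty.measurableE R)) => //.
  move=> _ [_ [a ->] <-]; rewrite setTI; apply: sub_sigma_algebra.
  exists (p @^-1` `]a, +oo[) => //.
  rewrite openE => z /=; rewrite in_itv/= andbT => az.
  rewrite /interior -nbhs_ballE; exists (p z - a)%:C%C => /=.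
    by rewrite ltcR subr_gt0.
  move=> w; rewrite -ball_normE /= => zw; rewrite in_itv/= andbT.
  have := le_lt_trans (pl z w) zw; rewrite ltcR ltr_norml => /andP[_]; lra.
split; apply: m => z w.
  by rewrite -cReN -cReD normc_ge_Re.
have -> : `|z - w| = `|(z - w) * 'i%C| by rewrite normrM complexiE normCi mulr1.
apply: le_trans (normc_ge_Re _); rewrite lecR ReiNIm normrN.
by rewrite -cImN -cImD.
Qed.

Lemma zshift_subproof (f : L2circle K) :
  (fun z : circle R => circle_val z *: f z) \in L2pred (@circle_measure R) K.
Proof.
have [mf fi] := L2funP f; apply/asboolP; split.
  by apply: vmeasurableM => //; exact: cmeasurable_circle_val.
under eq_integral => z _.
  have -> : sqnorm (circle_val z *: f z) = sqnorm (f z).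
    by rewrite /sqnorm normrZ (eqP (valP z)) mul1r.
  over.
exact: fi.
Qed.

(* Multiplication by z on L^2; it leaves the Hardy space invariant. *)
Definition zshift (f : L2circle K) : L2circle K :=
  L2pi (MkL2fun (zshift_subproof f)).

Definition model_space (N : set (L2circle K)) :=
  [/\ N `<=` hardy, closed_subspace N
    & forall f, N f -> N (adjoint_on hardy zshift f)].

Definition shift_compression (N : set (L2circle K)) (f : L2circle K) :
    L2circle K :=
  orth_proj N (zshift f).

(* W = ominus M (zshift @` M) lies in a separable space, so its orthonormal
   bases are countable. The a.e. condition depends neither on the
   representatives of the E j nor on the basis of W. *)
Definition full_range (M : set (L2circle K)) :=
  exists (D : set nat) (E : nat -> L2circle K),
    orthonormal_basis (ominus M (zshift @` M)) D E /\
    {ae @circle_measure R, forall z,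
       closed_span [set E j z | j in D] = [set: K]}.

End Hardy.
Arguments hardy {R} K _.

(* Main.v *)
From HB Require Import structures.
Require Import Defs.
From mathcomp Require Import all_boot all_order all_algebra.
From mathcomp Require Import all_classical all_reals all_analysis.
From mathcomp Require Import measurable_realfun complex ring lra zify.
Import Order.TTheory GRing.Theory Num.Theory.
Import numFieldNormedType.Exports.

Set Implicit Arguments.
Unset Strict Implicit.
Unset Printing Implicit Defensive.

Local Open Scope classical_set_scope.
Local Open Scope ring_scope.

(** Write [M] for the orthogonal complement of a model space [N] in the Hardy space,
    [P] for the projection onto [N], and [J(z)] for the closed span of the values at
    [z] of an orthonormal basis [E_j] of the wandering subspace [W] of [M].

    The heart of the matter is that full range of [M] is the same as strong stability
    of the compression [A_N]. Indeed [A_N^n f = P (z^n f)] for [f] in [N], and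
    [|P (z^n f)|] is the distance from [f] to [z^-n M]. So the compression is strongly
    stable exactly when the union of the increasing subspaces [z^-n M] is dense in
    [L^2]. If [M] is full range, a function orthogonal to this union is orthogonal to
    all [z^n E_j] with [n] an integer; by uniqueness of Fourier coefficients it is
    pointwise orthogonal to [J(z) = K], hence zero ([full_range_compression_stable]).
    Conversely, the union consists of functions with values in [J(z)], a condition
    that is closed in [L^2]; if the union is dense, the constants satisfy it, and
    [J(z) = K] almost everywhere ([stable_full_range]).

    The adjoint of a compression is the restriction of the backward shift, which is
    always strongly stable because the tails of a Fourier series tend to 0. Both
    stability properties are invariant under similarity, which gives one direction
    ([similar_joint_stability]).

    For the other direction take [K = H] and let [D] be the positive square root of
    [1 - T T*]. Since [|D x|^2 = |x|^2 - |T* x|^2], the map sending [x] to the series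
    [sum_n z^n D T*^n x] is an isometry of [H] into the Hardy space as soon as [T*] is
    strongly stable. It intertwines [T*] with the backward shift, so its range is a
    model space [N] and [T] is unitarily equivalent to [A_N]; as [T] is strongly
    stable, the complement of [N] is full range ([stable_has_model]).

    The functional analysis behind this is developed first: orthogonal projections
    and the Riesz representation, square roots of operators, completeness of the
    spaces of square-integrable vector functions, and uniqueness of Fourier
    coefficients of integrable functions on the circle. *)

(** * Norms, inner products and limits *)
Section RealSequences.
Variable R : realType.
Implicit Types (u v : nat -> R) (a b c : R).

Lemma cvg0D u v : u @ \oo --> (0 : R) -> v @ \oo --> (0 : R) ->
  (fun n => u n + v n) @ \oo --> (0 : R).
Proof. by move=> u0 v0; rewrite -(addr0 (0 : R)); exact: cvgD. Qed.

Lemma cvg0Zl c u : u @ \oo --> (0 : R) -> (fun n => c * u n) @ \oo --> (0 : R).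
Proof. by move=> u0; rewrite -(mulr0 c); apply: cvgM => //; exact: cvg_cst. Qed.

Lemma cvg0_sqr u : u @ \oo --> (0 : R) -> (fun n => u n ^+ 2) @ \oo --> (0 : R).
Proof. by move=> u0; rewrite -(mulr0 (0 : R)); exact: cvgM. Qed.

Lemma le_of_vanishing u a b : u @ \oo --> (0 : R) ->
  (forall n, a <= b + u n) -> a <= b.
Proof.
move=> u0 h; apply/ler_addgt0Pr => e e0.
have /cvgrPdist_lt/(_ e e0)[n _ /(_ n (leqnn n)) /=] := u0.
rewrite sub0r normrN => /(le_lt_trans (ler_norm _)) un.
by apply: le_trans (h n) _; rewrite lerD2l ltW.
Qed.

Lemma cvg0_squeeze u v : (forall n, 0 <= u n <= v n) -> v @ \oo --> (0 : R) ->
  u @ \oo --> (0 : R).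
Proof.
move=> uv v0; apply: (@squeeze_cvgr _ _ _ _ (fun=> 0) v) => //; last exact: cvg_cst.
by near=> n; exact: uv.
Unshelve. all: by end_near. Qed.

Lemma cvg_sub0 u a : (fun n => u n - a) @ \oo --> (0 : R) -> u @ \oo --> a.
Proof.
move=> /cvgrPdist_lt u0; apply/cvgrPdist_lt => e e0.
by apply: filterS (u0 e e0) => n; rewrite sub0r opprB.
Qed.

Lemma cvg_norm_le u a c : (forall n, `|u n| <= c) -> u @ \oo --> a -> `|a| <= c.
Proof.
move=> uc ua; have h : (fun n => `|u n - a|) @ \oo --> (0 : R).
  apply/cvgrPdist_lt => e e0; move/cvgrPdist_lt: ua => /(_ e e0).
  by apply: filterS => n; rewrite sub0r normrN normr_id distrC.
apply: (le_of_vanishing h) => n; have := uc n; have := ler_normB (u n) (u n - a).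
rewrite subKr; lra.
Qed.

End RealSequences.

Lemma gt0_complexE (R : realType) (e : R[i]) : 0 < e -> e = (complex.Re e)%:C%C.
Proof. by case: e => a b; rewrite ltcE /= => /andP[/eqP -> _]. Qed.

Section RealNorm.
Variables (R : realType) (V : preHilbertType R).
Implicit Types (x y z : V) (a : R[i]).

(** The norm of a normed module over [R[i]] is a complex number; its real part
    lets real inequalities and real limits be used. *)
Definition nrm x : R := complex.Re `|x|.

Lemma nrmE x : `|x| = (nrm x)%:C%C.
Proof.
rewrite /nrm; have : 0 <= `|x| by [].
by case: (`|x|) => a b; rewrite lecE /= => /andP[/eqP -> _].
Qed.

Lemma nrm_ge0 x : 0 <= nrm x.
Proof. by rewrite -lecR -nrmE normr_ge0. Qed.

Lemma nrm_sq x : nrm x ^+ 2 = sqnorm x.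
Proof. by rewrite /sqnorm nrmE -rmorphXn. Qed.

Lemma nrm_eq0 x : nrm x = 0 -> x = 0.
Proof. by move=> x0; apply: sqnorm_eq0; rewrite -nrm_sq x0 expr0n. Qed.

Lemma nrm0 : nrm (0 : V) = 0.
Proof. by rewrite /nrm normr0. Qed.

Lemma nrmD x y : nrm (x + y) <= nrm x + nrm y.
Proof. by rewrite -lecR rmorphD /= -!nrmE; exact: ler_normD. Qed.

Lemma nrmN x : nrm (- x) = nrm x.
Proof. by rewrite /nrm normrN. Qed.

Lemma nrmBC x y : nrm (x - y) = nrm (y - x).
Proof. by rewrite -nrmN opprB. Qed.

Lemma nrmZ a x : nrm (a *: x) = complex.Re `|a| * nrm x.
Proof. by rewrite {1}/nrm normrZ nrmE cReM /= mulr0 subr0. Qed.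

Lemma nrmZR (t : R) x : nrm (t%:C%C *: x) = `|t| * nrm x.
Proof. by rewrite nrmZ normc_def /= expr0n addr0 sqrtr_sqr. Qed.

Lemma Re_norm_ge0 a : 0 <= complex.Re `|a|.
Proof. by rewrite normc_def /= sqrtr_ge0. Qed.

Lemma sqnormN x : sqnorm (- x) = sqnorm x.
Proof. by rewrite -!nrm_sq nrmN. Qed.

Lemma sqnormBC x y : sqnorm (x - y) = sqnorm (y - x).
Proof. by rewrite -sqnormN opprB. Qed.

Lemma dotBl x y z : dot (x - y) z = dot x z - dot y z.
Proof. by rewrite dotDl dotNl. Qed.

Lemma dotBr x y z : dot x (y - z) = dot x y - dot x z.
Proof. by rewrite dotDr dotNr. Qed.

Lemma dot_sym0 x y : dot x y = 0 -> dot y x = 0.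
Proof. by rewrite dotC => /eqP; rewrite conjC_eq0 => /eqP. Qed.

Lemma dotxx_eq0 x : dot x x = 0 -> x = 0.
Proof. by move=> x0; apply: sqnorm_eq0; rewrite sqnorm_dot x0. Qed.

Lemma dotxxE x : dot x x = (sqnorm x)%:C%C.
Proof. by rewrite dot_norm sqnormE. Qed.

Lemma dot_inj x y : (forall z, dot x z = dot y z) -> x = y.
Proof.
move=> xy; apply/eqP; rewrite -subr_eq0; apply/eqP/dotxx_eq0.
by rewrite dotBl xy subrr.
Qed.

Lemma Re_normE a : (complex.Re `|a|)%:C%C = `|a|.
Proof. by rewrite normc_def. Qed.

Lemma Re_norm_sq a : (complex.Re `|a|) ^+ 2 = complex.Re a ^+ 2 + complex.Im a ^+ 2.
Proof. by rewrite normc_def /= sqr_sqrtr // addr_ge0 ?sqr_ge0. Qed.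

Lemma norm_le_ReIm a : complex.Re `|a| <= `|complex.Re a| + `|complex.Im a|.
Proof.
rewrite -(ler_pXn2r (n := 2)) ?nnegrE ?addr_ge0 ?Re_norm_ge0// Re_norm_sq.
rewrite sqrrD !real_normK ?num_real// addrAC lerDl mulrn_wge0// mulr_ge0//.
Qed.

Lemma sqnormZ_norm a x : sqnorm (a *: x) = complex.Re `|a| ^+ 2 * sqnorm x.
Proof. by rewrite -!nrm_sq nrmZ exprMn. Qed.

Lemma cauchy_schwarz x y : complex.Re `|dot x y| <= nrm x * nrm y.
Proof.
have [y0|yN0] := eqVneq (sqnorm y) 0.
  by rewrite (sqnorm_eq0 y0) dot0r normr0 nrm0 mulr0.
have y_gt0 : 0 < sqnorm y by rewrite lt_def yN0 sqnorm_ge0.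
rewrite -(ler_pXn2r (n := 2)) ?nnegrE ?mulr_ge0 ?nrm_ge0 ?Re_norm_ge0 //.
rewrite exprMn !nrm_sq.
have := sqnorm_ge0 ((sqnorm y)%:C%C *: x - dot x y *: y).
rewrite sqnormB !sqnormZ_norm dotZl dotZr (_ : (sqnorm y)%:C%C * _ =
   (sqnorm y * complex.Re `|dot x y| ^+ 2)%:C%C); last first.
  by rewrite [X in _ * X]mulrC -normCK rmorphM rmorphXn /= Re_normE.
rewrite [complex.Re `|(sqnorm y)%:C%C| ^+ 2]Re_norm_sq /= expr0n addr0.
set p := complex.Re `|dot x y| ^+ 2.
rewrite (_ : _ + _ - _ = sqnorm y * (sqnorm x * sqnorm y - p)); last by rewrite /=; ring.
by rewrite pmulr_rge0// subr_ge0.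
Qed.

Lemma Re_dot_le_nrm x y : complex.Re (dot x y) <= nrm x * nrm y.
Proof.
apply: le_trans (cauchy_schwarz x y); rewrite -lecR Re_normE.
apply: le_trans (normc_ge_Re _); rewrite lecR; exact: ler_norm.
Qed.

Lemma cvg_nrmP (u : nat -> V) l :
  u @ \oo --> l <-> (fun n => nrm (u n - l)) @ \oo --> (0 : R).
Proof.
split=> [/cvgrPdist_lt ul|/cvgrPdist_lt ul].
  apply/cvgrPdist_lt => e e0.
  have := ul e%:C%C; rewrite ltcR => /(_ e0); apply: filterS => n.
  by rewrite sub0r normrN ger0_norm ?nrm_ge0// nrmE ltcR nrmBC.
apply/cvgrPdist_lt => e e0.
have eE := gt0_complexE e0.
have := ul (complex.Re e); rewrite -ltcR -eE => /(_ e0); apply: filterS => n.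
by rewrite sub0r normrN ger0_norm ?nrm_ge0// nrmE eE ltcR nrmBC.
Qed.

Lemma cvg_sqnormP (u : nat -> V) l :
  u @ \oo --> l <-> (fun n => sqnorm (u n - l)) @ \oo --> (0 : R).
Proof.
rewrite cvg_nrmP; split=> ul.
  by under eq_fun do rewrite -nrm_sq; exact: cvg0_sqr.
have -> : (fun n => nrm (u n - l)) = (fun n => Num.sqrt (sqnorm (u n - l))).
  by apply/funext => n; rewrite -nrm_sq sqrtr_sqr ger0_norm ?nrm_ge0.
rewrite -(@sqrtr0 R).
by apply: (cvg_comp _ _ ul); exact: sqrt_continuous.
Qed.

Lemma cvg_dot (u v : nat -> V) l m : u @ \oo --> l -> v @ \oo --> m ->
  (fun n => dot (u n) (v n) : R[i]^o) @ \oo --> (dot l m : R[i]^o).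
Proof.
move=> /cvg_nrmP ul /cvg_nrmP vm.
pose d n := nrm (u n - l) * nrm (v n - m) + (nrm m * nrm (u n - l) +
  nrm l * nrm (v n - m)).
have /cvgrPdist_lt d0 : d @ \oo --> (0 : R).
  apply: cvg0D; last by apply: cvg0D; exact: cvg0Zl.
  by rewrite -(mulr0 (0 : R)); exact: cvgM.
apply/cvgrPdist_lt => e e0.
have eE := gt0_complexE e0.
have := d0 (complex.Re e); rewrite -ltcR -eE => /(_ e0); apply: filterS => n.
rewrite sub0r normrN => /(le_lt_trans (ler_norm _)) dn.
rewrite -Re_normE eE ltcR; apply: le_lt_trans dn.
have -> : dot l m - dot (u n) (v n) =
    - (dot (u n - l) (v n - m) + (dot (u n - l) m + dot l (v n - m))).
  by rewrite !(dotBl, dotBr); ring.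
rewrite normrN -lecR Re_normE /d !rmorphD /=.
apply: le_trans (ler_normD _ _) _; apply: lerD.
  by rewrite -Re_normE lecR cauchy_schwarz.
apply: le_trans (ler_normD _ _) _; apply: lerD.
  by rewrite -Re_normE lecR mulrC cauchy_schwarz.
by rewrite -Re_normE lecR cauchy_schwarz.
Qed.

(** How every identity between inner products of limits is obtained from the
    same identity along the sequences. *)
Lemma dot_lim_eq (u v u' v' : nat -> V) l m l' m' :
  u @ \oo --> l -> v @ \oo --> m -> u' @ \oo --> l' -> v' @ \oo --> m' ->
  (forall n, dot (u n) (v n) = dot (u' n) (v' n)) -> dot l m = dot l' m'.
Proof.
move=> ul vm ul' vm' e; have h := cvg_dot ul vm; have h' := cvg_dot ul' vm'.
apply: (cvg_unique (@norm_hausdorff _ R[i]^o) h).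
by rewrite (_ : (fun n => _) = (fun n => dot (u' n) (v' n) : R[i]^o)) //; exact/funext.
Qed.

Lemma cvg_dot_eq0 (u : nat -> V) l z : u @ \oo --> l ->
  (forall n, dot (u n) z = 0) -> dot l z = 0.
Proof.
move=> ul u0; rewrite -(dot0l z); apply: (dot_lim_eq ul (cvg_cst z)
  (cvg_cst 0) (cvg_cst z)) => n.
by rewrite u0 dot0l.
Qed.

Lemma closed_seqP (A : set V) : closed A <->
  forall (u : nat -> V) l, (forall n, A (u n)) -> u @ \oo --> l -> A l.
Proof.
split=> [cA u l uA ul|h].
  by apply: (@closed_cvg _ _ _ _ u A cA _ l ul); exact: nearW.
move=> l cl.
have /choice[u uP] : forall n : nat, exists y, A y /\ nrm (y - l) < n.+1%:R^-1.
  move=> n; have [|y [Ay]] := cl (ball l (n.+1%:R^-1)%:C%C).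
    by apply: nbhsx_ballx; rewrite ltcR invr_gt0.
  by rewrite -ball_normE /= nrmE ltcR nrmBC => yl; exists y.
apply: (h u l) => [n|]; first by case: (uP n).
apply/cvg_nrmP; apply: (cvg0_squeeze _ (@cvg_harmonic R)) => n.
by rewrite nrm_ge0 ltW//; case: (uP n).
Qed.

Lemma closure_approx (A : set V) l : closure A l <->
  forall e : R, 0 < e -> exists2 y, A y & nrm (y - l) < e.
Proof.
split=> [cl e e0|h B /nbhs_ballP[e /= e0 eB]].
  have [|y [Ay]] := cl (ball l e%:C%C).
    by apply: nbhsx_ballx; rewrite ltcR.
  by rewrite -ball_normE /= nrmE ltcR nrmBC => yl; exists y.
have eE := gt0_complexE e0.
have [|y Ay yl] := h (complex.Re e); first by rewrite -ltcR -eE.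
by exists y; split=> //; apply: eB; rewrite -ball_normE /= nrmE eE ltcR nrmBC.
Qed.

Implicit Types B : set V.

Lemma lin0 B : linear_subspace B -> B 0.
Proof. by case. Qed.

Lemma linZD B a x y : linear_subspace B -> B x -> B y -> B (a *: x + y).
Proof. by move=> [_]; exact. Qed.

Lemma linD B x y : linear_subspace B -> B x -> B y -> B (x + y).
Proof. by move=> lB Bx By; rewrite -[x]scale1r; exact: linZD. Qed.

Lemma linZ B a x : linear_subspace B -> B x -> B (a *: x).
Proof. by move=> lB Bx; rewrite -[_ *: _]addr0; apply: linZD => //; exact: lin0. Qed.

Lemma linN B x : linear_subspace B -> B x -> B (- x).
Proof. by move=> lB Bx; rewrite -scaleN1r; exact: linZ. Qed.

Lemma linB B x y : linear_subspace B -> B x -> B y -> B (x - y).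
Proof. by move=> lB Bx By; apply: linD => //; exact: linN. Qed.

Lemma parallelogram x y :
  sqnorm (x - y) = 2 * sqnorm x + 2 * sqnorm y - sqnorm (x + y).
Proof. by rewrite sqnormB sqnormD; ring. Qed.

(** Moving from [y] by the multiple [t <v, z> z], where [v = x - y], changes the
    squared distance by [t^2 |<v, z>|^2 |z|^2 - 2 t |<v, z>|^2], which is negative
    for a small [t > 0] unless [<v, z> = 0]. *)
Lemma minimal_orth B x y : linear_subspace B -> B y ->
  (forall z, B z -> sqnorm (x - y) <= sqnorm (x - z)) ->
  forall z, B z -> dot (x - y) z = 0.
Proof.
move=> lB By ymin z Bz; set v := x - y.
set a := dot v z; set p := complex.Re a ^+ 2 + complex.Im a ^+ 2.
have p0 : 0 <= p by rewrite addr_ge0 ?sqr_ge0.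
have h (t : R) : 0 <= t ^+ 2 * p * sqnorm z - 2 * t * p.
  have := ymin (y + (t%:C%C * a) *: z) (linD lB By (linZ _ lB Bz)).
  rewrite opprD addrA -/v (sqnormB v) sqnormZ dotZr -/a !cReM !cImM cReJ cImJ.
  rewrite !(cReM, cImM) [complex.Re t%:C%C]/= [complex.Im t%:C%C]/= /p; lra.
have p_eq0 : p = 0.
  have := sqnorm_ge0 z; set s := sqnorm z in h *.
  (* the parameter t = 1 / (1 + |z|^2) is small enough *)
  move=> s0; have := h (1 + s)^-1; set t := (1 + s)^-1.
  have t0 : 0 < t by rewrite invr_gt0; lra.
  have -> : t ^+ 2 * p * s - 2 * t * p = - (t ^+ 2 * p * (2 + s)).
    by rewrite /t; field; rewrite lt0r_neq0 //; lra.
  rewrite oppr_ge0 => h1; apply/eqP; rewrite eq_le p0 andbT.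
  have t20 : 0 < t ^+ 2 by rewrite exprn_gt0.
  move: h1; rewrite pmulr_lle0; last by lra.
  by rewrite pmulr_rle0.
by apply/eqP; rewrite -normr_eq0 -Re_normE -sqrf_eq0 -rmorphXn /= Re_norm_sq -/p p_eq0.
Qed.

End RealNorm.

Lemma linear_subE (R : realType) (V W : lmodType R[i]) (f : V -> W) :
  (forall a x y, f (a *: x + y) = a *: f x + f y) ->
  forall x y, f (x - y) = f x - f y.
Proof. by move=> fl x y; rewrite addrC -scaleN1r fl scaleN1r addrC. Qed.

Lemma nrm_eq_sqnorm (R : realType) (V W : preHilbertType R) (x : V) (y : W) :
  sqnorm x = sqnorm y -> nrm x = nrm y.
Proof.
by move=> xy; apply/eqP; rewrite -(eqrXn2 (n := 2))// ?nrm_ge0// !nrm_sq xy.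
Qed.

(** * Orthogonal projections in Hilbert spaces *)
Section HilbertGeometry.
Variables (R : realType) (V : hilbertType R).
Implicit Types (x y z : V) (B : set V).

(** The form in which completeness is used below: all the sequences met here
    have explicit bounds on [|u_m - u_n|^2] that depend on the smaller index. *)
Lemma cvg_of_majorant (u : nat -> V) (d : nat -> R) :
  d @ \oo --> (0 : R) ->
  (forall n m, (n <= m)%N -> sqnorm (u m - u n) <= d n) ->
  exists l : V, u @ \oo --> l.
Proof.
move=> d0 ud.
suff : cvg (u @ \oo) by move=> cu; exists (lim (u @ \oo)); exact: cu.
apply/cauchy_cvgP; apply/cauchyP => e e0.
have eE := gt0_complexE e0.
have r0 : 0 < complex.Re e by rewrite -ltcR -eE.
have /cvgrPdist_lt/(_ (complex.Re e ^+ 2)) := d0; rewrite exprn_gt0// => /(_ isT).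
move=> [n _ nd]; exists (u n); exists n => // m /= nm.
rewrite -ball_normE /= nrmE eE ltcR nrmBC.
rewrite -(ltr_pXn2r (n := 2)) ?nnegrE ?nrm_ge0 ?ltW// nrm_sq.
apply: le_lt_trans (ud _ _ nm) _.
have /= := nd n (leqnn n); rewrite sub0r normrN.
exact: le_lt_trans (ler_norm _).
Qed.

(** The parallelogram law makes every minimizing sequence for the distance from
    [x] to [B] a Cauchy sequence; its limit is a closest point. *)
Lemma projection_exists B : closed_subspace B -> forall x,
  exists y, B y /\ forall z, B z -> dot (x - y) z = 0.
Proof.
move=> [lB cB] x.
pose A := [set r | exists2 y, B y & r = sqnorm (x - y)].
have A0 : A !=set0 by exists (sqnorm (x - 0)), 0 => //; exact: lin0.
have Alb : has_lbound A by exists 0 => r [y _ ->]; exact: sqnorm_ge0.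
have hA : has_inf A by [].
have /choice[u uP] : forall n : nat, exists y,
    B y /\ sqnorm (x - y) < inf A + n.+1%:R^-1.
  move=> n; have n0 : 0 < n.+1%:R^-1 :> R by rewrite invr_gt0.
  have [r [y By ->] ry] := inf_adherent n0 hA.
  by exists y.
have infA y : B y -> inf A <= sqnorm (x - y).
  by move=> By; apply: ge_inf => //; exists y.
have [l ul] : exists l : V, u @ \oo --> l.
  apply: (@cvg_of_majorant _ (fun n => 4 * @harmonic R n)).
    exact/cvg0Zl/cvg_harmonic.
  move=> n m nm; have [Bn un] := uP n; have [Bm um] := uP m.
  have := infA (2^-1 *: (u m + u n)) (linZ _ lB (linD lB Bm Bn)).
  have -> : x - 2^-1 *: (u m + u n) = 2^-1 *: ((x - u m) + (x - u n)).
    have -> : x - u m + (x - u n) = 2 *: x - (u m + u n).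
      by rewrite scaler_nat mulr2n opprD addrACA.
    by rewrite scalerBr scalerA mulVf ?scale1r// pnatr_eq0.
  rewrite sqnormZ_norm; have -> : complex.Re `|2^-1 : R[i]| = 2^-1.
    by rewrite normfV normr_nat -(rmorph_nat (real_complex R)) -fmorphV.
  have : (m.+1%:R^-1 : R) <= n.+1%:R^-1.
    by rewrite lef_pV2 ?posrE// ler_nat.
  have -> : u m - u n = (x - u n) - (x - u m) by rewrite opprB [RHS]addrC subrKA.
  rewrite (parallelogram (x - u n)) (addrC (x - u n)) /harmonic /= expr2.
  move: un um; set p := n.+1%:R^-1; set q := m.+1%:R^-1; set s := sqnorm (_ + _).
  set a := sqnorm (x - u n); set b := sqnorm (x - u m); lra.
have Bl : B l.
  by apply: ((closed_seqP B).1 cB u l _ ul) => n; case: (uP n).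
exists l; split => //; apply: minimal_orth => // z Bz.
apply: le_trans (infA _ Bz).
pose e n := nrm (u n - l); have e0 : e @ \oo --> (0 : R) by apply/cvg_nrmP.
pose c := 2 * (inf A + 2).
apply: (@le_of_vanishing _ (fun n => harmonic n + (e n ^+ 2 + c * e n))).
  apply: cvg0D; first exact: cvg_harmonic.
  by apply: cvg0D; [exact: cvg0_sqr|exact: cvg0Zl].
move=> n; have [Bn un] := uP n; have {}un : sqnorm (x - u n) < inf A + harmonic n by [].
have -> : x - l = (x - u n) + (u n - l) by rewrite addrA subrK.
rewrite sqnormD -(nrm_sq (u n - l)) -/(e n).
have := Re_dot_le_nrm (x - u n) (u n - l); rewrite -/(e n).
have e_ge0 : 0 <= e n by exact: nrm_ge0.
have h1 : (harmonic n : R) <= 1 by rewrite /harmonic invf_le1// ler1n.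
have n0 := nrm_ge0 (x - u n).
have : nrm (x - u n) <= inf A + 2.
  have := nrm_sq (x - u n); nra.
rewrite /c; nra.
Qed.


Section Projection.
Variables (B : set V) (clB : closed_subspace B).

Lemma orth_projP x : B (orth_proj B x) /\ forall z, B z -> dot (x - orth_proj B x) z = 0.
Proof. by have := projection_exists clB x; rewrite /orth_proj => /(xgetPex 0). Qed.

Lemma orth_proj_unique x y : B y -> (forall z, B z -> dot (x - y) z = 0) ->
  orth_proj B x = y.
Proof.
move=> By xy; have [Bp xp] := orth_projP x; have [lB _] := clB.
apply/eqP; rewrite -subr_eq0; apply/eqP/dotxx_eq0.
have Bd : B (orth_proj B x - y) by exact: linB.
have {1}-> : orth_proj B x - y = (x - y) - (x - orth_proj B x).
  by rewrite opprB [RHS]addrC subrKA.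
by rewrite dotBl xy// xp// subrr.
Qed.

End Projection.

(** The functional is a multiple of the inner product with a vector [e] that is
    orthogonal to its kernel. Working on a closed subspace [B] covers functionals
    that are defined only on a model space. *)
Lemma riesz B (l : V -> R[i]) (c : R) : closed_subspace B ->
  (forall a x y, B x -> B y -> l (a *: x + y) = a * l x + l y) ->
  (forall x, B x -> complex.Re `|l x| <= c * nrm x) ->
  exists2 y, B y & forall x, B x -> l x = dot x y.
Proof.
move=> clB ll lc; have [lB cB] := clB.
have l0 : l 0 = 0.
  by have := ll (-1) 0 0 (lin0 lB) (lin0 lB); rewrite scaler0 addr0 mulN1r addNr.
have lZ a x : B x -> l (a *: x) = a * l x.
  by move=> Bx; have := ll a x 0 Bx (lin0 lB); rewrite !addr0 l0 addr0.
have lB' x y : B x -> B y -> l (x - y) = l x - l y.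
  by move=> Bx By; rewrite addrC -scaleN1r ll// mulN1r addrC.
pose ker := [set x | B x /\ l x = 0].
have clk : closed_subspace ker.
  split; first split; first by split => //; exact: lin0.
    by move=> a x y [Bx x0] [By y0]; split; [exact: linZD|rewrite ll// x0 y0 mulr0 addr0].
  apply/closed_seqP => u x uk ux.
  have Bx : B x by apply: ((closed_seqP B).1 cB u x _ ux) => n; case: (uk n).
  split => //; apply/eqP; rewrite -normr_eq0 -Re_normE; apply/eqP; congr (_%:C%C).
  apply/eqP; rewrite eq_le Re_norm_ge0 andbT.
  have /cvg_nrmP e0 := ux.
  apply: (le_of_vanishing (cvg0Zl c e0)) => n; have [Bu u0] := uk n.
  rewrite add0r nrmBC; apply: le_trans (lc _ (linB lB Bx Bu)).
  by rewrite lB'// u0 subr0.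
have [[x0 [Bx0 lx0]]|no] := pselect (exists x, B x /\ l x <> 0); last first.
  exists 0 => [|x Bx]; first exact: lin0.
  by rewrite dot0r; apply: contrapT => lx; apply: no; exists x.
pose e := x0 - orth_proj ker x0; have [[Bp lp] pk] := orth_projP clk x0.
have Be : B e by exact: linB.
have le : l e = l x0 by rewrite /e lB'// lp subr0.
have e0 : dot e e != 0.
  by apply/eqP => /dotxx_eq0 e0; apply: lx0; rewrite -le e0.
exists ((l e / dot e e)^* *: e) => [|x Bx]; first exact: linZ.
rewrite dotZr conjCK.
have : ker (x - (l x / l e) *: e).
  split; first by apply: linB => //; exact: linZ.
  rewrite lB' ?lZ ?divfK ?subrr ?le//; [exact/eqP|exact: linZ].
move=> /pk; rewrite -/e => /dot_sym0; rewrite dotBl dotZl => /eqP.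
rewrite subr_eq0 => /eqP ->; field; rewrite e0 andbT; by rewrite le; exact/eqP.
Qed.

(** Since [B m] lies in [B n] for [n <= m], the Pythagorean identity
    [|b_n - b_m|^2 = |b_n|^2 - |b_m|^2] holds, and the decreasing squared norms make
    the projections a Cauchy sequence. The limit lies in every [B n]. *)
Lemma decreasing_projections (B : nat -> set V) (b : nat -> V) x :
  (forall n, closed (B n)) ->
  (forall n m, (n <= m)%N -> B m `<=` B n) ->
  (forall n, B n (b n) /\ forall z, B n z -> dot (x - b n) z = 0) ->
  \bigcap_n B n `<=` [set 0] ->
  b @ \oo --> (0 : V).
Proof.
move=> cB dB bP B0.
have pyth n m : (n <= m)%N -> sqnorm (b m - b n) = sqnorm (b n) - sqnorm (b m).
  move=> nm; have [_ on] := bP n; have [Bm om] := bP m.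
  have : dot (b n - b m) (b m) = 0.
    have -> : b n - b m = (x - b m) - (x - b n) by rewrite opprB [RHS]addrC subrKA.
    by rewrite dotBl om// on ?subrr//; exact: dB nm _ Bm.
  rewrite dotBl => /eqP; rewrite subr_eq0 => /eqP h.
  by rewrite sqnormBC sqnormB h -sqnorm_dot; ring.
have dec n m : (n <= m)%N -> sqnorm (b m) <= sqnorm (b n).
  by move=> nm; have := sqnorm_ge0 (b m - b n); rewrite pyth// subr_ge0.
pose s n := sqnorm (b n).
have cs : cvg (s @ \oo).
  apply: nonincreasing_is_cvgn; first by move=> n m; exact: dec.
  by exists 0 => _ [n _ <-]; exact: sqnorm_ge0.
have [l bl] : exists l : V, b @ \oo --> l.
  apply: (@cvg_of_majorant _ (fun n => s n - lim (s @ \oo))).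
    by have h := cvgB cs (cvg_cst (lim (s @ \oo))); rewrite subrr in h; exact: h.
  move=> n m nm; rewrite pyth// lerD2l lerN2.
  apply: nonincreasing_cvgn_ge => //; by move=> i j; exact: dec.
suff : l = 0 by move=> <-.
apply: B0 => n _.
have h : (fun m => b (m + n)%N) @ \oo --> l by rewrite cvg_shiftn.
apply: ((closed_seqP (B n)).1 (cB n) _ _ _ h) => m.
by apply: (dB _ _ (leq_addl m n)); case: (bP (m + n)%N).
Qed.

End HilbertGeometry.

(** * Adjoints and positive square roots *)
Section Adjoint.
Variable R : realType.

Lemma adjoint_on_unique (V : preHilbertType R) (M : set V) (A : V -> V) x y :
  linear_subspace M -> M y -> (forall u, M u -> dot (A u) x = dot u y) ->
  adjoint_on M A x = y.
Proof.
move=> lM My Ay; rewrite /adjoint_on; case: xgetP => [z _ [Mz Az]|/(_ y)[]//].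
apply/eqP; rewrite -subr_eq0; apply/eqP/dotxx_eq0.
have Md : M (z - y) by exact: linB.
by rewrite dotBr -Az// -Ay// subrr.
Qed.

Lemma adjoint_contraction (V : hilbertType R) (T : {linear V -> V}) :
  contractive T ->
  forall u x, dot (T u) x = dot u (adjoint_on [set: V] T x).
Proof.
move=> cT u x.
have clT : closed_subspace [set: V] by split; [split|exact: closedT].
have [a y z _ _|y _|y _ h] := riesz (l := fun u => dot (T u) x) (c := nrm x) clT.
- by rewrite linearP dotDl dotZl.
- apply: le_trans (cauchy_schwarz _ _) _; rewrite mulrC ler_wpM2l ?nrm_ge0//.
  by rewrite -lecR -!nrmE; exact: cT.
- by rewrite (adjoint_on_unique clT.1 (y := y)) ?h// => v _; exact: h.
Qed.

End Adjoint.

Section SquareRoot.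
Variables (R : realType) (V : hilbertType R) (A : V -> V).
Hypothesis A_linear : forall a x y, A (a *: x + y) = a *: A x + A y.
Hypothesis A_self : forall x y, dot (A x) y = dot x (A y).
Hypothesis A_contr : forall x, nrm (A x) <= nrm x.

(** The limit [Y] of this iteration satisfies [2 Y = A + Y^2], that is,
    [(1 - Y)^2 = 1 - A]. The powers of [A] enter with nonnegative coefficients only,
    so the iteration is dominated by the scalar one with [A] replaced by 1. *)
Fixpoint sqrt_iter n : V -> V :=
  if n is m.+1 then fun x => 2^-1 *: (A x + sqrt_iter m (sqrt_iter m x))
  else fun=> 0.

Fixpoint sqrt_major n : R :=
  if n is m.+1 then (1 + sqrt_major m ^+ 2) / 2 else 0.

Local Notation Y := sqrt_iter.
Local Notation y := sqrt_major.

Let sqrt_iterS n u : Y n.+1 u = 2^-1 *: (A u + Y n (Y n u)).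
Proof. by []. Qed.

Let sqrt_iter_linear n a u v : Y n (a *: u + v) = a *: Y n u + Y n v.
Proof.
elim: n u v => [|n IHn] u v /=; first by rewrite scaler0 addr0.
rewrite !IHn A_linear scalerA mulrC -scalerA -scalerDr; congr (_ *: _).
by rewrite scalerDr addrACA.
Qed.

Let sqrt_iterD n u v : Y n (u + v) = Y n u + Y n v.
Proof. by have := sqrt_iter_linear n 1 u v; rewrite !scale1r. Qed.

Let sqrt_iter0 n : Y n 0 = 0.
Proof. by have := sqrt_iter_linear n (-1) 0 0; rewrite scaler0 addr0 scaleN1r addNr. Qed.

Let sqrt_iterZ n a u : Y n (a *: u) = a *: Y n u.
Proof. by have := sqrt_iter_linear n a u 0; rewrite sqrt_iter0 !addr0. Qed.

Let sqrt_iterB n u v : Y n (u - v) = Y n u - Y n v.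
Proof. by rewrite -scaleN1r sqrt_iterD sqrt_iterZ scaleN1r. Qed.

Let sqrt_iter_comm n (B : V -> V) : (forall u v, B (u + v) = B u + B v) ->
  (forall a u, B (a *: u) = a *: B u) ->
  (forall u, A (B u) = B (A u)) -> forall u, Y n (B u) = B (Y n u).
Proof.
move=> BD BZ AB; elim: n => [|n IHn] u /=; first by have := BZ 0 0; rewrite !scale0r.
by rewrite AB !IHn BZ BD.
Qed.

Let AD u v : A (u + v) = A u + A v.
Proof. by have := A_linear 1 u v; rewrite !scale1r. Qed.

Let A0 : A 0 = 0.
Proof. by have := A_linear (-1) 0 0; rewrite scaler0 addr0 scaleN1r addNr. Qed.

Let AZ a u : A (a *: u) = a *: A u.
Proof. by have := A_linear a u 0; rewrite A0 !addr0. Qed.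

Let sqrt_iterC n m u : Y n (Y m u) = Y m (Y n u).
Proof.
apply: sqrt_iter_comm => {}u; [exact: sqrt_iterD|exact: sqrt_iterZ|].
by rewrite (@sqrt_iter_comm _ A).
Qed.

Let sqrt_iter_self n u v : dot (Y n u) v = dot u (Y n v).
Proof.
elim: n u v => [|n IHn] u v /=; first by rewrite dot0l dot0r.
rewrite dotZl dotZr dotDl dotDr A_self !IHn; congr (_ * _).
by rewrite fmorphV rmorph_nat.
Qed.

Let yS n : y n.+1 = (1 + y n ^+ 2) / 2.
Proof. by []. Qed.

Let y_bound n : 0 <= y n <= 1.
Proof.
elim: n => [|n /= /andP[y0 y1]]; first by rewrite lexx ler01.
by apply/andP; split; nra.
Qed.

Let y_incr n : y n <= y n.+1.
Proof. by have /andP[y0 y1] := y_bound n; rewrite /=; nra. Qed.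

Let Re_half : complex.Re `|2^-1 : R[i]| = 2^-1.
Proof. by rewrite normfV normr_nat -(rmorph_nat (real_complex R)) -fmorphV. Qed.

Let sqrt_iter_le n u : nrm (Y n u) <= y n * nrm u.
Proof.
elim: n u => [|n IHn] u /=; first by rewrite nrm0 mul0r.
rewrite nrmZ Re_half mulrAC [_ / 2]mulrC ler_wpM2l// ?invr_ge0//.
apply: le_trans (nrmD _ _) _; rewrite mulrDl mul1r lerD ?A_contr//.
apply: le_trans (IHn _) _; rewrite expr2 -mulrA ler_wpM2l//.
by have /andP[] := y_bound n.
Qed.

(** The iterates commute, so [2 (Y_(n+2) - Y_(n+1))] factors as
    [(Y_(n+1) - Y_n) (Y_(n+1) + Y_n)]; the scalar iteration obeys the same identity. *)
Let sqrt_iter_diff n u : nrm (Y n.+1 u - Y n u) <= (y n.+1 - y n) * nrm u.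
Proof.
elim: n u => [|n IHn] u.
  rewrite /= addr0 !subr0 expr0n addr0 nrmZ Re_half mul1r ler_wpM2l ?invr_ge0//.
have -> : Y n.+2 u - Y n.+1 u =
    2^-1 *: (Y n.+1 (Y n.+1 u + Y n u) - Y n (Y n.+1 u + Y n u)).
  rewrite !sqrt_iterD (sqrt_iterC n.+1 n) (sqrt_iterS n.+1) {2}(sqrt_iterS n) -scalerBr.
  by congr (_ *: _); rewrite opprD addrACA subrr add0r opprD addrA addrK.
rewrite nrmZ Re_half.
have := IHn (Y n.+1 u + Y n u).
have := nrmD (Y n.+1 u) (Y n u); have := sqrt_iter_le n.+1 u.
have := sqrt_iter_le n u; have := y_incr n; have := nrm_ge0 u.
set a := nrm (Y n.+1 u + Y n u); set b := nrm (_ - _).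
set p := nrm (Y n.+1 u); set q := nrm (Y n u); set t := nrm u.
have -> : y n.+2 - y n.+1 = (y n.+1 - y n) * (y n.+1 + y n) / 2.
  by rewrite (yS n.+1) {2}(yS n); set z := y n.+1; set w := y n; field.
move=> t0 yn qt pt apq ba.
have h : (y n.+1 - y n) * a <= (y n.+1 - y n) * ((y n.+1 + y n) * t).
  by apply: ler_wpM2l; [lra|lra].
nra.
Qed.

Let sqrt_iter_mono n m u : (n <= m)%N ->
  nrm (Y m u - Y n u) <= (y m - y n) * nrm u.
Proof.
move=> /subnK <-; elim: (m - n)%N => [|k IHk].
  by rewrite add0n !subrr nrm0 mul0r.
rewrite addSn.
have -> : Y (k + n).+1 u - Y n u =
    (Y (k + n).+1 u - Y (k + n)%N u) + (Y (k + n)%N u - Y n u) by rewrite addrA subrK.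
apply: le_trans (nrmD _ _) _.
apply: le_trans (lerD (sqrt_iter_diff _ _) IHk) _.
by rewrite -mulrDl addrA subrK.
Qed.

Lemma square_root_one_minus : exists2 D : V -> V,
  forall a u v, D (a *: u + v) = a *: D u + D v &
  forall u v, dot (D u) (D v) = dot (u - A u) v.
Proof.
have cy : cvg (y @ \oo).
  apply: nondecreasing_is_cvgn.
    by apply/nondecreasing_seqP => n; exact: y_incr.
  by exists 1 => _ [n _ <-]; have /andP[] := y_bound n.
pose l := lim (y @ \oo).
have yl n : y n <= l.
  apply: nondecreasing_cvgn_le => //.
  by apply/nondecreasing_seqP => k; exact: y_incr.
have /choice[Z Zl] : forall u, exists z : V, Y ^~ u @ \oo --> z.
  move=> u; apply: (@cvg_of_majorant _ _ _ (fun n => ((l - y n) * nrm u) ^+ 2)).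
    apply: cvg0_sqr; under eq_fun do rewrite mulrC.
    apply: cvg0Zl; rewrite -(subrr l); apply: cvgB => //; exact: cvg_cst.
  move=> n m nm; rewrite -nrm_sq ler_pXn2r ?nnegrE ?nrm_ge0//; last first.
    by rewrite mulr_ge0 ?nrm_ge0// subr_ge0.
  apply: le_trans (sqrt_iter_mono _ nm) _.
  by rewrite ler_wpM2r ?nrm_ge0// lerD2r.
have Z_self u v : dot (Z u) v = dot u (Z v).
  by apply: (dot_lim_eq (Zl u) (cvg_cst v) (cvg_cst u) (Zl v)) => n.
have Z_linear a u v : Z (a *: u + v) = a *: Z u + Z v.
  apply: dot_inj => z; rewrite dotDl dotZl !Z_self.
  by rewrite dotDl dotZl.
have ZZ u : Z u + Z u = A u + Z (Z u).
  have h : (fun n => Y n (Y n u)) @ \oo --> Z (Z u).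
    apply/cvg_nrmP; have /cvg_nrmP h1 := Zl u; have /cvg_nrmP h2 := Zl (Z u).
    apply: (cvg0_squeeze _ (cvg0D h1 h2)) => n; rewrite nrm_ge0 /=.
    have -> : Y n (Y n u) - Z (Z u) = Y n (Y n u - Z u) + (Y n (Z u) - Z (Z u)).
      by rewrite sqrt_iterB addrA subrK.
    apply: le_trans (nrmD _ _) _; rewrite lerD2r.
    apply: le_trans (sqrt_iter_le _ _) _; rewrite ler_piMl ?nrm_ge0//.
    by have /andP[] := y_bound n.
  have h1 : (fun n => Y n.+1 u) @ \oo --> Z u by have := Zl u; rewrite -(cvg_shiftS (Y^~ u)).
  apply: (cvg_unique (@norm_hausdorff _ V) (cvgD h1 h1)).
  have -> : (fun n => Y n.+1 u) + (fun n => Y n.+1 u) = (fun n => A u + Y n (Y n u)).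
    apply/funext => n; transitivity (Y n.+1 u + Y n.+1 u) => //.
    by rewrite sqrt_iterS -scalerDl -[RHS]scale1r; congr (_ *: _); field.
  by apply: cvgD => //; exact: cvg_cst.
exists (fun u => u - Z u) => [a u v|u v].
  by rewrite Z_linear scalerBr opprD addrACA.
rewrite dotBr -Z_self -dotBl; congr dot.
rewrite (linear_subE Z_linear).
have -> : A u = Z u + Z u - Z (Z u) by rewrite ZZ addrK.
by rewrite !opprB opprD !addrA; congr (_ - _); rewrite addrAC.
Qed.

End SquareRoot.

(** * Orthonormal bases of separable subspaces *)
Section OrthonormalBases.
Variables (R : realType) (V : preHilbertType R).
Implicit Types (A B W : set V) (w : nat -> V) (x : V).

Lemma lin_span_linear A : linear_subspace (lin_span A).
Proof.
split; first by exists 0%N, (fun=> 0), (fun=> 0); split; [case|rewrite big_ord0].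
move=> a x y [n [c [v [Av ->]]]] [m [d [z [Az ->]]]].
exists (n + m)%N, (fun i => match fintype.split i with inl j => a * c j | inr j => d j end),
  (fun i => match fintype.split i with inl j => v j | inr j => z j end).
split=> [i|]; first by case: (fintype.split i).
rewrite big_split_ord /= scaler_sumr; congr (_ + _).
  by apply: eq_bigr => i _; rewrite (unsplitK (inl i)) scalerA.
by apply: eq_bigr => i _; rewrite (unsplitK (inr i)).
Qed.

Lemma sub_lin_span A : A `<=` lin_span A.
Proof.
by move=> x Ax; exists 1%N, (fun=> 1), (fun=> x); rewrite big_ord1 scale1r.
Qed.

Lemma lin_sum B n (v : 'I_n -> V) : linear_subspace B -> (forall i, B (v i)) ->
  B (\sum_(i < n) v i).
Proof.
move=> lB Bv; elim/big_ind: _ => //; first exact: lin0.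
by move=> x y; exact: linD.
Qed.

Lemma lin_span_sub A B : linear_subspace B -> A `<=` B -> lin_span A `<=` B.
Proof.
move=> lB AB x [n [c [v [Av ->]]]]; apply: lin_sum => // i.
by apply: linZ => //; exact: AB.
Qed.

Lemma closure_linear B : linear_subspace B -> closed_subspace (closure B).
Proof.
move=> lB; split; last exact: closed_closure.
split; first by apply: subset_closure; exact: lin0.
move=> a x y /closure_approx Bx /closure_approx By; apply/closure_approx => e e0.
pose k := complex.Re `|a| + 1; have k0 : 0 < k by rewrite ltr_wpDl ?Re_norm_ge0.
have [|x' Bx' xx'] := Bx (e / 2 / k); first by rewrite !divr_gt0.
have [|y' By' yy'] := By (e / 2); first by rewrite divr_gt0.
exists (a *: x' + y'); first exact: linZD.
rewrite opprD addrACA -scalerBr; apply: le_lt_trans (nrmD _ _) _.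
rewrite nrmZ [e]splitr; apply: ler_ltD => //.
move: xx'; rewrite ltr_pdivlMr// => /ltW; apply: le_trans.
by rewrite mulrC ler_wpM2l ?nrm_ge0// lerDl.
Qed.

Lemma closed_span_sub A B : closed_subspace B -> A `<=` B ->
  closed_span A `<=` B.
Proof.
move=> [lB cB] AB; rewrite [X in _ `<=` X]((closure_id B).1 cB).
by apply: closure_subset; exact: lin_span_sub.
Qed.

(** A vector that depends on its predecessors produces the zero vector, so
    the sequence keeps the indices of [w]; the basis consists of the nonzero entries. *)
Fixpoint gram_schmidt_seq w n : seq V :=
  if n is m.+1 then
    let s := gram_schmidt_seq w m in
    let v := w m - \sum_(e <- s) dot (w m) e *: e in
    rcons s ((nrm v)^-1%:C%C *: v)
  else [::].

Definition gram_schmidt w n := nth 0 (gram_schmidt_seq w n.+1) n.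

Lemma size_gram_schmidt w n : size (gram_schmidt_seq w n) = n.
Proof. by elim: n => //= n IHn; rewrite size_rcons IHn. Qed.

Lemma nth_gram_schmidt w n i : (i < n)%N ->
  nth 0 (gram_schmidt_seq w n) i = gram_schmidt w i.
Proof.
elim: n => // n IHn; rewrite ltnS leq_eqVlt => /orP[/eqP -> //|ni].
by rewrite -IHn//= nth_rcons size_gram_schmidt ni.
Qed.

Definition gs_residue w n :=
  w n - \sum_(i < n) dot (w n) (gram_schmidt w i) *: gram_schmidt w i.

Lemma gram_schmidtE w n :
  gram_schmidt w n = (nrm (gs_residue w n))^-1%:C%C *: gs_residue w n.
Proof.
rewrite /gram_schmidt /= nth_rcons size_gram_schmidt ltnn eqxx.
suff -> : \sum_(e <- gram_schmidt_seq w n) dot (w n) e *: e =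
    \sum_(i < n) dot (w n) (gram_schmidt w i) *: gram_schmidt w i by [].
rewrite (big_nth 0) size_gram_schmidt big_mkord.
by apply: eq_bigr => i _; rewrite nth_gram_schmidt.
Qed.

Lemma gram_schmidt_unit w n : gram_schmidt w n = 0 \/
  dot (gram_schmidt w n) (gram_schmidt w n) = 1.
Proof.
rewrite gram_schmidtE; set v := gs_residue w n.
have [->|v0] := eqVneq (nrm v) 0; first by left; rewrite invr0 scale0r.
right; rewrite dotxxE -nrm_sq nrmZR normfV ger0_norm ?nrm_ge0//.
by rewrite mulVf// expr1n.
Qed.

Lemma dot_sumZl n (a : 'I_n -> R[i]) (v : 'I_n -> V) x :
  dot (\sum_(i < n) a i *: v i) x = \sum_(i < n) a i * dot (v i) x.
Proof.
elim/big_rec2: _ => [|i s t _ <-]; first by rewrite dot0l.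
by rewrite dotDl dotZl.
Qed.

Lemma gram_schmidt_orth w n i : (i < n)%N ->
  dot (gram_schmidt w n) (gram_schmidt w i) = 0.
Proof.
elim/ltn_ind: n i => n IHn i ni.
rewrite [gram_schmidt w n]gram_schmidtE dotZl.
suff -> : dot (gs_residue w n) (gram_schmidt w i) = 0 by rewrite mulr0.
rewrite /gs_residue dotBl dot_sumZl.
rewrite (bigD1 (Ordinal ni))//= big1 => [|j]; last first.
  rewrite -val_eqE /=; case: (ltngtP j i) => // [ji|ij] _.
    by rewrite (dot_sym0 (IHn i ni j ji)) mulr0.
  by rewrite (IHn j (ltn_ord j) i ij) mulr0.
rewrite addr0; have [->|->] := gram_schmidt_unit w i.
  by rewrite !dot0r mulr0 subrr.
by rewrite mulr1 subrr.
Qed.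

Lemma gram_schmidt_in w B n : linear_subspace B -> (forall n, B (w n)) ->
  B (gram_schmidt w n).
Proof.
move=> lB Bw; elim/ltn_ind: n => n IHn; rewrite gram_schmidtE.
apply: linZ => //; apply: linB => //; apply: lin_sum => // i.
by apply: linZ => //; exact: IHn.
Qed.

Lemma gram_schmidt_span w B n : linear_subspace B ->
  (forall n, B (gram_schmidt w n)) -> B (w n).
Proof.
move=> lB Bg.
have -> : w n = (nrm (gs_residue w n))%:C%C *: gram_schmidt w n +
    \sum_(i < n) dot (w n) (gram_schmidt w i) *: gram_schmidt w i.
  rewrite gram_schmidtE scalerA -rmorphM /=.
  have [n0|n0] := eqVneq (nrm (gs_residue w n)) 0.
    rewrite n0 mul0r scale0r add0r; apply/eqP; rewrite -subr_eq0; apply/eqP.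
    exact: nrm_eq0 n0.
  by rewrite mulfV// scale1r subrK.
by apply: linD => //; [exact: linZ|apply: lin_sum => // i; exact: linZ].
Qed.

Lemma orthonormal_basis_exists W w : closed_subspace W ->
  (forall n, W (w n)) -> W `<=` closure (range w) ->
  exists D E, orthonormal_basis W D E.
Proof.
move=> [lW cW] Ww wd; pose E := gram_schmidt w.
exists [set n | E n <> 0], E; split.
- by move=> j _; exact: gram_schmidt_in.
- move=> i j Ei Ej; case: (ltngtP i j) => [ij|ji|<-].
  + by rewrite dot_sym0// gram_schmidt_orth.
  + by rewrite gram_schmidt_orth.
  + by have [] := gram_schmidt_unit w i.
apply/seteqP; split.
  apply: closed_span_sub => // _ [j _ <-]; exact: gram_schmidt_in.
apply: (subset_trans wd); apply: closure_subset => _ [n _ <-].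
apply: gram_schmidt_span => [|m]; first exact: lin_span_linear.
have [E0|E0] := pselect (gram_schmidt w m = 0).
  by rewrite E0; apply: lin0; exact: lin_span_linear.
by apply: sub_lin_span; exists m.
Qed.

(** Separability passes to a subset [W]: for each [n] and [k], keep a point of [W]
    within distance [1 / (k + 1)] of [d n], if there is one. *)
Lemma dense_sequence_in W (d : nat -> V) : W !=set0 -> W `<=` closure (range d) ->
  exists2 w : nat -> V, (forall n, W (w n)) & W `<=` closure (range w).
Proof.
move=> [x0 Wx0] dW.
pose P (p : nat * nat) := [set x | W x /\ nrm (d p.1 - x) < p.2.+1%:R^-1].
pose f p := xget x0 (P p).
exists (fun n => if unpickle n is Some p then f p else x0).
  move=> n; case: unpickle => // p; rewrite /f.
  by case: xgetP => // x _ [].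
move=> x Wx; apply/closure_approx => e e0.
have [k ke] : exists k, k.+1%:R^-1 < e / 2.
  have /cvgrPdist_lt/(_ (e / 2)) := @cvg_harmonic R.
  rewrite divr_gt0// => /(_ isT)[k _ /(_ k (leqnn k)) /=].
  by rewrite sub0r normrN ger0_norm ?invr_ge0// => ?; exists k.
have /closure_approx := dW _ Wx => /(_ k.+1%:R^-1).
rewrite invr_gt0 => /(_ (ltr0Sn _ _))[_ [n _ <-] nx].
have [_ fP] : P (n, k) (f (n, k)) by apply: (xgetPex x0); exists x.
exists (f (n, k)); first by exists (pickle (n, k)); rewrite // pickleK.
have -> : f (n, k) - x = (d n - x) - (d n - f (n, k)) by rewrite opprB [RHS]addrC subrKA.
apply: le_lt_trans (nrmD _ _) _; rewrite nrmN.
by apply: lt_trans (ltrD nx fP) _; rewrite [e]splitr ltrD.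
Qed.

End OrthonormalBases.

(** * Completeness of spaces of square-integrable vector functions *)
Section Fatou.
Context d (X : measurableType d) (R : realType).
Variable mu : {measure set X -> \bar R}.

Lemma fatou_le (f : nat -> X -> \bar R) (g : X -> \bar R) (c : \bar R) :
  (forall n, measurable_fun [set: X] (f n)) -> (forall n x, (0 <= f n x)%E) ->
  (forall x, f ^~ x @ \oo --> g x) ->
  (forall n, (\int[mu]_x f n x <= c)%E) -> (\int[mu]_x g x <= c)%E.
Proof.
move=> mf f0 fg fc.
have := @fatou _ _ _ mu _ measurableT f mf (fun n x _ => f0 n x).
rewrite (_ : (fun x => _) = g) //; last first.
  by apply/funext => x; have [] := cvg_limn_einf_sup (fg x).
move=> /le_trans; apply; rewrite limn_einf_lim; apply: lime_le.
  exact: is_cvg_einfs.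
apply: nearW => n; apply: le_trans (fc n).
by apply: ereal_inf_lbound; exists n => /=.
Qed.

End Fatou.

Section GeometricSteps.
Variable R : realType.

Lemma geometric_cvg0 : (fun n => 2 ^- n : R) @ \oo --> (0 : R).
Proof.
under eq_fun do rewrite -exprVn.
by apply: cvg_expr; rewrite ger0_norm ?invr_ge0// invf_lt1// ltr1n.
Qed.

Lemma geometric_tail (V : preHilbertType R) (u : nat -> V) (c : R) :
  (forall n, nrm (u n.+1 - u n) <= c * 2 ^- n) ->
  forall n m, (n <= m)%N -> nrm (u m - u n) <= 2 * c * 2 ^- n.
Proof.
move=> step n m /subnKC <-.
have c0 : 0 <= c.
  by have := step 0%N; rewrite expr0 invr1 mulr1; apply: le_trans; exact: nrm_ge0.
have tail k : nrm (u (n + k)%N - u n) <= 2 * c * (2 ^- n - 2 ^- (n + k)).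
  elim: k => [|k IHk]; first by rewrite addn0 !subrr nrm0 mulr0.
  have -> : u (n + k.+1)%N - u n = (u (n + k).+1 - u (n + k)%N) + (u (n + k)%N - u n).
    by rewrite addrA subrK addnS.
  apply: le_trans (nrmD _ _) _; apply: le_trans (lerD (step _) IHk) _.
  rewrite addnS exprS invfM; set p := 2 ^- (n + k); rewrite le_eqVlt; apply/orP; left.
  by apply/eqP; field.
apply: le_trans (tail _) _; rewrite ler_wpM2l ?mulr_ge0//.
by rewrite gerBl invr_ge0 exprn_ge0.
Qed.

Lemma cvg_geometric_steps (V : hilbertType R) (u : nat -> V) (c : R) :
  (forall n, nrm (u n.+1 - u n) <= c * 2 ^- n) -> exists l : V, u @ \oo --> l.
Proof.
move=> step; apply: (@cvg_of_majorant _ _ _ (fun n => (2 * c * 2 ^- n) ^+ 2)).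
  by apply: cvg0_sqr; apply: cvg0Zl; exact: geometric_cvg0.
move=> n m nm; have h := geometric_tail step nm.
by rewrite -nrm_sq ler_pXn2r ?nnegrE ?nrm_ge0//; apply: le_trans h; exact: nrm_ge0.
Qed.

Lemma nrm_of_sqnorm (V : preHilbertType R) (x : V) (C : R) n :
  sqnorm x <= C * 4 ^- n -> nrm x <= (C + 1) * 2 ^- n.
Proof.
have p0 : 0 < 2 ^- n :> R by rewrite invr_gt0 exprn_gt0.
have -> : 4 ^- n = (2 ^- n) ^+ 2 :> R.
  by rewrite -!exprVn -exprM mulnC exprM; congr (_ ^+ _); field.
rewrite -nrm_sq; move: (nrm_ge0 x) p0; set t := nrm x; set p := 2 ^- n.
move=> t0 p0 h; rewrite leNgt; apply/negP => h1.
have C0 : 0 <= C by rewrite -(pmulr_lge0 _ (exprn_gt0 2 p0)) (le_trans _ h)// sqr_ge0.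
have : ((C + 1) * p) ^+ 2 < t ^+ 2.
  by rewrite ltr_pXn2r// ?nnegrE// mulr_ge0 ?addr_ge0// ltW.
have p20 : 0 < p ^+ 2 by exact: exprn_gt0.
by move=> /lt_le_trans/(_ h); rewrite exprMn ltr_pM2r// sqrrD; nra.
Qed.

Lemma cvg_Re_dot (V : preHilbertType R) (u : nat -> V) l k : u @ \oo --> l ->
  (fun n => complex.Re (dot (u n) k)) @ \oo --> (complex.Re (dot l k) : R).
Proof.
move=> /cvg_nrmP ul.
apply: cvg_sub0.
apply/norm_cvg0P; apply: (cvg0_squeeze _ (cvg0Zl (nrm k) ul)) => n.
rewrite normr_ge0 /= -cReN -cReD -dotNl -dotDl mulrC.
apply: le_trans (cauchy_schwarz _ _).
by rewrite -lecR Re_normE; exact: normc_ge_Re.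
Qed.

Lemma cvg_sqnormB (V : preHilbertType R) (u : nat -> V) l y : u @ \oo --> l ->
  (fun n => (sqnorm (u n - y))%:E) @ \oo --> (sqnorm (l - y))%:E.
Proof.
move=> ul; apply: cvg_EFin; first exact: nearW.
rewrite (_ : fine \o _ = (fun n => sqnorm (u n - y))) //.
apply: cvg_sub0.
have -> : (fun n => sqnorm (u n - y) - sqnorm (l - y)) =
    (fun n => sqnorm (u n - l) +
      2 * (complex.Re (dot (u n) (l - y)) - complex.Re (dot l (l - y)))).
  apply/funext => n; rewrite -cReN -cReD -dotNl -dotDl.
  have -> : u n - y = (u n - l) + (l - y) by rewrite addrA subrK.
  by rewrite sqnormD; ring.
apply: cvg0D; first exact/cvg_sqnormP.
apply: cvg0Zl; rewrite -(subrr (complex.Re (dot l (l - y)))).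
by apply: cvgB; [exact: cvg_Re_dot|exact: cvg_cst].
Qed.

End GeometricSteps.

Section L2Complete.
Context d (X : measurableType d) (R : realType).
Variables (mu : {measure set X -> \bar R}) (K : sepHilbertType R).
Implicit Types (f g : L2fun mu K) (F G : L2 mu K).

Lemma measurable_sqnormL2 f : measurable_fun [set: X] (fun x => (sqnorm (f x))%:E).
Proof. by apply/measurable_EFinP; apply: measurable_sqnorm; case: (L2funP f). Qed.

Lemma integral_sqnorm f : (\int[mu]_x (sqnorm (f x))%:E)%E = (sqnorm (L2pi f))%:E.
Proof.
have [mf fi] := L2funP f.
rewrite sqnorm_dot [dot _ _]L2dotE /idot /cintegral /=.
under eq_Rintegral do rewrite -sqnorm_dot.
rewrite /Rintegral fineK// ge0_fin_numE//.
by apply: integral_ge0 => x _; rewrite lee_fin sqnorm_ge0.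
Qed.

Lemma L2piB f g : L2pi f - L2pi g = L2pi (f - g).
Proof. by rewrite [- _]L2piN [LHS]L2piD. Qed.

Lemma L2_ae0 : {ae mu, forall x, L2repr (0 : L2 mu K) x = 0}.
Proof. by have := L2piK (0 : L2fun mu K); apply: filterS => x /= ->. Qed.

Lemma L2_aeD F G : {ae mu, forall x, L2repr (F + G) x = F x + G x}.
Proof. by have := L2piK (L2repr F + L2repr G); apply: filterS => x /= ->. Qed.

Lemma L2_aeZ a F : {ae mu, forall x, L2repr (a *: F) x = a *: F x}.
Proof. by have := L2piK (a *: L2repr F); apply: filterS => x /= ->. Qed.

Lemma L2_eq F G : {ae mu, forall x, F x = G x} -> F = G.
Proof.
move=> FG; rewrite -(L2reprK F) -(L2reprK G); apply/L2pi_eq.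
by move: FG; apply: filterS => x /= ->.
Qed.

(** A rate at which [sum_n 4^n fast_rate n] converges, which is what
    [fast_decay_ae] needs. *)
Definition fast_rate (n : nat) : R := (2 ^ n.+1)%:R^-1 * 4 ^- n.

(** The integral of [sum_n 4^n |g_n(x)|^2] is at most [sum_n 2^-(n+1)], so this sum is
    finite for almost every [x]. The exceptional set is given as a measurable set,
    since measurable functions are later modified on it. *)
Lemma fast_decay_ae (g : nat -> L2fun mu K) :
  (forall n, sqnorm (L2pi (g n)) <= fast_rate n) ->
  exists A : set X, [/\ measurable A, mu (~` A) = 0%E &
    forall x, A x -> exists C : R, forall n, sqnorm (g n x) <= C * 4 ^- n].
Proof.
move=> gn.
pose h n x : \bar R := (4 ^+ n * sqnorm (g n x))%:E.
have h0 n x : (0 <= h n x)%E by rewrite lee_fin mulr_ge0 ?exprn_ge0 ?sqnorm_ge0.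
have mh n : measurable_fun [set: X] (h n).
  apply/measurable_EFinP; apply: measurable_funM; first exact: measurable_cst.
  by apply: measurable_sqnorm; case: (L2funP (g n)).
pose s x : \bar R := (\sum_(0 <= n <oo) h n x)%E.
have s0 x : (0 <= s x)%E by exact: nneseries_ge0.
have ms : measurable_fun [set: X] s by exact: ge0_emeasurable_sum.
have s_lty : (\int[mu]_x s x < +oo)%E.
  rewrite integral_nneseries//; apply: (@le_lt_trans _ _ (1%:E)); last exact: ltry.
  apply: le_trans (epsilon_trick0 xpredT ler01).
  apply: lee_nneseries => [n _ _|n _]; first exact: integral_ge0.
  rewrite /h; under eq_integral do rewrite EFinM.
  rewrite ge0_integralZl//; [|exact: measurable_sqnormL2
    |by move=> x _; rewrite lee_fin sqnorm_ge0].
  rewrite integral_sqnorm -EFinM lee_fin div1r.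
  rewrite -ler_pdivlMl ?exprn_gt0//; apply: le_trans (gn n) _.
  by rewrite /fast_rate mulrC.
have mA : measurable (s @^-1` [set y | (y < +oo)%E]).
  rewrite -[X in measurable X]setTI.
  exact: (emeasurable_fun_infty_o measurableT ms).
exists (s @^-1` [set y | (y < +oo)%E]); split => //.
- apply/negligibleP; first exact: measurableC.
  have is_ : mu.-integrable [set: X] s.
    by apply/integrableP; split => //; under eq_integral do rewrite gee0_abs//.
  have := integrable_ae measurableT is_; apply: negligibleS => x /= sx.
  by move=> /(_ Logic.I); rewrite ge0_fin_numE.
move=> x /= sx; exists (fine (s x)) => n.
rewrite ler_pdivlMr ?exprn_gt0// mulrC -lee_fin fineK ?ge0_fin_numE//.
have := @nneseries_lim_ge _ (h ^~ x) xpredT 0 n.+1 (fun k _ _ => h0 k x).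
apply: le_trans; rewrite big_nat_recr//= leeDr//.
exact: sume_ge0.
Qed.

Lemma restrict_L2_subproof (A : set X) f : measurable A ->
  (fun x => (\1_A x : R)%:C%C *: f x) \in L2pred mu K.
Proof.
move=> mA; have [mf fi] := L2funP f; apply/asboolP; split.
  apply: vmeasurableM => //; split; last exact: measurable_cst.
  exact: measurable_indic.
apply: le_lt_trans fi; apply: ge0_le_integral => //.
- by move=> x _; rewrite lee_fin sqnorm_ge0.
- apply/measurable_EFinP; apply: measurable_sqnorm; apply: vmeasurableM => //.
  by split; [exact: measurable_indic|exact: measurable_cst].
- exact: measurable_sqnormL2.
- move=> x _; rewrite lee_fin sqnormZ /= expr0n addr0 indicE.
  by case: (x \in A) => /=; rewrite ?expr1n ?mul1r// expr0n mul0r sqnorm_ge0.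
Qed.

(** Imaginary parts reduce to real parts, as they are real parts of inner products
    with ['i *: k]. *)
Lemma vmeasurable_cvg (u : nat -> X -> K) (f : X -> K) :
  (forall n, vmeasurable (u n)) -> (forall x, u ^~ x @ \oo --> f x) ->
  vmeasurable f.
Proof.
move=> mu_ uf.
have mRe k : measurable_fun [set: X] (fun x => complex.Re (dot (f x) k)).
  apply: (measurable_fun_cvg (h := fun n x => complex.Re (dot (u n x) k))).
    by move=> n; have [] := mu_ n k.
  by move=> x _; exact: cvg_Re_dot.
move=> k; split=> //.
by under eq_fun do rewrite Im_dotE; exact: mRe.
Qed.

Lemma fast_rate_gt0 n : 0 < fast_rate n.
Proof. by rewrite /fast_rate mulr_gt0// invr_gt0 ?exprn_gt0// ltr0n expn_gt0. Qed.

Lemma fast_rateS n : fast_rate n.+1 = fast_rate n / 8.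
Proof.
rewrite /fast_rate expnS natrM exprS; field.
by rewrite expf_neq0// pnatr_eq0 expn_eq0.
Qed.

Lemma fast_rate_le n : fast_rate n <= 2 ^- n.
Proof.
elim: n => [|n IHn].
  by rewrite /fast_rate !expr0 invr1 mulr1 invf_le1 ?ler1n// ltr0n expn_gt0.
have p0 : 0 < 2 ^- n :> R by rewrite invr_gt0 exprn_gt0.
by rewrite fast_rateS exprS invfM; move: IHn p0; set p := 2 ^- n; lra.
Qed.

(** Riesz-Fischer: from a Cauchy filter one extracts a sequence whose steps decay
    so fast that it converges almost everywhere at a geometric rate; by Fatou's lemma
    the pointwise limit is the limit in norm. *)
Lemma L2_cauchy_cvg (F : set_system (L2 mu K)) :
  ProperFilter F -> cauchy F -> cvg F.
Proof.
move=> FF /cauchyP cF.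
have /choice[u Fu] : forall n, exists G, F (ball G (fast_rate n / 2)%:C%C).
  by move=> n; apply: cF; rewrite ltcR divr_gt0// fast_rate_gt0.
have step n : nrm (u n.+1 - u n) <= fast_rate n.
  have [G [/=]] := filter_ex (filterI (Fu n) (Fu n.+1)).
  rewrite -!ball_normE /= !nrmE !ltcR => h0 h1.
  have -> : u n.+1 - u n = (u n.+1 - G) - (u n - G) by rewrite opprB addrA subrK.
  apply: le_trans (nrmD _ _) _; rewrite nrmN.
  by move: h0 h1; rewrite fast_rateS; have := fast_rate_gt0 n; lra.
have step1 n : nrm (u n.+1 - u n) <= 1 * 2 ^- n.
  by rewrite mul1r; apply: le_trans (step n) (fast_rate_le n).
have tail := geometric_tail step1.
pose x n : L2fun mu K := L2repr (u n).
have [A [mA A0 gA]] : exists A : set X, [/\ measurable A, mu (~` A) = 0%E &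
    forall z, A z -> exists C : R, forall n, sqnorm ((x n.+1 - x n) z) <= C * 4 ^- n].
  apply: fast_decay_ae => n; rewrite -L2piB !L2reprK -nrm_sq.
  have f1 : fast_rate n <= 1.
    by apply: le_trans (fast_rate_le n) _; rewrite invf_le1 ?exprn_gt0// exprn_ege1// ler1n.
  have := step n; have := nrm_ge0 (u n.+1 - u n); have := fast_rate_gt0 n; nra.
(* representatives that vanish off the good set converge everywhere *)
pose y n : L2fun mu K := MkL2fun (restrict_L2_subproof (x n) mA).
have yx n : L2pi (y n) = u n.
  rewrite -[RHS]L2reprK; apply/L2pi_eq; exists (~` A); split => //; first exact: measurableC.
  by move=> z /= h Az; apply: h => _; rewrite indicE mem_set// scale1r.
have /choice[f yf] : forall z, exists l : K, (fun n => y n z) @ \oo --> l.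
  move=> z; have [Az|Az] := pselect (A z); last first.
    exists 0; rewrite (_ : (fun n => _) = (fun=> 0)); first exact: cvg_cst.
    by apply/funext => n /=; rewrite indicE memNset// scale0r.
  have [C hC] := gA z Az; apply: (@cvg_geometric_steps _ _ _ (C + 1)) => n.
  apply: nrm_of_sqnorm; apply: le_trans (hC n).
  by rewrite /= indicE mem_set// !scale1r.
have mf : vmeasurable f.
  by apply: (@vmeasurable_cvg (fun n => y n)) => // n; case: (L2funP (y n)).
have fL2 : f \in L2pred mu K.
  apply/asboolP; split => //.
  apply: (@le_lt_trans _ _ (2 * sqnorm (u 0%N) + 8)%:E); last exact: ltry.
  apply: (@fatou_le _ _ _ _ (fun n z => (sqnorm (y n z))%:E)).
  - by move=> n; exact: measurable_sqnormL2.
  - by move=> n z; rewrite lee_fin sqnorm_ge0.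
  - move=> z; rewrite -[f z]subr0.
    rewrite (_ : (fun n => _) = (fun n => (sqnorm (y n z - 0))%:E)).
      exact: cvg_sqnormB.
    by apply/funext => n; rewrite subr0.
  - move=> n; rewrite integral_sqnorm yx lee_fin.
    have -> : u n = u 0%N + (u n - u 0%N) by rewrite addrC subrK.
    apply: le_trans (sqnormD_le _ _) _; rewrite lerD2l.
    have := tail 0%N n (leq0n n); rewrite expr0 invr1 !mulr1 -nrm_sq.
    by have := nrm_ge0 (u n - u 0%N); nra.
pose l : L2 mu K := L2pi (MkL2fun fL2).
have ul n : nrm (l - u n) <= 2 * 2 ^- n.
  rewrite -(ler_pXn2r (n := 2)) ?nnegrE ?nrm_ge0 ?mulr_ge0 ?invr_ge0 ?exprn_ge0//.
  rewrite nrm_sq -(yx n) [L2pi _ - _]L2piB -lee_fin -integral_sqnorm.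
  apply: (@fatou_le _ _ _ _ (fun m z => (sqnorm (y (m + n)%N z - y n z))%:E)).
  - by move=> m; exact: (measurable_sqnormL2 (y (m + n)%N - y n)).
  - by move=> m z; rewrite lee_fin sqnorm_ge0.
  - move=> z; apply: (cvg_sqnormB (u := fun m => y (m + n)%N z)).
    by have := yf z; rewrite -(cvg_shiftn n).
  - move=> m; rewrite (integral_sqnorm (y (m + n)%N - y n)) -L2piB !yx lee_fin -nrm_sq.
    rewrite ler_pXn2r ?nnegrE ?nrm_ge0 ?mulr_ge0 ?invr_ge0 ?exprn_ge0//.
    by have := tail n (m + n)%N (leq_addl m n); rewrite mulr1.
apply/cvg_ex; exists l; apply/cvg_ballP => e e0.
have eE := gt0_complexE e0.
have r0 : 0 < complex.Re e by rewrite -ltcR -eE.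
have [n ne] : exists n, 3 * 2 ^- n < complex.Re e.
  have /cvgrPdist_lt/(_ _ r0)[n _ /(_ n (leqnn n)) /=] := cvg0Zl 3 (@geometric_cvg0 R).
  by rewrite sub0r normrN => /(le_lt_trans (ler_norm _)); exists n.
apply: filterS (Fu n) => G; rewrite -!ball_normE /= !nrmE eE !ltcR => h.
have -> : l - G = (l - u n) + (u n - G) by rewrite addrA subrK.
apply: le_lt_trans (nrmD _ _) _.
by have := ul n; have := fast_rate_le n; have := fast_rate_gt0 n; lra.
Qed.

HB.instance Definition _ := Uniform_isComplete.Build (L2 mu K) L2_cauchy_cvg.

End L2Complete.

Section PointwiseSubspace.
Context d (X : measurableType d) (R : realType).
Variables (mu : {measure set X -> \bar R}) (K : sepHilbertType R).
Variable J : X -> set K.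

Definition L2_in : set (L2 mu K) := [set F | {ae mu, forall x, J x (L2repr F x)}].

(** A sequence that converges in norm has a subsequence that converges almost
    everywhere, so the pointwise condition passes to the limit. *)
Lemma L2_in_closed_subspace : (forall x, closed_subspace (J x)) ->
  closed_subspace L2_in.
Proof.
move=> cJ; split; first split.
- have := L2_ae0 mu K; apply: filterS => x ->.
  by apply: lin0; case: (cJ x).
- move=> a F G JF JG; have hD := L2_aeD (a *: F) G; have hZ := L2_aeZ a F.
  have {}hD : {ae mu, forall x, L2repr (a *: F + G) x = a *: L2repr F x + L2repr G x}.
    by move: hD hZ; apply: filterS2 => x -> ->.
  move: JF JG hD; rewrite /L2_in /=.
  apply: filterS3 => x Fx Gx ->.
  by apply: linZD => //; case: (cJ x).
apply/closed_seqP => u l uJ /cvg_sqnormP ul.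
have /choice[p pP] : forall n, exists m, sqnorm (u m - l) <= fast_rate R n.
  move=> n; have /cvgrPdist_lt/(_ _ (fast_rate_gt0 R n))[m _ /(_ m (leqnn m)) /=] := ul.
  by rewrite sub0r normrN => /(le_lt_trans (ler_norm _)) /ltW; exists m.
have [|A [mA A0 gA]] := @fast_decay_ae _ _ _ mu K (fun n => L2repr (u (p n)) - L2repr l).
  by move=> n; rewrite -L2piB !L2reprK.
have aeA : {ae mu, forall x, A x}.
  by exists (~` A); split => //; exact: measurableC.
have aeJ : {ae mu, forall x, forall n, J x (L2repr (u (p n)) x)}.
  by apply: ae_foralln => n; exact: uJ.
move: aeA aeJ; apply: filterS2 => x /gA[C hC] Jx.
have [_ cx] := cJ x; apply: ((closed_seqP (J x)).1 cx _ _ Jx).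
apply/cvg_nrmP; apply: (@cvg0_squeeze _ _ (fun n => (C + 1) * 2 ^- n)).
  by move=> n; rewrite nrm_ge0 /=; apply: nrm_of_sqnorm; exact: hC.
by apply: cvg0Zl; exact: geometric_cvg0.
Qed.

End PointwiseSubspace.

(** * Uniqueness of Fourier coefficients on the circle *)
Section ThresholdPowers.
Variable R : realType.
Implicit Types (x r : R) (n : nat).

Lemma natr_mul_geometric_cvg0 r : 0 <= r -> r < 1 ->
  (fun n => n%:R * r ^+ n) @ \oo --> (0 : R).
Proof.
move=> r0 r1; pose q := Num.sqrt r.
have q0 : 0 <= q by exact: sqrtr_ge0.
have q1 : q < 1 by rewrite -sqrtr1 ltr_sqrt.
have rq : r = q ^+ 2 by rewrite sqr_sqrtr.
have qn : (fun n => q ^+ n) @ \oo --> (0 : R) by apply: cvg_expr; rewrite ger0_norm.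
apply: (cvg0_squeeze _ (cvg0Zl (1 - q)^-1 qn)) => n.
rewrite mulr_ge0 ?exprn_ge0//= rq -exprM mulnC exprM expr2 mulrA.
rewrite ler_wpM2r ?exprn_ge0// -[X in _ <= X]mul1r ler_pdivlMr ?subr_gt0//.
have -> : n%:R * q ^+ n = \sum_(i < n) q ^+ n.
  by rewrite sumr_const card_ord mulr_natl.
apply: (@le_trans _ _ ((\sum_(i < n) q ^+ i) * (1 - q))).
  apply: ler_wpM2r; first by rewrite subr_ge0 ltW.
  apply: ler_sum => i _.
  by apply: ler_wiXn2l => //; [exact: ltW|exact: ltnW].
rewrite mulrC -opprB mulNr -subrX1 opprB gerBl.
exact: exprn_ge0.
Qed.

Lemma bernoulli_ge x n : 0 <= x <= 1 -> 1 - n%:R * x <= (1 - x) ^+ n.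
Proof.
move=> /andP[x0 x1]; elim: n => [|n IHn]; first by rewrite mul0r subr0 expr0.
rewrite exprS; apply: (@le_trans _ _ ((1 - x) * (1 - n%:R * x))).
  by rewrite -natr1; have := ler0n R n; nra.
by rewrite ler_wpM2l// subr_ge0.
Qed.

Lemma bernoulli_prod_le x n : 0 <= x <= 1 -> (1 - x) ^+ n * (1 + n%:R * x) <= 1.
Proof.
move=> /andP[x0 x1]; elim: n => [|n IHn]; first by rewrite mul0r addr0 expr0 mulr1.
rewrite exprSr -mulrA; apply: le_trans IHn.
rewrite ler_wpM2l ?exprn_ge0 ?subr_ge0//.
by rewrite -natr1; have := ler0n R n; nra.
Qed.

(** Polynomials that stay in [[0, 1]] and approach the indicator of [x < 1/2]. With
    the exponent [2^n] the limit at [x = 1/2] would be [1/e]; the extra factor [n]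
    turns it into 0. *)
Lemma threshold_cvg x : 0 <= x <= 1 ->
  (fun n => (1 - x ^+ n) ^+ (2 ^ n * n)) @ \oo --> ((x < 2^-1)%R%:R : R).
Proof.
move=> /andP[x0 x1].
have xn n : 0 <= x ^+ n <= 1 by rewrite exprn_ge0//= exprn_ile1.
case: ltP => hx /=.
  apply: cvg_sub0; apply/norm_cvg0P.
  apply: (@cvg0_squeeze _ _ (fun n => n%:R * (2 * x) ^+ n)); last first.
    by apply: natr_mul_geometric_cvg0; lra.
  move=> n; rewrite normr_ge0 /=; have := bernoulli_ge (2 ^ n * n) (xn n).
  have -> : (2 ^ n * n)%:R * x ^+ n = n%:R * (2 * x) ^+ n :> R.
    by rewrite exprMn natrM natrX mulrAC mulrC.
  have : (1 - x ^+ n) ^+ (2 ^ n * n) <= 1.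
    by apply: exprn_ile1; have := xn n; lra.
  by rewrite ler_norml => *; apply/andP; split; lra.
apply: (@cvg0_squeeze _ _ (fun n => 2 ^- n)); last exact: geometric_cvg0.
move=> n.
rewrite exprn_ge0 ?subr_ge0//=; last by have /andP[] := xn n.
rewrite exprM -exprVn lerXn2r ?nnegrE ?invr_ge0 ?exprn_ge0//.
  by rewrite subr_ge0; have /andP[] := xn n.
have := bernoulli_prod_le (2 ^ n) (xn n).
have : 1 <= (2 ^ n)%:R * x ^+ n :> R.
  by rewrite natrX -exprMn exprn_ege1//; lra.
have : 0 <= (1 - x ^+ n) ^+ (2 ^ n).
  by rewrite exprn_ge0// subr_ge0; have /andP[] := xn n.
set a := (1 - x ^+ n) ^+ _; set b := _%:R * _; nra.
Qed.

End ThresholdPowers.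

Section BoundedMultipliers.
Context d (X : measurableType d) (R : realType).
Variable mu : {measure set X -> \bar R}.
Variables (I : Type) (psi : I -> X -> R).
Hypothesis psi_int : forall i, mu.-integrable [set: X] (EFin \o psi i).
Implicit Types (g h v w : X -> R).

Definition bounded_mfun h := measurable_fun [set: X] h /\ exists M, forall x, `|h x| <= M.

Lemma bounded_mfun_integrable i h : bounded_mfun h ->
  mu.-integrable [set: X] (EFin \o (fun x => h x * psi i x)).
Proof.
move=> [mh [M hM]].
have bh : [bounded h x | x in [set: X]].
  by exists M; split=> [|N MN x _]; [exact: num_real|exact: le_trans (hM x) (ltW MN)].
exact: (integrableMr measurableT mh bh (psi_int i)).
Qed.

Lemma bounded_mfunM v w : bounded_mfun v -> bounded_mfun w ->
  bounded_mfun (fun x => v x * w x).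
Proof.
move=> [mv [M vM]] [mw [N wN]]; split; first exact: measurable_funM.
by exists (M * N) => x; rewrite normrM ler_pM.
Qed.

Definition annihilating h :=
  bounded_mfun h /\ forall i, \int[mu]_x (h x * psi i x) = 0.

(** Multipliers of the annihilator form an algebra that is closed under bounded
    pointwise limits. This is why the sets whose indicators are multipliers form a
    sigma-algebra. *)
Definition multiplier v := bounded_mfun v /\
  forall h, annihilating h -> annihilating (fun x => v x * h x).

Lemma annihilatingB h g : annihilating h -> annihilating g ->
  annihilating (fun x => h x - g x).
Proof.
move=> [[mh [M hM]] h0] [[mg [N gN]] g0]; split.
  split; first exact: measurable_funB.
  by exists (M + N) => x; apply: le_trans (ler_normB _ _) _; exact: lerD.
move=> i; under eq_Rintegral do rewrite mulrBl.
rewrite RintegralB//;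
  [|by apply: bounded_mfun_integrable; split => //; eexists; eassumption..].
by rewrite h0 g0 subrr.
Qed.

Lemma annihilatingZ a h : annihilating h -> annihilating (fun x => a * h x).
Proof.
move=> [[mh [M hM]] h0]; split.
  split; first by apply: measurable_funM => //; exact: measurable_cst.
  by exists (`|a| * M) => x; rewrite normrM ler_wpM2l.
move=> i; under eq_Rintegral do rewrite -mulrA.
rewrite RintegralZl//; first by rewrite h0 mulr0.
by apply: bounded_mfun_integrable; split => //; exists M.
Qed.

Lemma annihilating_lim (h : nat -> X -> R) g (M : R) :
  (forall n, annihilating (h n)) -> (forall n x, `|h n x| <= M) ->
  (forall x, h ^~ x @ \oo --> g x) -> annihilating g.
Proof.
move=> hA hM hg.
have mg : measurable_fun [set: X] g.
  by apply: (measurable_fun_cvg (h := h)) => // n; case: (hA n) => -[].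
have gM x : `|g x| <= M by apply: (cvg_norm_le (fun n => hM n x)); exact: hg.
split; first by split => //; exists M.
move=> i.
have ig : mu.-integrable [set: X] (fun x => `|(M * psi i x)%:E|%E).
  apply: integrable_abse.
  apply: (@eq_integrable _ _ _ _ _ measurableT
    (fun x => (M%:E * (EFin \o psi i) x)%E)) => //.
  exact: integrableZl.
have := @dominated_convergence _ _ _ mu _ measurableT
  (fun n x => (h n x * psi i x)%:E) (fun x => (g x * psi i x)%:E) _ _ _ _ ig _.
case.
- by move=> n; have [bh _] := hA n; exact: measurable_int (bounded_mfun_integrable i bh).
- apply/measurable_EFinP; apply: measurable_funM => //.
  by apply/measurable_EFinP; exact: measurable_int (psi_int i).
- apply: aeW => x _; apply: cvg_EFin; first exact: nearW.
  by apply: cvgM; [exact: hg|exact: cvg_cst].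
- apply: aeW => x n _; rewrite /= lee_fin !normrM ler_wpM2r//.
  by apply: le_trans (hM n x) _; exact: ler_norm.
move=> _ _ hcvg; rewrite /Rintegral.
suff -> : (\int[mu]_x (g x * psi i x)%:E = 0)%E by [].
have e0 : (fun n => (\int[mu]_x (h n x * psi i x)%:E)%E) = (fun=> 0%E).
  apply/funext => n; have [bh /(_ i)] := hA n; rewrite /Rintegral => h0.
  rewrite -[LHS]fineK ?h0//.
  exact: (integrable_fin_num measurableT (bounded_mfun_integrable i bh)).
rewrite e0 in hcvg.
by apply: (cvg_unique (@ereal_hausdorff R) hcvg); exact: cvg_cst.
Qed.

Lemma multiplier_cst a : multiplier (fun=> a).
Proof.
split; last by move=> h; exact: annihilatingZ.
by split; [exact: measurable_cst|exists `|a|].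
Qed.

Lemma multiplierM v w : multiplier v -> multiplier w ->
  multiplier (fun x => v x * w x).
Proof.
move=> [bv Mv] [bw Mw]; split; first exact: bounded_mfunM.
move=> h /Mw/Mv; congr annihilating; apply/funext => x; exact: mulrA.
Qed.

Lemma multiplierB v w : multiplier v -> multiplier w ->
  multiplier (fun x => v x - w x).
Proof.
move=> [bv Mv] [bw Mw]; split.
  case: bv bw => [mv [M vM]] [mw [N wN]]; split; first exact: measurable_funB.
  by exists (M + N) => x; apply: le_trans (ler_normB _ _) _; exact: lerD.
move=> h Ah; have := annihilatingB (Mv h Ah) (Mw h Ah).
by congr annihilating; apply/funext => x; rewrite mulrBl.
Qed.

Lemma multiplierX v n : multiplier v -> multiplier (fun x => v x ^+ n).
Proof.
move=> Mv; elim: n => [|n IHn].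
  by under eq_fun do rewrite expr0; exact: multiplier_cst.
by under eq_fun do rewrite exprS; exact: multiplierM.
Qed.

Lemma multiplier_lim (v : nat -> X -> R) w (M : R) :
  (forall n, multiplier (v n)) -> (forall n x, `|v n x| <= M) ->
  (forall x, v ^~ x @ \oo --> w x) -> multiplier w.
Proof.
move=> vA vM vw; split.
  split; first by apply: (measurable_fun_cvg (h := v)) => // n; case: (vA n) => -[].
  by exists M => x; apply: (cvg_norm_le (fun n => vM n x)); exact: vw.
move=> h Ah; have [[mh [N hN]] _] := Ah.
apply: (@annihilating_lim (fun n x => v n x * h x) _ (M * N)).
- by move=> n; have [_] := vA n; apply.
- by move=> n x; rewrite normrM ler_pM.
- by move=> x; apply: cvgM; [exact: vw|exact: cvg_cst].
Qed.

Definition multiplier_set (A : set X) := multiplier (\1_A : X -> R).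

Lemma multiplier_sigma_algebra : sigma_algebra [set: X] multiplier_set.
Proof.
have MC A : multiplier_set A -> multiplier_set (~` A).
  move=> MA; have := multiplierB (multiplier_cst 1) MA.
  congr multiplier; apply/funext => x; rewrite !indicE in_setC.
  by case: (x \in A); rewrite ?subrr ?subr0.
have MU A B : multiplier_set A -> multiplier_set B -> multiplier_set (A `|` B).
  move=> /MC MA /MC MB; rewrite -[_ `|` _]setCK; apply: MC.
  rewrite setCU; have := multiplierM MA MB; congr multiplier.
  apply/funext => x; rewrite !indicE in_setI.
  by do 2!case: (_ \in _); rewrite /= ?mulr1 ?mulr0.
have M0 : multiplier_set set0.
  rewrite /multiplier_set; have := multiplier_cst 0; congr multiplier.
  by apply/funext => x; rewrite indic0.
split => // [A MA|F MF]; first by rewrite setTD; exact: MC.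
pose G n := \big[setU/set0]_(i < n) F i.
apply: (@multiplier_lim (fun n => \1_(G n)) _ 1).
- by move=> n; apply: (big_ind multiplier_set).
- by move=> n x; rewrite indicE; case: (_ \in _); rewrite /= ?normr1 ?normr0.
- move=> x; have [[n _ Fnx]|nF] := pselect ((\bigcup_k F k) x).
    apply: cvg_near_cst; exists n.+1 => // m /= nm.
    have hG : G m x by rewrite /G -bigcup_mkord; exists n.
    have hU : (\bigcup_k F k) x by exists n.
    by rewrite !indicE (mem_set hG) (mem_set hU).
  rewrite (_ : (fun n => _) = (fun=> \1_(\bigcup_k F k) x)); first exact: cvg_cst.
  apply/funext => n; rewrite !indicE !memNset// /G -bigcup_mkord => -[k _ Fk].
  by apply: nF; exists k.
Qed.

(** An affine change of variable moves the threshold [c] to [1/2], and the polynomials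
    of [threshold_cvg] in a multiplier are multipliers. *)
Lemma multiplier_sublevel v c : multiplier v -> (forall x, `|v x| <= 1) ->
  multiplier_set [set x | v x < c].
Proof.
move=> Mv v1; pose k : R := (2 * (1 + `|c|))^-1.
have c0 : 0 <= `|c| by [].
have k0 : 0 < k by rewrite invr_gt0; lra.
pose u x := k * (v x - c) - (- 2^-1).
have Mu : multiplier u.
  apply: multiplierB; last exact: multiplier_cst.
  by apply: multiplierM; [|apply: multiplierB => //]; exact: multiplier_cst.
have u01 x : 0 <= u x <= 1.
  have : `|v x - c| <= 1 + `|c| by apply: le_trans (ler_normB _ _) _; rewrite lerD2r.
  have kk : k * (1 + `|c|) = 2^-1 by rewrite /k; field; rewrite lt0r_neq0//; lra.
  rewrite ler_norml => /andP[l1 l2].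
  have h1 : k * (v x - c) <= 2^-1 by rewrite -kk ler_pM2l.
  have h2 : - 2^-1 <= k * (v x - c) by rewrite -kk -mulrN ler_pM2l.
  by rewrite /u; apply/andP; split; lra.
apply: (@multiplier_lim (fun n x => (1 - u x ^+ n) ^+ (2 ^ n * n)) _ 1).
- move=> n; apply: multiplierX; apply: multiplierB; first exact: multiplier_cst.
  exact: multiplierX.
- move=> n x; have /andP[a b] := u01 x.
  have h0 : 0 <= u x ^+ n by exact: exprn_ge0.
  have h1 : u x ^+ n <= 1 by exact: exprn_ile1.
  by rewrite normrX exprn_ile1// ger0_norm; lra.
- move=> x; have e : (x \in [set x | v x < c]) = (u x < 2^-1).
    have -> : (x \in [set x | v x < c]) = (v x < c) by apply/idP/idP; rewrite inE.
    have -> : (u x < 2^-1) = (k * (v x - c) < 0) by rewrite /u; apply/idP/idP; lra.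
    by rewrite pmulr_rlt0// subr_lt0.
  by rewrite indicE e; exact: threshold_cvg.
Qed.

Lemma multiplier_setI A B : multiplier_set A -> multiplier_set B ->
  multiplier_set (A `&` B).
Proof.
move=> MA MB; have := multiplierM MA MB; congr multiplier.
by apply/funext => x; rewrite !indicE in_setI; do 2!case: (_ \in _); rewrite /= ?mulr1 ?mulr0.
Qed.

(** When [psi] runs through a function times the real and imaginary parts of the
    powers of [z], multiplication by a coordinate of [z] has this shape, by the
    product formulas of trigonometry. *)
Lemma multiplier_recurrence v : bounded_mfun v ->
  (forall i, exists (a b : R) j k, forall x, v x * psi i x = a * psi j x + b * psi k x) ->
  multiplier v.
Proof.
move=> bv vrec; split => // h [bh h0]; split; first exact: bounded_mfunM.
move=> i; have [a [b [j [k e]]]] := vrec i.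
have {}e x : v x * h x * psi i x = a * (h x * psi j x) + b * (h x * psi k x).
  by rewrite mulrAC e; ring.
under eq_Rintegral do rewrite e.
have ih l c : mu.-integrable [set: X] (EFin \o (fun x => c * (h x * psi l x))).
  exact: (integrableZl measurableT c (bounded_mfun_integrable l bh)).
rewrite RintegralD// !RintegralZl//; try exact: bounded_mfun_integrable.
by rewrite !h0 !mulr0 addr0.
Qed.

End BoundedMultipliers.

Section FourierUniqueness.
Variable R : realType.
Local Notation mu := (@circle_measure R).

Lemma norm_circle (z : circle R) : `|circle_val z| = 1.
Proof. exact: eqP (valP z). Qed.

Lemma circle_neq0 (z : circle R) : circle_val z != 0.
Proof. by rewrite -normr_eq0 norm_circle oner_eq0. Qed.

Lemma norm_circleX (z : circle R) (n : int) : `|circle_val z ^ n| = 1.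
Proof.
case: n => n; first by rewrite -exprnP normrX norm_circle expr1n.
by rewrite NegzE -exprnN normfV normrX norm_circle expr1n invr1.
Qed.

Lemma conj_circleX (z : circle R) (n : int) : (circle_val z ^ n)^* = circle_val z ^ (- n).
Proof.
have := invC_norm (circle_val z ^ n); rewrite norm_circleX expr1n invr1 mul1r => <-.
exact: invr_expz.
Qed.

Lemma circleXD (z : circle R) (m n : int) :
  circle_val z ^ (m + n) = circle_val z ^ m * circle_val z ^ n.
Proof. by rewrite expfzDr// circle_neq0. Qed.

Lemma cmeasurable_circleX (n : int) :
  cmeasurable (fun z : circle R => circle_val z ^ n).
Proof.
have pos (m : nat) : cmeasurable (fun z : circle R => circle_val z ^ m).
  elim: m => [|m IHm]; first exact: cmeasurable_cst.
  under [X in cmeasurable X]eq_fun do rewrite exprSz.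
  by apply: cmeasurableM => //; exact: cmeasurable_circle_val.
case: n => n; first exact: pos.
have [mr mi] := pos n.+1.
have e (z : circle R) : circle_val z ^ (Negz n) = (circle_val z ^ (n.+1 : int))^*.
  by rewrite conj_circleX NegzE.
split.
  by under eq_fun do rewrite e cReJ.
by under eq_fun do rewrite e cImJ; exact: measurableT_comp.
Qed.

Lemma Re_circleX_le (z : circle R) (n : int) : `|complex.Re (circle_val z ^ n)| <= 1.
Proof.
by rewrite -lecR; have := normc_ge_Re (circle_val z ^ n); rewrite norm_circleX.
Qed.

Lemma Im_circleX_le (z : circle R) (n : int) : `|complex.Im (circle_val z ^ n)| <= 1.
Proof.
rewrite -(ler_pXn2r (n := 2)) ?nnegrE// expr1n real_normK ?num_real//.
have := Re_norm_sq (circle_val z ^ n); rewrite norm_circleX /= expr1n => ->.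
by rewrite lerDr sqr_ge0.
Qed.

Section RealFunction.
Variable phi : circle R -> R.
Hypothesis phi_int : mu.-integrable [set: circle R] (EFin \o phi).
Hypothesis phi_coef : forall n : int,
  \int[mu]_z (complex.Re (circle_val z ^ n) * phi z) = 0 /\
  \int[mu]_z (complex.Im (circle_val z ^ n) * phi z) = 0.

Let psi (i : int * bool) (z : circle R) : R :=
  (if i.2 then complex.Re (circle_val z ^ i.1) else complex.Im (circle_val z ^ i.1)) * phi z.

Let part_bounded (i : int * bool) : bounded_mfun (fun z : circle R =>
  if i.2 then complex.Re (circle_val z ^ i.1) else complex.Im (circle_val z ^ i.1)).
Proof.
have [mr mi] := cmeasurable_circleX i.1.
case: i mr mi => n [] /= mr mi; split => //; exists 1 => z.
  exact: Re_circleX_le.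
exact: Im_circleX_le.
Qed.

Let psi_int i : mu.-integrable [set: circle R] (EFin \o psi i).
Proof.
exact: (@bounded_mfun_integrable _ _ _ mu unit (fun=> phi) (fun=> phi_int) tt _
  (part_bounded i)).
Qed.

Let mult_Re : multiplier mu psi (fun z : circle R => complex.Re (circle_val z)).
Proof.
apply: multiplier_recurrence => //; first exact: (part_bounded (1, true)).
move=> [n b]; exists 2^-1, 2^-1, (n + 1, b), (n - 1, b) => z.
rewrite /psi /= !circleXD expr1z -(conj_circleX z 1) expr1z.
by case: b; rewrite ?cReM ?cImM cReJ cImJ; field.
Qed.

Let mult_Im : multiplier mu psi (fun z : circle R => complex.Im (circle_val z)).
Proof.
apply: multiplier_recurrence => //; first exact: (part_bounded (1, false)).
move=> [n b]; exists (if b then 2^-1 else - 2^-1), (if b then - 2^-1 else 2^-1),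
  (n + 1, ~~ b), (n - 1, ~~ b) => z.
rewrite /psi /= !circleXD expr1z -(conj_circleX z 1) expr1z.
by case: b => /=; rewrite ?cReM ?cImM cReJ cImJ; field.
Qed.

Let mult_rectangle (q : rat * rat * (rat * rat)) :
  multiplier_set mu psi [set z : circle R |
    (ratr q.1.1 < complex.Re (circle_val z) /\ complex.Re (circle_val z) < ratr q.1.2) /\
    (ratr q.2.1 < complex.Im (circle_val z) /\ complex.Im (circle_val z) < ratr q.2.2)].
Proof.
have half (v : circle R -> R) (a b : R) : multiplier mu psi v -> (forall z, `|v z| <= 1) ->
    multiplier_set mu psi [set z | a < v z /\ v z < b].
  move=> Mv v1; apply: multiplier_setI; last exact: multiplier_sublevel.
  rewrite (_ : (fun z => _) = [set z | 0 - v z < - a]); last first.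
    by apply/funext => z /=; rewrite sub0r ltrN2.
  apply: multiplier_sublevel => // [|z]; last by rewrite sub0r normrN.
  by apply: multiplierB => //; exact: multiplier_cst.
apply: multiplier_setI; apply: half => // z.
  by have := Re_circleX_le z 1; rewrite expr1z.
by have := Im_circleX_le z 1; rewrite expr1z.
Qed.

Let mult_open (A : set (circle R)) : @circle_open R A -> multiplier_set mu psi A.
Proof.
move=> [U oU ->].
have [M0 MC MU] := multiplier_sigma_algebra psi_int.
pose rect (q : rat * rat * (rat * rat)) := [set w : R[i] |
    (ratr q.1.1 < complex.Re w /\ complex.Re w < ratr q.1.2) /\
    (ratr q.2.1 < complex.Im w /\ complex.Im w < ratr q.2.2)].
pose F n : set (circle R) := if unpickle n is Some q then
   [set z | rect q `<=` U /\ rect q (circle_val z)] else set0.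
suff -> : @circle_val R @^-1` U = \bigcup_n F n.
  apply: MU => n; rewrite /F; case: unpickle => [q|]//.
  have [qU|qU] := pselect (rect q `<=` U).
    rewrite (_ : [set _ | _] = [set z | rect q (circle_val z)]).
      exact: mult_rectangle.
    by apply/seteqP; split=> z /=; [case|split].
  by rewrite (_ : [set _ | _] = set0)//; apply/seteqP; split=> z //= [].
apply/seteqP; split=> z /=; last first.
  by move=> [n _]; rewrite /F; case: unpickle => // q [qU]; exact: qU.
move=> Uz; move: oU; rewrite openE => /(_ _ Uz); rewrite /interior /= -nbhs_ballE.
move=> [e /= e0 eU].
have eE := gt0_complexE e0.
have r0 : 0 < complex.Re e by rewrite -ltcR -eE.
set r := complex.Re e in eE r0.
(* a rational rectangle around z inside the disc of radius r *)
have near (x : R) : exists p q : rat,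
    [/\ ratr p < x, x < ratr q & x - r / 2 < ratr p /\ ratr q < x + r / 2].
  have lx : x - r / 2 < x by lra.
  have rx : x < x + r / 2 by lra.
  have [p] := rat_in_itvoo lx; have [q] := rat_in_itvoo rx.
  by rewrite !in_itv /= => /andP[? ?] /andP[? ?]; exists p, q.
have [p1 [q1 [h1 h2 [h3 h4]]]] := near (complex.Re (circle_val z)).
have [p2 [q2 [k1 k2 [k3 k4]]]] := near (complex.Im (circle_val z)).
exists (pickle ((p1, q1), (p2, q2))); first exact: Logic.I.
rewrite /F pickleK; split; last by split.
move=> w [[a1 a2] [b1 b2]]; rewrite /= in a1 a2 b1 b2.
apply: eU; rewrite -ball_normE /= -Re_normE eE ltcR.
apply: le_lt_trans (norm_le_ReIm _) _; rewrite cReD cImD cReN cImN.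
have : `|complex.Re (circle_val z) - complex.Re w| < r / 2.
  by rewrite ltr_norml; apply/andP; split; lra.
have : `|complex.Im (circle_val z) - complex.Im w| < r / 2.
  by rewrite ltr_norml; apply/andP; split; lra.
lra.
Qed.

(** The hypothesis says that the constant 1 annihilates [phi] times all
    trigonometric functions, and the coordinates of the plane are multipliers. Hence
    every indicator of a Borel set is a multiplier, and [phi] has integral 0 on every
    Borel set. *)
Lemma fourier_unique_real : {ae mu, forall z, phi z = 0}.
Proof.
have one : annihilating mu psi (fun=> 1).
  split; first by split; [exact: measurable_cst|exists 1 => x; rewrite normr1].
  move=> [n b]; under eq_Rintegral do rewrite mul1r /psi /=.
  by have [] := phi_coef n; case: b.
have mA (A : set (circle R)) : measurable A -> multiplier_set mu psi A.
  exact: (@smallest_sub _ (sigma_algebra [set: circle R]) (@circle_open R)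
    (multiplier_set mu psi) (multiplier_sigma_algebra psi_int) mult_open A).
have : ae_eq mu [set: circle R] (EFin \o phi) (cst 0%E).
  apply: integral_ae_eq => // A _ mA'.
  rewrite integral0.
  have [_ /(_ _ one) [bA /(_ (0, true)) A0]] := mA _ mA'.
  have e : (EFin \o phi) \_ A = EFin \o (fun z => \1_A z * 1 * psi (0, true) z).
    apply/funext => z; rewrite /patch [RHS]/= indicE /psi expr0z /= mulr1.
    by case: (z \in A); rewrite /= ?mul1r ?mul0r.
  rewrite integral_mkcond e -[LHS]fineK.
    by congr (_%:E); exact: A0.
  exact: (integrable_fin_num measurableT (bounded_mfun_integrable psi_int (0, true) bA)).
by apply: filterS => z /= /(_ Logic.I)[].
Qed.

End RealFunction.

End FourierUniqueness.

(** * Integrals of powers of z *)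
Section CircleMoments.
Variable R : realType.
Local Notation mu := (@circle_measure R).

Lemma circle_expX (t : R) (m : nat) :
  circle_val (circle_exp t) ^ m =
  Complex (cos (m%:R * (2 * pi * t))) (sin (m%:R * (2 * pi * t))).
Proof.
elim: m => [|m IHm]; first by rewrite mul0r cos0 sin0 expr0z.
have -> : m.+1%:R * (2 * pi * t) = m%:R * (2 * pi * t) + 2 * pi * t.
  by rewrite -[m.+1%:R]natr1 mulrDl mul1r.
rewrite exprSz IHm cosD sinD /=; apply/eqP.
by rewrite eq_complex /=; apply/andP; split; apply/eqP; ring.
Qed.

(** The fundamental theorem of calculus on [[0, 1]], transported by the
    parametrization of the circle. *)
Lemma integral_circle_eq0 (f : circle R -> R) (F : R -> R) :
  bounded_mfun f -> continuous (fun t : R => f (circle_exp t)) ->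
  (forall t : R, is_derive t 1 F (f (circle_exp t))) -> F 0 = F 1 ->
  \int[mu]_z f z = 0.
Proof.
move=> [mf [M fM]] cf dF F01.
pose nu : {measure set (measurableTypeR R) -> \bar R} :=
  mrestr (@lebesgue_measure R) (measurable_itv `[0%R, 1%R]).
pose g t := f (circle_exp t).
have mg : measurable_fun [set: measurableTypeR R] g.
  exact: measurableT_comp mf (@measurable_circle_exp R).
have ig : nu.-integrable [set: measurableTypeR R] (EFin \o g).
  apply: measurable_bounded_integrable => //.
    by rewrite /nu /= /mrestr setTI lebesgue_measure_itv /= lte01 oppr0 adde0 ltry.
  by exists M; split=> [|N MN x _]; [exact: num_real|exact: le_trans (fM _) (ltW MN)].
suff : (\int[mu]_z (f z)%:E = 0)%E by rewrite /Rintegral => ->.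
transitivity (\int[pushforward nu (@circle_exp R)]_z (EFin \o f) z)%E => //.
rewrite (integral_pushforward (@measurable_circle_exp R))//; last first.
  exact/measurable_EFinP.
rewrite preimage_setT.
have mI : measurable (`[0%R, 1%R] : set (measurableTypeR R)) by exact: measurable_itv.
rewrite (@negligible_integral _ _ _ nu _ (~` `[0%R, 1%R]))//; last 2 first.
- exact: measurableC.
- by rewrite /nu /= /mrestr setICl measure0.
rewrite setTD setCK (@eq_measure_integral _ _ _ _ (@lebesgue_measure R)); last first.
  by move=> A mA AI; rewrite /nu /= /mrestr setIidl.
rewrite (@continuous_FTC2 _ g F)//.
- by rewrite F01 -EFinB subrr.
- exact: continuous_subspaceT.
- have cF : continuous F.
    move=> x; apply: differentiable_continuous; apply/derivable1_diffP.
    exact: ex_derive.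
  split; first by move=> x _; apply: ex_derive.
    by apply: cvg_at_right_filter; exact: cF.
  by apply: cvg_at_left_filter; exact: cF.
- by move=> x _; rewrite derive1E; exact: derive_val.
Qed.

Lemma circle_moments_pos (m : nat) : (0 < m)%N ->
  \int[mu]_z complex.Re (circle_val z ^ m) = 0 /\
  \int[mu]_z complex.Im (circle_val z ^ m) = 0.
Proof.
move=> m0; pose c : R := m%:R * (2 * pi).
have c0 : c != 0 by rewrite /c !mulf_neq0 ?pnatr_eq0 ?gt_eqF ?pi_gt0// -lt0n.
have [cosc sinc] : cos c = 1 /\ sin c = 0.
  have one : circle_val (circle_exp (1 : R)) = 1.
    apply/eqP; rewrite eq_complex /= mulr1.
    by rewrite [2 * pi]mulrC mulr_natr cos2pi sin2pi !eqxx.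
  have := circle_expX 1 m; rewrite one exp1rz mulr1 -/c => h.
  by have := congr1 (@complex.Re R) h; have := congr1 (@complex.Im R) h => /= <- <-.
have cexp (t : R) : m%:R * (2 * pi * t) = c * t by rewrite /c !mulrA.
have dc (t : R) : is_derive t 1 (fun t : R => c * t) c.
  have := is_deriveZ c (is_derive_id t (1 : R)); rewrite /GRing.scale /= mulr1; exact.
have cc : continuous (fun t : R => c * t) by move=> t; exact: mulrl_continuous.
split.
  apply: (@integral_circle_eq0 _ (fun t => c^-1 * sin (c * t))).
  - split; first by have [] := cmeasurable_circleX R m.
    by exists 1 => z; exact: Re_circleX_le.
  - under eq_fun do rewrite circle_expX /= cexp.
    by move=> t; apply: continuous_comp; [exact: cc|exact: continuous_cos].
  - move=> t; rewrite circle_expX /= cexp.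
    have d1 := is_derive1_comp (is_derive_sin (c * t)) (dc t).
    have := is_deriveZ c^-1 d1; rewrite /GRing.scale /= mulrCA mulVf// mulr1.
    exact.
  - by rewrite mulr0 mulr1 sin0 sinc.
apply: (@integral_circle_eq0 _ (fun t => - c^-1 * cos (c * t))).
- split; first by have [] := cmeasurable_circleX R m.
  by exists 1 => z; exact: Im_circleX_le.
- under eq_fun do rewrite circle_expX /= cexp.
  by move=> t; apply: continuous_comp; [exact: cc|exact: continuous_sin].
- move=> t; rewrite circle_expX /= cexp.
  have d1 := is_derive1_comp (is_derive_cos (c * t)) (dc t).
  have := is_deriveZ (- c^-1) d1.
  rewrite /GRing.scale /= mulNr mulNr mulrN opprK mulrCA mulVf// mulr1.
  exact.
- by rewrite mulr0 mulr1 cos0 cosc.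
Qed.

Lemma circle_power_integrable (n : int) :
  mu.-integrable [set: circle R] (EFin \o (fun z => complex.Re (circle_val z ^ n))) /\
  mu.-integrable [set: circle R] (EFin \o (fun z => complex.Im (circle_val z ^ n))).
Proof.
have [mr mi] := cmeasurable_circleX R n.
have fin : (mu [set: circle R] < +oo)%E by rewrite /= probability_setT ltry.
split; apply: measurable_bounded_integrable => //; exists 1.
  by split=> [|N MN z _]; [exact: num_real|exact: le_trans (Re_circleX_le _ _) (ltW MN)].
by split=> [|N MN z _]; [exact: num_real|exact: le_trans (Im_circleX_le _ _) (ltW MN)].
Qed.

Lemma circle_moments (n : int) : n != 0 ->
  \int[mu]_z complex.Re (circle_val z ^ n) = 0 /\
  \int[mu]_z complex.Im (circle_val z ^ n) = 0.
Proof.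
case: n => [m|m] n0; first by apply: circle_moments_pos; rewrite lt0n.
have [hr hi] := @circle_moments_pos m.+1 isT.
have e (z : circle R) : circle_val z ^ (Negz m) = (circle_val z ^ (m.+1 : int))^*.
  by rewrite conj_circleX NegzE.
split; first by under eq_Rintegral do rewrite e cReJ.
under eq_Rintegral do rewrite e cImJ -mulN1r.
rewrite RintegralZl//; first by rewrite hi mulr0.
by have [] := circle_power_integrable m.+1.
Qed.

Lemma cintegral_circleX (n : int) (a : R[i]) : n != 0 ->
  cintegral mu (fun z => circle_val z ^ n * a) = 0.
Proof.
move=> n0; have [hr hi] := circle_moments n0; have [ir ii] := circle_power_integrable n.
have iZ (c : R) (h : circle R -> R) : mu.-integrable [set: circle R] (EFin \o h) ->
    mu.-integrable [set: circle R] (EFin \o (fun z => c * h z)).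
  exact: (integrableZl measurableT c).
have eR (z : circle R) : complex.Re (circle_val z ^ n * a) =
    complex.Re a * complex.Re (circle_val z ^ n) -
    complex.Im a * complex.Im (circle_val z ^ n).
  by rewrite cReM; ring.
have eI (z : circle R) : complex.Im (circle_val z ^ n * a) =
    complex.Im a * complex.Re (circle_val z ^ n) +
    complex.Re a * complex.Im (circle_val z ^ n).
  by rewrite cImM; ring.
rewrite /cintegral (eq_Rintegral _ (fun z _ => eR z)) (eq_Rintegral _ (fun z _ => eI z)).
rewrite RintegralB ?RintegralD//; try exact: iZ.
by rewrite !RintegralZl// hr hi !mulr0 subrr addr0.
Qed.

Lemma circle_part_integrable (phi : circle R -> R) (n : int) :
  mu.-integrable [set: circle R] (EFin \o phi) ->
  mu.-integrable [set: circle R] (EFin \o (fun z => complex.Re (circle_val z ^ n) * phi z)) /\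
  mu.-integrable [set: circle R] (EFin \o (fun z => complex.Im (circle_val z ^ n) * phi z)).
Proof.
move=> iphi; have [mr mi] := cmeasurable_circleX R n.
have h g := @bounded_mfun_integrable _ _ _ mu unit (fun=> phi) (fun=> iphi) tt g.
by split; apply: h; split => //; exists 1 => z; [exact: Re_circleX_le|exact: Im_circleX_le].
Qed.

(** The coefficients of index [n] and [- n] together determine the integrals of the
    real and imaginary parts against [cos] and [sin], which reduces to the real case. *)
Lemma fourier_unique (phi : circle R -> R[i]) :
  mu.-integrable [set: circle R] (EFin \o (fun z => complex.Re (phi z))) ->
  mu.-integrable [set: circle R] (EFin \o (fun z => complex.Im (phi z))) ->
  (forall n : int, cintegral mu (fun z => circle_val z ^ n * phi z) = 0) ->
  {ae mu, forall z, phi z = 0}.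
Proof.
move=> iR iI phi0.
have key n : [/\ \int[mu]_z (complex.Re (circle_val z ^ n) * complex.Re (phi z)) = 0,
    \int[mu]_z (complex.Im (circle_val z ^ n) * complex.Im (phi z)) = 0,
    \int[mu]_z (complex.Re (circle_val z ^ n) * complex.Im (phi z)) = 0 &
    \int[mu]_z (complex.Im (circle_val z ^ n) * complex.Re (phi z)) = 0].
  have [iRR iIR] := circle_part_integrable n iR.
  have [iRI iII] := circle_part_integrable n iI.
  have [h3 h4] := phi0 n; have [h1 h2] := phi0 (- n).
  have e1 (z : circle R) : complex.Re (circle_val z ^ (- n) * phi z) =
      complex.Re (circle_val z ^ n) * complex.Re (phi z) +
      complex.Im (circle_val z ^ n) * complex.Im (phi z).
    by rewrite -conj_circleX cReM cReJ cImJ; ring.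
  have e2 (z : circle R) : complex.Im (circle_val z ^ (- n) * phi z) =
      complex.Re (circle_val z ^ n) * complex.Im (phi z) -
      complex.Im (circle_val z ^ n) * complex.Re (phi z).
    by rewrite -conj_circleX cImM cReJ cImJ; ring.
  rewrite (eq_Rintegral _ (fun z _ => e1 z)) RintegralD// in h1.
  rewrite (eq_Rintegral _ (fun z _ => e2 z)) RintegralB// in h2.
  rewrite (eq_Rintegral _ (fun z _ => cReM _ _)) RintegralB// in h3.
  rewrite (eq_Rintegral _ (fun z _ => cImM _ _)) RintegralD// in h4.
  by split; lra.
have hR : {ae mu, forall z, complex.Re (phi z) = 0}.
  by apply: fourier_unique_real => // n; have [? ? ? ?] := key n.
have hI : {ae mu, forall z, complex.Im (phi z) = 0}.
  by apply: fourier_unique_real => // n; have [? ? ? ?] := key n.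
move: hR hI; apply: filterS2 => z.
by case: (phi z) => x y /= -> ->.
Qed.

End CircleMoments.

(** * Multiplication by powers of z *)
Section DenseSequences.
Variables (R : realType) (K : sepHilbertType R).

Lemma dense_sequence : exists e : nat -> K, forall x, closure (range e) x.
Proof.
have [D cD dD] := @separable_dense R K.
have [e eD] : exists e : nat -> K, D `<=` range e.
  have /countable_injP[i iI] := cD.
  exists (fun n => xget 0 [set k | D k /\ i k = n]) => k Dk.
  exists (i k) => //; case: xgetP => [y _ [Dy iy]|/(_ k)[]//].
  by apply: iI => //; rewrite inE.
exists e => x; apply/closure_approx => r r0.
have [||y []] := dD (ball x r%:C%C).
- by exists x; apply: ballxx; rewrite ltcR.
- exact: ball_open.
by rewrite -ball_normE /= nrmE ltcR nrmBC => xy /eD ey; exists y.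
Qed.

Lemma closed_dense (e : nat -> K) (A : set K) : (forall x, closure (range e) x) ->
  closed A -> (forall n, A (e n)) -> forall x, A x.
Proof.
move=> de cA Ae x; rewrite ((closure_id A).1 cA).
by apply: closure_subset (de x) => _ [n _ <-].
Qed.

End DenseSequences.

Section VectorValued.
Variables (R : realType) (K : sepHilbertType R).
Local Notation mu := (@circle_measure R).
Local Notation L2K := (L2circle K).
Implicit Types (f g : L2circle K) (n m : int) (k : K).

Lemma zpow_subproof n (f : L2fun mu K) :
  (fun z : circle R => circle_val z ^ n *: f z) \in L2pred mu K.
Proof.
have [mf fi] := L2funP f; apply/asboolP; split.
  by apply: vmeasurableM => //; exact: cmeasurable_circleX.
under eq_integral => z _.
  have -> : sqnorm (circle_val z ^ n *: f z) = sqnorm (f z).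
    by rewrite /sqnorm normrZ norm_circleX mul1r.
  over.
exact: fi.
Qed.

(** The bilateral shift and its inverse as one unitary group indexed by the integers.
    Everything about the unilateral shift below is phrased through it. *)
Definition zpow n f : L2circle K := L2pi (MkL2fun (zpow_subproof n f)).

Lemma zpow_ae n f : {ae mu, forall z, zpow n f z = circle_val z ^ n *: f z}.
Proof. by have := L2piK (MkL2fun (zpow_subproof n f)); apply: filterS => z /= ->. Qed.

Lemma zpow0 f : zpow 0 f = f.
Proof.
by apply: L2_eq; have := zpow_ae 0 f; apply: filterS => z ->; rewrite expr0z scale1r.
Qed.

Lemma zpow1 f : zpow 1 f = zshift f.
Proof.
apply: L2_eq; move: (zpow_ae 1 f) (L2piK (MkL2fun (zshift_subproof f))).
by apply: filterS2 => z -> /= ->//; rewrite expr1z.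
Qed.

Lemma zpowD m n f : zpow m (zpow n f) = zpow (m + n) f.
Proof.
apply: L2_eq; move: (zpow_ae m (zpow n f)) (zpow_ae n f) (zpow_ae (m + n) f).
by apply: filterS3 => z -> -> ->; rewrite scalerA circleXD.
Qed.

Lemma zpowK n f : zpow (- n) (zpow n f) = f.
Proof. by rewrite zpowD addNr zpow0. Qed.

Lemma zpowNK n f : zpow n (zpow (- n) f) = f.
Proof. by rewrite zpowD subrr zpow0. Qed.

Lemma zpow_linear n a f g : zpow n (a *: f + g) = a *: zpow n f + zpow n g.
Proof.
apply: L2_eq.
have h1 : {ae mu, forall z, L2repr (a *: f + g) z = a *: f z + g z}.
  by move: (L2_aeD (a *: f) g) (L2_aeZ a f); apply: filterS2 => z -> ->.
have h2 : {ae mu, forall z, L2repr (a *: zpow n f + zpow n g) z =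
    a *: (circle_val z ^ n *: f z) + circle_val z ^ n *: g z}.
  have h : {ae mu, forall z, L2repr (a *: zpow n f + zpow n g) z =
      a *: zpow n f z + zpow n g z}.
    move: (L2_aeD (a *: zpow n f) (zpow n g)) (L2_aeZ a (zpow n f)).
    by apply: filterS2 => z -> ->.
  by move: h (zpow_ae n f) (zpow_ae n g); apply: filterS3 => z -> -> ->.
move: (zpow_ae n (a *: f + g)) h1 h2; apply: filterS3 => z -> -> ->.
by rewrite scalerDr !scalerA mulrC.
Qed.

Lemma zpowB n f g : zpow n (f - g) = zpow n f - zpow n g.
Proof. exact: (linear_subE (zpow_linear n)). Qed.

Lemma dot_zpow n f g : dot (zpow n f) g = dot f (zpow (- n) g).
Proof.
have e1 : dot (zpow n f) g = idot (MkL2fun (zpow_subproof n f)) (L2repr g).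
  by apply: ae_eq_idot; [exact: L2piK|exact: ae_eq_refl].
have e2 : dot f (zpow (- n) g) = idot (L2repr f) (MkL2fun (zpow_subproof (- n) g)).
  by apply: ae_eq_idot; [exact: ae_eq_refl|exact: L2piK].
rewrite e1 e2 /idot; congr cintegral; apply/funext => z /=.
by rewrite dotZl dotZr conj_circleX opprK.
Qed.

Lemma dot_zpowE n f g : dot f (zpow n g) =
  cintegral mu (fun z => circle_val z ^ (- n) * dot (f z) (g z)).
Proof.
have -> : dot f (zpow n g) = idot (L2repr f) (MkL2fun (zpow_subproof n g)).
  by apply: ae_eq_idot; [exact: ae_eq_refl|exact: L2piK].
rewrite /idot; congr cintegral; apply/funext => z /=.
by rewrite dotZr conj_circleX.
Qed.

Lemma zpow_isometry n f g : dot (zpow n f) (zpow n g) = dot f g.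
Proof. by rewrite dot_zpow zpowK. Qed.

Lemma nrm_zpow n f : nrm (zpow n f) = nrm f.
Proof.
by apply: nrm_eq_sqnorm; rewrite !sqnorm_dot zpow_isometry.
Qed.

Lemma zpow_cvg n (u : nat -> L2circle K) f : u @ \oo --> f ->
  (fun i => zpow n (u i)) @ \oo --> zpow n f.
Proof.
move=> /cvg_nrmP uf; apply/cvg_nrmP.
by under eq_fun do rewrite -zpowB nrm_zpow.
Qed.

(** Orthogonality to all the functions [z^n g] means that the scalar function
    [z |-> <f(z), g(z)>] has vanishing Fourier coefficients. This turns global
    orthogonality into pointwise orthogonality. *)
Lemma orth_zpow_ae f g : (forall n, dot f (zpow n g) = 0) ->
  {ae mu, forall z, dot (f z) (g z) = 0}.
Proof.
move=> fg; apply: fourier_unique.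
- exact: integrable_Re_dot.
- exact: integrable_Im_dot.
- by move=> n; rewrite -(fg (- n)) dot_zpowE opprK.
Qed.

Lemma cst_subproof k : (fun _ : circle R => k) \in L2pred mu K.
Proof.
apply/asboolP; split; first by move=> x; exact: cmeasurable_cst.
rewrite integral_cst//= probability_setT mule1; exact: ltry.
Qed.

Definition constL2 k : L2circle K := L2pi (MkL2fun (cst_subproof k)).

Lemma constL2_ae k : {ae mu, forall z, constL2 k z = k}.
Proof. by have := L2piK (MkL2fun (cst_subproof k)); apply: filterS => z /= ->. Qed.

Lemma constL2_linear a k l : constL2 (a *: k + l) = a *: constL2 k + constL2 l.
Proof.
apply: L2_eq.
have h : {ae mu, forall z, L2repr (a *: constL2 k + constL2 l) z =
    a *: constL2 k z + constL2 l z}.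
  move: (L2_aeD (a *: constL2 k) (constL2 l)) (L2_aeZ a (constL2 k)).
  by apply: filterS2 => z -> ->.
have h' : {ae mu, forall z, L2repr (a *: constL2 k + constL2 l) z = a *: k + l}.
  by move: h (constL2_ae k) (constL2_ae l); apply: filterS3 => z -> -> ->.
by move: h' (constL2_ae (a *: k + l)); apply: filterS2 => z -> ->.
Qed.

Lemma constL2B k l : constL2 (k - l) = constL2 k - constL2 l.
Proof. exact: (linear_subE constL2_linear). Qed.

Lemma dot_zpow_constE n f k : dot f (zpow n (constL2 k)) =
  cintegral mu (fun z => circle_val z ^ (- n) * dot (f z) k).
Proof.
rewrite -[n in LHS]opprK -dot_zpow.
have -> : dot (zpow (- n) f) (constL2 k) =
    idot (MkL2fun (zpow_subproof (- n) f)) (MkL2fun (cst_subproof k)).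
  by apply: ae_eq_idot; exact: L2piK.
by rewrite /idot; congr cintegral; apply/funext => z /=; rewrite dotZl.
Qed.

Lemma dot_const_zpow n k l : n != 0 -> dot (constL2 k) (zpow n (constL2 l)) = 0.
Proof.
move=> n0; have nn0 : - n != 0 by rewrite oppr_eq0.
rewrite -[n]opprK -dot_zpow.
have -> : dot (zpow (- n) (constL2 k)) (constL2 l) = idot
    (MkL2fun (zpow_subproof (- n) (MkL2fun (cst_subproof k)))) (MkL2fun (cst_subproof l)).
  apply: ae_eq_idot; last exact: L2piK.
  apply: (ae_eq_trans (L2piK _)); move: (L2piK (MkL2fun (cst_subproof k))).
  by apply: filterS => z /= h _; rewrite h.
rewrite /idot -[RHS](cintegral_circleX (dot k l) nn0).
by congr cintegral; apply/funext => z /=; rewrite dotZl.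
Qed.

Lemma dot_const k l : dot (constL2 k) (constL2 l) = dot k l.
Proof.
rewrite [LHS]L2dotE /idot /cintegral /=.
rewrite !Rintegral_cst//= probability_setT /= !mulr1.
by case: (dot k l).
Qed.

Lemma hardyP f : hardy K f <-> forall n k, n < 0 -> dot f (zpow n (constL2 k)) = 0.
Proof.
split=> [hf n k n0|hf n n0 k].
  by rewrite dot_zpow_constE -(hf n n0 k) dot0l.
by rewrite dot0l -dot_zpow_constE hf.
Qed.

Lemma L2_eq0 f : (forall n k, dot f (zpow n (constL2 k)) = 0) -> f = 0.
Proof.
move=> f0; have [e eD] := dense_sequence K.
have ae0 : {ae mu, forall z, forall i : nat, dot (f z) (e i) = 0}.
  apply: ae_foralln => n; move: (orth_zpow_ae (f0 ^~ (e n))) (constL2_ae (e n)).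
  by apply: filterS2 => z h e_n; rewrite -[e n]e_n.
apply: L2_eq; move: ae0 (L2_ae0 mu K); apply: filterS2 => z fz ->.
apply: dotxx_eq0; apply: (closed_dense eD (A := [set k | dot (f z) k = 0])) => //.
apply/closed_seqP => u l u0 ul; apply: dot_sym0.
by apply: (cvg_dot_eq0 ul) => n; apply: dot_sym0; exact: u0.
Qed.

End VectorValued.

(** * The Hardy space *)
Section IsometricImages.
Variable R : realType.

Lemma lim_unique (V : normedModType R[i]) (u v : nat -> V) (l m : V) : u @ \oo --> l ->
  v @ \oo --> m -> (forall n, u n = v n) -> l = m.
Proof.
move=> ul vm uv; have {}vm : u @ \oo --> m by rewrite (_ : u = v)//; exact/funext.
exact: (cvg_unique (@norm_hausdorff _ V) ul vm).
Qed.

Lemma cvg_ZD (V : preHilbertType R) (u v : nat -> V) l m a : u @ \oo --> l ->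
  v @ \oo --> m -> (fun n => a *: u n + v n) @ \oo --> a *: l + m.
Proof.
move=> /cvg_nrmP ul /cvg_nrmP vm; apply/cvg_nrmP.
apply: (cvg0_squeeze _ (cvg0D (cvg0Zl (complex.Re `|a|) ul) vm)) => n.
rewrite nrm_ge0 /= opprD addrACA -scalerBr.
by apply: le_trans (nrmD _ _) _; rewrite nrmZ.
Qed.

Lemma isometric_image_closed (H V : hilbertType R) (f : H -> V) :
  (forall a x y, f (a *: x + y) = a *: f x + f y) ->
  (forall x, sqnorm (f x) = sqnorm x) -> closed_subspace (range f).
Proof.
move=> fl fi.
have fB := linear_subE fl.
split; first split.
- by exists (0 - 0) => //; rewrite fB subrr.
- by move=> a _ _ [x _ <-] [y _ <-]; exists (a *: x + y).
apply/closed_seqP => u l uf /cvg_sqnormP ul.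
have /choice[p pP] : forall n : nat, exists x, sqnorm (f x - l) <= n.+1%:R^-1.
  move=> n; have n0 : 0 < n.+1%:R^-1 :> R by rewrite invr_gt0.
  have /cvgrPdist_lt/(_ _ n0)[m _ /(_ m (leqnn m)) /=] := ul.
  have [x _ <-] := uf m.
  by rewrite sub0r normrN => /(le_lt_trans (ler_norm _)) /ltW; exists x.
have [x px] : exists x : H, p @ \oo --> x.
  apply: (@cvg_of_majorant _ _ _ (fun n => 4 * @harmonic R n)).
    exact/cvg0Zl/cvg_harmonic.
  move=> n m nm; rewrite -fi fB.
  have -> : f (p m) - f (p n) = (f (p m) - l) + (l - f (p n)) by rewrite addrA subrK.
  apply: le_trans (sqnormD_le _ _) _; rewrite (sqnormBC l).
  have h : (m.+1%:R^-1 : R) <= n.+1%:R^-1 by rewrite lef_pV2 ?posrE// ler_nat.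
  have := pP m; have := pP n; rewrite /harmonic /=; move: h.
  set a := sqnorm _; set b := sqnorm _; set c := _^-1; set d := _^-1; lra.
exists x => //; apply: (@lim_unique V (fun n => f (p n)) (fun n => f (p n))) => //.
  apply/cvg_sqnormP; under eq_fun do rewrite -fB fi.
  exact/cvg_sqnormP.
apply/cvg_sqnormP; apply: (cvg0_squeeze _ (@cvg_harmonic R)) => n.
by rewrite sqnorm_ge0 /= pP.
Qed.

End IsometricImages.

Section SubspaceOperations.
Variables (R : realType) (V : preHilbertType R).
Implicit Types (B M : set V).

Lemma orth_closed_subspace B : closed_subspace [set f : V | forall g, B g -> dot f g = 0].
Proof.
split; first split.
- by move=> g _; rewrite dot0l.
- by move=> a f g f0 g0 h Bh; rewrite dotDl dotZl f0// g0// mulr0 addr0.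
by apply/closed_seqP => u l u0 ul g Bg; apply: (cvg_dot_eq0 ul) => n; exact: u0.
Qed.

Lemma setI_closed_subspace B M : closed_subspace B -> closed_subspace M ->
  closed_subspace (B `&` M).
Proof.
move=> [lB cB] [lM cM]; split; last exact: closedI.
split; first by split; exact: lin0.
by move=> a f g [Bf Mf] [Bg Mg]; split; exact: linZD.
Qed.

Lemma ominus_closed_subspace B M : closed_subspace B -> closed_subspace (ominus B M).
Proof. by move=> cB; exact: (setI_closed_subspace cB (orth_closed_subspace M)). Qed.

End SubspaceOperations.

Section HardySpace.
Variables (R : realType) (K : sepHilbertType R).
Local Notation L2K := (L2circle K).
Implicit Types (f g : L2circle K) (p : nat) (k : K) (B M N : set (L2circle K)).

Lemma zpow_closed_subspace (n : int) B : closed_subspace B ->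
  closed_subspace [set f | B (zpow n f)].
Proof.
move=> [lB cB]; split; first split.
- have -> : (0 : L2circle K) = 0 - 0 by rewrite subrr.
  by rewrite /= zpowB subrr; exact: lin0.
- by move=> a f g Bf Bg; rewrite /= zpow_linear; exact: linZD.
apply/closed_seqP => u l uB ul; apply: ((closed_seqP B).1 cB _ _ uB).
exact: zpow_cvg.
Qed.

Lemma hardy_closed_subspace : closed_subspace (hardy K).
Proof.
have -> : hardy K = [set f | forall g,
    (exists n k, n < 0 /\ g = zpow n (constL2 k)) -> dot f g = 0].
  apply/seteqP; split=> f.
    by move=> /hardyP hf _ [n [k [n0 ->]]]; exact: hf.
  by move=> hf; apply/hardyP => n k n0; apply: hf; exists n, k.
exact: orth_closed_subspace.
Qed.

Lemma hardy_const k : hardy K (constL2 k).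
Proof. by apply/hardyP => n l n0; rewrite dot_const_zpow// lt_eqF. Qed.

Lemma hardy_zpow p f : hardy K f -> hardy K (zpow p f).
Proof.
move=> /hardyP hf; apply/hardyP => n k n0; rewrite dot_zpow zpowD; apply: hf.
by lia.
Qed.

(** A function in all the spaces [z^p H^2] has all its Fourier coefficients equal to 0. *)
Lemma shifted_hardy_cap f : (forall p, hardy K (zpow (- p%:Z) f)) -> f = 0.
Proof.
move=> hf; apply: L2_eq0 => n k; have /hardyP h := hf (`|n|.+1)%N.
rewrite -(zpow_isometry (- (`|n|.+1)%:Z)) zpowD; apply: h; lia.
Qed.

Lemma const_orth_shift k f : hardy K f -> dot (constL2 k) (zpow 1 f) = 0.
Proof.
by move=> /hardyP hf; apply: dot_sym0; rewrite dot_zpow; exact: hf.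
Qed.

Lemma adjoint_zshift f : adjoint_on (hardy K) (@zshift R K) f =
  orth_proj (hardy K) (zpow (- 1) f).
Proof.
have [hp op] := orth_projP hardy_closed_subspace (zpow (- 1) f).
apply: adjoint_on_unique => //; first by case: hardy_closed_subspace.
move=> u hu; rewrite -zpow1 dot_zpow.
by apply/eqP; rewrite -subr_eq0 -dotBr dot_sym0// op.
Qed.

(** The projections of [f] onto [z^p H^2] are the tails of its Fourier series. *)
Lemma hardy_tail_cvg0 f : hardy K f ->
  (fun p => orth_proj [set g | hardy K (zpow (- p%:Z) g)] f) @ \oo --> (0 : L2K).
Proof.
move=> hf; pose B p := [set g : L2K | hardy K (zpow (- p%:Z) g)].
have cB p : closed_subspace (B p) by exact: zpow_closed_subspace hardy_closed_subspace.
apply: (@decreasing_projections _ _ B _ f).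
- by move=> p; case: (cB p).
- move=> n m nm g; rewrite /B /= => hg.
  have -> : zpow (- n%:Z) g = zpow (m - n)%N (zpow (- m%:Z) g).
    by rewrite zpowD; congr zpow; lia.
  exact: hardy_zpow.
- by move=> p; have [? ?] := orth_projP (cB p) f.
- by move=> g hg; apply: shifted_hardy_cap => p; exact: hg p Logic.I.
Qed.

End HardySpace.

(** * Model spaces: full range and stability of the compression *)
Section ModelSpaces.
Variables (R : realType) (K : sepHilbertType R) (N : set (L2circle K)).
Local Notation L2K := (L2circle K).
Hypothesis N_model : model_space N.
Implicit Types (f g : L2circle K) (p : nat) (k : K).

Local Notation M := (ominus (hardy K) N).
Local Notation A := (shift_compression N).
Local Notation P := (orth_proj N).

Let N_hardy f : N f -> hardy K f.
Proof. by case: N_model => h _ _; exact: h. Qed.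

Let N_closed : closed_subspace N.
Proof. by case: N_model. Qed.

Lemma complement_closed : closed_subspace M.
Proof. exact/ominus_closed_subspace/hardy_closed_subspace. Qed.

Lemma complement_residue f : hardy K f -> M (f - P f).
Proof.
move=> hf; have [Np op] := orth_projP N_closed f; split => //.
by have [lh _] := hardy_closed_subspace K; exact: (linB lh hf (N_hardy Np)).
Qed.

Lemma complement_zpow p f : M f -> M (zpow p f).
Proof.
have M1 g : M g -> M (zpow 1 g).
  move=> [hg og]; split; first exact: (hardy_zpow 1).
  move=> y Ny; have [_ _ Na] := N_model.
  have := og _ (Na _ Ny); rewrite adjoint_zshift dot_zpow => h.
  have [_ op] := orth_projP (hardy_closed_subspace K) (zpow (- 1) y).
  by have := dot_sym0 (op _ hg); rewrite dotBr h subr0.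
elim: p f => [|p IHp] f Mf; first by rewrite zpow0.
by rewrite -[p.+1]addn1 PoszD -zpowD; apply: IHp; exact: M1.
Qed.

(** [M] is invariant under the shift, so the part of [z g] that comes from the component
    of [g] in [M] is lost under the projection onto [N]. *)
Lemma compression_iter p f : hardy K f -> iter p A (P f) = P (zpow p f).
Proof.
move=> hf; elim: p => [|p IHp]; first by rewrite zpow0.
rewrite iterS IHp /shift_compression -zpow1; symmetry.
set g := zpow p f; have hg : hardy K g by exact: hardy_zpow.
have [Nq oq] := orth_projP N_closed (zpow 1 (P g)).
apply: orth_proj_unique => // y Ny.
have -> : zpow p.+1 f = zpow 1 g by rewrite /g zpowD.
have -> : zpow 1 g - P (zpow 1 (P g)) =
    zpow 1 (g - P g) + (zpow 1 (P g) - P (zpow 1 (P g))) by rewrite zpowB addrA subrK.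
rewrite dotDl oq// addr0; have [_] := complement_zpow 1 (complement_residue hg).
exact.
Qed.

Lemma orth_proj_id f : N f -> P f = f.
Proof. by move=> Nf; apply: orth_proj_unique => // z _; rewrite subrr dot0l. Qed.

(** The function [z^-p P (z^p f)] is the projection of [f] onto the orthogonal complement
    of [z^-p M], and these complements decrease. A function in all of them is
    orthogonal to [z^n E_j] for all integers [n], hence pointwise orthogonal to a
    total set of vectors of [K]. *)
Lemma full_range_compression_stable f : full_range M -> N f ->
  (fun p => iter p A f) @ \oo --> (0 : L2K).
Proof.
move=> [D [E [[EW _ _] Efull]]] Nf.
pose B p := [set g : L2K | forall h, (exists2 m, M m & h = zpow (- p%:Z) m) -> dot g h = 0].
pose b p := zpow (- p%:Z) (iter p A f).
suff b0 : b @ \oo --> (0 : L2K).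
  move/cvg_nrmP: b0 => b0; apply/cvg_nrmP; move: b0.
  by under eq_fun do rewrite subr0 nrm_zpow; under [in X in _ -> X]eq_fun do rewrite subr0.
have hf := N_hardy Nf.
have it p : iter p A f = P (zpow p f) by rewrite -[in LHS](orth_proj_id Nf) compression_iter.
have Nit p : N (iter p A f) by rewrite it; have [] := orth_projP N_closed (zpow p f).
apply: (@decreasing_projections _ _ B _ f).
- by move=> p; case: (orth_closed_subspace [set h | exists2 m, M m & h = zpow (- p%:Z) m]).
- move=> n m nm g Bg _ [h Mh ->]; apply: Bg.
  exists (zpow (m - n)%N h); first exact: complement_zpow.
  by rewrite zpowD; congr zpow; lia.
- move=> p; split.
    by move=> _ [m [_ om] ->]; rewrite zpow_isometry; apply: dot_sym0; exact: om.
  move=> g Bg; apply: dot_sym0; apply: Bg; exists (zpow p f - P (zpow p f)).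
    by apply: complement_residue; exact: hardy_zpow.
  by rewrite zpowB zpowK -it.
move=> g Bg /=; apply: L2_eq.
have gE : {ae @circle_measure R, forall z, forall j : nat,
    D j -> dot (L2repr g z) (L2repr (E j) z) = 0}.
  apply: ae_foralln => j; have [Dj|nD] := pselect (D j); last by apply: aeW => z.
  have h : forall n, dot g (zpow n (E j)) = 0.
    move=> n; apply: (Bg (absz n) Logic.I).
    have [p pE] : exists p : nat, n + (absz n)%:Z = p%:Z.
      by exists (absz (n + (absz n)%:Z)%R); lia.
    exists (zpow p (E j)); first by apply: complement_zpow; have [] := EW j Dj.
    by rewrite -pE zpowD; congr zpow; lia.
  by move: (orth_zpow_ae h); apply: filterS => z.
move: gE Efull (L2_ae0 (@circle_measure R) K); apply: filterS3 => z gz Ez ->.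
apply: dotxx_eq0.
suff : closed_span [set E j z | j in D] `<=` [set k | dot (L2repr g z) k = 0].
  by apply; rewrite Ez.
apply: closed_span_sub; last by move=> _ [j Dj <-]; exact: gz.
split; first split; rewrite /= ?dot0r//.
  by move=> a x y x0 y0; rewrite /= dotDr dotZr x0 y0 mulr0 addr0.
apply/closed_seqP => u l u0 ul; apply: dot_sym0.
by apply: (cvg_dot_eq0 ul) => n; apply: dot_sym0; exact: u0.
Qed.

Section StableImpliesFullRange.
Variable d : nat -> L2circle K.
Local Notation W := (ominus M (@zshift R K @` M)).
Hypothesis d_dense : W `<=` closure (range d).
Hypothesis A_stable : forall f, N f -> (fun p => iter p A f) @ \oo --> (0 : L2K).

(** Stability makes each constant function the limit of functions [z^-p m_p] with
    [m_p] in [M], and the values of such functions lie in [J(z)] because [M] is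
    generated by the shifts of [W]. So [J(z)] contains a dense sequence of [K]
    for almost every [z]. *)
Lemma stable_full_range : full_range M.
Proof.
have clM := complement_closed; have [lM cM] := clM.
have clW : closed_subspace W by exact: ominus_closed_subspace.
have W0 : W !=set0 by exists 0; apply: lin0; case: clW.
have [w wW wd] := dense_sequence_in W0 d_dense.
have [D [E DE]] := orthonormal_basis_exists clW wW wd.
exists D, E; split => //; have [EW _ EsW] := DE.
pose J (z : circle R) := closed_span [set L2repr (E j) z | j in D].
have clJ z : closed_subspace (J z).
  by apply: closure_linear; exact: lin_span_linear.
pose Q : set (L2circle K) := L2_in J.
have clQ : closed_subspace Q by exact: L2_in_closed_subspace.
have WQ : W `<=` Q.
  rewrite -EsW; apply: closed_span_sub => // _ [j Dj <-]; apply: aeW => z.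
  by apply: subset_closure; apply: sub_lin_span; exists j.
have Qz n f : Q f -> Q (zpow n f).
  move=> Qf; move: Qf (zpow_ae n f); apply: filterS2 => z Jf ->.
  exact: (linZ _ (clJ z).1 Jf).
(* Wold: what is left of M after the closed invariant part X, which contains
     W, lies in all the spaces z^p H^2 *)
have MQ : M `<=` Q.
  pose X := M `&` Q; have clX : closed_subspace X by exact: setI_closed_subspace.
  move=> m Mm; have [[Mp Qp] op] := orth_projP clX m.
  set g := m - orth_proj X m in op.
  have Mg : M g by exact: linB.
  suff g0 : g = 0 by move/eqP: g0; rewrite subr_eq0 => /eqP ->.
  have Mgp p : M (zpow (- p%:Z) g).
    elim: p => [|p Mgp]; first by rewrite oppr0 zpow0.
    set gp := zpow (- p%:Z) g in Mgp.
    have clzM := zpow_closed_subspace (- 1) clM.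
    have [zq oq] := orth_projP clzM gp.
    set q := orth_proj _ gp in zq oq.
    have Mq : M q by rewrite -(zpowNK 1 q); exact: (complement_zpow 1).
    have Ww : W (gp - q).
      split; first exact: linB.
      by move=> _ [y My <-]; apply: oq; rewrite /= -zpow1 zpowK.
    (* z^p (gp - q) is in X, to which g is orthogonal *)
    have w0 : gp - q = 0.
      apply: dotxx_eq0; rewrite dotBr (oq q zq) subr0.
      transitivity (dot (zpow p (gp - q)) g); first by rewrite dot_zpow.
      apply: dot_sym0; apply: op; split; last exact/Qz/WQ.
      by have [Mw _] := Ww; exact: (complement_zpow p Mw).
    move/eqP: w0; rewrite subr_eq0 => /eqP w0.
    have -> : zpow (- p.+1%:Z) g = zpow (- 1) gp by rewrite zpowD; congr zpow; lia.
    by rewrite w0; exact: zq.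
  by apply: shifted_hardy_cap => p; have [] := Mgp p.
have cQ k : Q (constL2 k).
  have hc := hardy_const k; have [Nc _] := orth_projP N_closed (constL2 k).
  have [_ closedQ] := clQ; apply: ((closed_seqP Q).1 closedQ
    (fun p => constL2 k - zpow (- p%:Z) (iter p A (P (constL2 k))))).
    move=> p; rewrite compression_iter// -[constL2 k in X in Q (X - _)](zpowK p) -zpowB.
    by apply/Qz/MQ; apply: complement_residue; exact: hardy_zpow.
  have /cvg_nrmP := A_stable Nc; under eq_fun do rewrite subr0.
  move=> s0; apply/cvg_nrmP; move: s0; under [in X in _ -> X]eq_fun do
    rewrite addrAC subrr sub0r nrmN nrm_zpow.
  exact.
have [e de] := dense_sequence K.
have ae_e : {ae @circle_measure R, forall z, forall n : nat, J z (e n)}.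
  apply: ae_foralln => n; move: (cQ (e n)) (constL2_ae (e n)).
  by apply: filterS2 => z + h; rewrite h.
move: ae_e; apply: filterS => z Jz; apply/seteqP; split => // x _.
by apply: (closed_dense de _ Jz); case: (clJ z).
Qed.

End StableImpliesFullRange.

End ModelSpaces.

(** * Operators similar to a compression *)
Section Similarity.
Variables (R : realType) (H : sepHilbertType R) (T : {linear H -> H}).
Hypothesis T_contraction : contractive T.
Variables (K : sepHilbertType R) (N : set (L2circle K)).
Hypothesis N_model : model_space N.
Local Notation A := (shift_compression N).

Lemma nrm_bound (V V' : preHilbertType R) (c : R[i]) (x : V) (y : V') :
  `|x| <= c * `|y| -> nrm x <= complex.Re `|c| * nrm y.
Proof.
move=> h; rewrite -lecR rmorphM /= -nrmE Re_normE -nrmE; apply: (le_trans h).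
by rewrite -(ger0_norm (le_trans (normr_ge0 x) h)) normrM normr_id.
Qed.

Lemma adjoint_iter n x y :
  dot (iter n T x) y = dot x (iter n (adjoint_on [set: H] T) y).
Proof.
elim: n x y => // n IHn x y.
by rewrite iterS (adjoint_contraction T_contraction) IHn -iterSr.
Qed.

(** Stability of [T] is transported from the compression by similarity. For the
    adjoint, represent [f |-> <U' f, x>] on [N] by [phi]; then [<T^n y, x>] is the inner
    product of [z^n U y] with the projection of [phi] onto [z^n H^2], which tends to 0
    uniformly for [y] in the unit ball. *)
Lemma similar_joint_stability : full_range (ominus (hardy K) N) ->
  similar_on T N A -> joint_strong_stability T.
Proof.
move=> fr [U [U' [NU U'U UU' [[c cU] [c' cU']] UTU']]].
have UT x : U (T x) = A (U x) by rewrite -UTU'// U'U.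
have UTn n x : U (iter n T x) = iter n A (U x).
  by elim: n => // n IHn; rewrite !iterS UT IHn.
pose C := complex.Re `|c|; pose C' := complex.Re `|c'|.
have bU x : nrm (U x) <= C * nrm x by exact: nrm_bound.
have bU' x : nrm x <= C' * nrm (U x).
  by rewrite -{1}(U'U x); apply: nrm_bound; exact: cU'.
have NA n x : N (iter n A (U x)) by rewrite -UTn.
have clN : closed_subspace N by case: N_model.
split=> x.
  have /cvg_nrmP s0 := full_range_compression_stable N_model fr (NU x).
  apply/cvg_nrmP; apply: (cvg0_squeeze _ (cvg0Zl C' s0)) => n.
  by rewrite nrm_ge0 /= !subr0 -UTn.
have [] := @riesz _ _ N (fun f => dot (U' f) x) (C' * nrm x) clN.
- move=> a f g Nf Ng.
  have -> : U' (a *: f + g) = a *: U' f + U' g.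
    by rewrite -[in LHS](UU' f Nf) -[in LHS](UU' g Ng) -linearP U'U.
  by rewrite dotDl dotZl.
- move=> f Nf; apply: le_trans (cauchy_schwarz _ _) _.
  rewrite mulrAC ler_wpM2r ?nrm_ge0//.
  by have := bU' (U' f); rewrite UU'.
move=> phi Nphi phiE.
have hphi : hardy K phi by case: N_model => h _ _; exact: h.
pose r p := orth_proj [set g | hardy K (zpow (- p%:Z) g)] phi.
have r0 : r @ \oo --> (0 : L2circle K) by exact: hardy_tail_cvg0.
have key n y : dot (iter n T y) x = dot (zpow n (U y)) (r n).
  have hU : hardy K (U y) by case: N_model => h _ _; exact: h.
  rewrite -(U'U (iter n T y)) phiE// UTn -[in LHS](orth_proj_id N_model (NU y)).
  rewrite compression_iter//.
  have [_ oP] := orth_projP clN (zpow n (U y)).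
  have := oP _ Nphi; rewrite dotBl => /eqP; rewrite subr_eq0 => /eqP <-.
  have cB := zpow_closed_subspace (- n%:Z) (hardy_closed_subspace K).
  have [_ oB] := orth_projP cB phi.
  have /oB /dot_sym0 : [set g | hardy K (zpow (- n%:Z) g)] (zpow n (U y)) by rewrite /= zpowK.
  by rewrite dotBr => /eqP; rewrite subr_eq0 => /eqP.
apply/cvg_nrmP; have /cvg_nrmP r1 := r0.
apply: (cvg0_squeeze _ (cvg0Zl C r1)) => n; rewrite nrm_ge0 /= !subr0.
(* the bound on <T^n y, x> is applied to y = T*^n x, where it is |y|^2 *)
set y := iter n (adjoint_on [set: H] T) x.
have [->|y0] := eqVneq (nrm y) 0; first by rewrite mulr_ge0 ?nrm_ge0 ?Re_norm_ge0.
have ygt0 : 0 < nrm y by rewrite lt_def y0 nrm_ge0.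
rewrite -(ler_pM2l ygt0) -expr2 nrm_sq sqnorm_dot -adjoint_iter key.
apply: le_trans (Re_dot_le_nrm _ _) _; rewrite nrm_zpow mulrA ler_wpM2r ?nrm_ge0//.
by rewrite mulrC; exact: bU.
Qed.

End Similarity.

(** * The canonical model of a stable contraction *)
Section CanonicalModel.
Variables (R : realType) (H : sepHilbertType R) (T : {linear H -> H}).
Hypothesis T_contraction : contractive T.
Hypothesis T_stable : strongly_stable T.
Local Notation Ts := (adjoint_on [set: H] T).
Hypothesis Ts_stable : strongly_stable Ts.
Local Notation L2H := (L2circle H).

Let adj u x : dot (T u) x = dot u (Ts x) := adjoint_contraction T_contraction u x.

Let Tnrm x : nrm (T x) <= nrm x.
Proof. by rewrite -lecR -!nrmE; exact: T_contraction. Qed.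

Let Ts_linear a x y : Ts (a *: x + y) = a *: Ts x + Ts y.
Proof.
apply: dot_inj => u; rewrite [LHS]dotC -adj dotDr dotZr !adj.
by rewrite -dotZr -dotDr -dotC.
Qed.

Let Ts_nrm x : nrm (Ts x) <= nrm x.
Proof.
have [->|t0] := eqVneq (nrm (Ts x)) 0; first exact: nrm_ge0.
have tgt0 : 0 < nrm (Ts x) by rewrite lt_def t0 nrm_ge0.
rewrite -(ler_pM2l tgt0) -expr2 nrm_sq sqnorm_dot -adj.
by apply: le_trans (Re_dot_le_nrm _ _) _; rewrite ler_wpM2r ?nrm_ge0.
Qed.

(** The operator is the positive square root of [1 - T Ts]. *)
Lemma defect_operator : exists2 D : H -> H,
  forall a x y, D (a *: x + y) = a *: D x + D y &
  forall x y, dot (D x) (D y) = dot x y - dot (Ts x) (Ts y).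
Proof.
have [a x y|x y|x|D Dl DD] := @square_root_one_minus _ _ (fun x => T (Ts x)).
- by rewrite Ts_linear linearP.
- by rewrite adj [RHS]dotC adj -dotC.
- exact: le_trans (Tnrm _) (Ts_nrm _).
by exists D => // x y; rewrite DD dotBl adj.
Qed.

Variable D : H -> H.
Hypothesis D_linear : forall a x y, D (a *: x + y) = a *: D x + D y.
Hypothesis DD : forall x y, dot (D x) (D y) = dot x y - dot (Ts x) (Ts y).

(** Partial sums of the series [sum_i z^i D Ts^i x], in the recursive form in which
    [x] is replaced by [Ts x]. *)
Fixpoint model_sum n : H -> L2H :=
  if n is m.+1 then fun x => constL2 (D x) + zpow 1 (model_sum m (Ts x)) else fun=> 0.

Lemma model_sum_hardy n x : hardy H (model_sum n x).
Proof.
have [lh _] := hardy_closed_subspace H.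
elim: n x => [|n IHn] x /=; first exact: lin0.
by apply: (linD lh (hardy_const _)); exact: (hardy_zpow 1).
Qed.

Lemma model_sum_linear n a x y :
  model_sum n (a *: x + y) = a *: model_sum n x + model_sum n y.
Proof.
elim: n x y => [|n IHn] x y /=; first by rewrite scaler0 addr0.
by rewrite Ts_linear IHn D_linear constL2_linear zpow_linear scalerDr addrACA.
Qed.

(** The inner products telescope because [D] is a defect operator, so strong stability
    of [Ts] makes the limit map an isometry. *)
Lemma model_sum_dot n x y : dot (model_sum n x) (model_sum n y) =
  dot x y - dot (iter n Ts x) (iter n Ts y).
Proof.
elim: n x y => [|n IHn] x y /=; first by rewrite dot0l subrr.
have o k z : dot (constL2 k) (zpow 1 (model_sum n z)) = 0.
  exact/const_orth_shift/model_sum_hardy.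
rewrite dotDl !dotDr o (dot_sym0 (o _ _)) addr0 add0r dot_const DD zpow_isometry IHn.
by rewrite -!iterSr addrA subrK.
Qed.

Lemma model_sum_tail n m x :
  model_sum (n + m) x - model_sum n x = zpow n (model_sum m (iter n Ts x)).
Proof.
elim: n x => [|n IHn] x; first by rewrite subr0 zpow0.
rewrite addSn /= opprD addrACA subrr add0r -zpowB IHn zpowD -iterSr.
by congr zpow.
Qed.

Lemma model_map_exists x : exists f : L2H, (fun n => model_sum n x) @ \oo --> f.
Proof.
apply: (@cvg_of_majorant _ _ _ (fun n => sqnorm (iter n Ts x))).
  by have /cvg_sqnormP := Ts_stable x; under eq_fun do rewrite subr0.
move=> n m nm; rewrite -(subnKC nm) model_sum_tail -!nrm_sq nrm_zpow !nrm_sq.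
rewrite sqnorm_dot model_sum_dot cReD cReN -!sqnorm_dot gerBl.
exact: sqnorm_ge0.
Qed.

Definition model_map x : L2H := xget 0 [set f | (fun n => model_sum n x) @ \oo --> f].
Local Notation V := model_map.

Lemma model_map_cvg x : (fun n => model_sum n x) @ \oo --> V x.
Proof. exact: (xgetPex 0 (model_map_exists x)). Qed.

Lemma model_map_linear a x y : V (a *: x + y) = a *: V x + V y.
Proof.
apply: (@lim_unique _ L2H _ _ _ _ (@model_map_cvg _)
  (cvg_ZD (a := a) (@model_map_cvg x) (@model_map_cvg y))) => n.
exact: model_sum_linear.
Qed.

Lemma model_map_dot x y : dot (V x) (V y) = dot x y.
Proof.
have h1 := cvg_dot (@model_map_cvg x) (@model_map_cvg y).
have h2 : (fun n => dot x y - dot (iter n Ts x) (iter n Ts y) : R[i]^o) @ \oo -->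
    (dot x y : R[i]^o).
  rewrite -[X in _ --> X](subr0 (dot x y)) -[X in _ - X](dot0l (0 : H)).
  by apply: cvgB; [exact: cvg_cst|exact: (cvg_dot (@Ts_stable x) (@Ts_stable y))].
by apply: (@lim_unique _ R[i]^o _ _ _ _ h1 h2) => n; exact: model_sum_dot.
Qed.

Lemma model_map_sqnorm x : sqnorm (V x) = sqnorm x.
Proof. by rewrite !sqnorm_dot model_map_dot. Qed.

Lemma model_map_shift x : V x = constL2 (D x) + zpow 1 (V (Ts x)).
Proof.
have h : (fun n => model_sum n.+1 x) @ \oo --> V x.
  by have := @model_map_cvg x; rewrite -(cvg_shiftS (model_sum ^~ x)).
have h' : (fun n => constL2 (D x) + zpow 1 (model_sum n (Ts x))) @ \oo -->
    constL2 (D x) + zpow 1 (V (Ts x)).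
  by apply: cvgD; [exact: cvg_cst|exact: (zpow_cvg (@model_map_cvg _))].
exact: (@lim_unique _ L2H _ _ _ _ h h').
Qed.

Local Notation N := (range V).

Lemma model_map_hardy x : hardy H (V x).
Proof.
have [_ ch] := hardy_closed_subspace H.
by apply: ((closed_seqP (hardy H)).1 ch _ _ _ (@model_map_cvg x)) => n; exact: model_sum_hardy.
Qed.

Lemma range_model_space : model_space N.
Proof.
split.
- by move=> _ [x _ <-]; exact: model_map_hardy.
- by apply: isometric_image_closed; [exact: model_map_linear|exact: model_map_sqnorm].
move=> _ [x _ <-]; exists (Ts x) => //; symmetry.
apply: adjoint_on_unique; first by case: (hardy_closed_subspace H).
  exact: model_map_hardy.
move=> u hu; rewrite [in LHS]model_map_shift dotDr -zpow1.
by rewrite (dot_sym0 (const_orth_shift _ hu)) add0r zpow_isometry.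
Qed.

(** The identity [V y = D y + z V (Ts y)] and the isometry property give
    [<z V x, V y> = <x, Ts y> = <V (T x), V y>]. *)
Lemma model_compression x : shift_compression N (V x) = V (T x).
Proof.
have [_ clN _] := range_model_space.
apply: orth_proj_unique => // _ [y _ <-].
rewrite dotBl model_map_dot -zpow1 [V y]model_map_shift.
rewrite dotDr (dot_sym0 (const_orth_shift _ (model_map_hardy x))) add0r.
by rewrite zpow_isometry model_map_dot adj subrr.
Qed.

(** A vector [w] of the wandering subspace is a constant plus [z g], with [g] in [H^2]
    orthogonal to [M] and therefore in [N]. So the wandering subspace lies in
    [H + z N], which is separable because [H] is. *)
Lemma model_wandering_dense : exists d : nat -> L2H,
  ominus (ominus (hardy H) N) (@zshift R H @` ominus (hardy H) N) `<=` closure (range d).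
Proof.
have [e de] := dense_sequence H.
pose d n := if unpickle n is Some p then constL2 (e p.1) + zpow 1 (V (e p.2)) else 0.
exists d => w [[hw ow] wM].
have clC : closed_subspace (range (@constL2 R H)).
  apply: isometric_image_closed; first exact: constL2_linear.
  by move=> k; rewrite !sqnorm_dot dot_const.
have [[k _ kE] oC] := orth_projP clC w; rewrite -kE in oC.
pose g := zpow (- 1) (w - constL2 k).
have wE : w = constL2 k + zpow 1 g by rewrite /g zpowNK addrC subrK.
have hg : hardy H g.
  apply/hardyP => n l n0; rewrite /g dot_zpow opprK zpowD.
  have [n1|n1] := eqVneq n (- 1).
    by rewrite n1 addrN zpow0; apply: oC; exists l.
  move/hardyP: hw => hw; have /hardyP hk := hardy_const k.
  have lt0 : 1 + n < 0 by lia.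
  by rewrite dotBl hw// hk// subrr.
have Nm := range_model_space.
have Mm := complement_residue Nm hg; set m := g - orth_proj N g in Mm.
have [_ clN _] := Nm; have [Ng og] := orth_projP clN g.
have m0 : m = 0.
  apply: dotxx_eq0; rewrite {2}/m dotBr (og _ Ng) subr0 -(zpow_isometry 1).
  have -> : zpow 1 g = w - constL2 k by rewrite /g zpowNK.
  have [hm _] := Mm.
  rewrite dotBr (dot_sym0 (const_orth_shift k hm)) subr0; apply: dot_sym0.
  by apply: wM; exists m; rewrite // zpow1.
have [h _ hE] : N g by move/eqP: m0; rewrite subr_eq0 => /eqP ->.
apply/closure_approx => r r0.
have r20 : 0 < r / 2 by rewrite divr_gt0.
have [_ [i _ <-] ik] := (closure_approx _ _).1 (de k) _ r20.
have [_ [j _ <-] jh] := (closure_approx _ _).1 (de h) _ r20.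
exists (constL2 (e i) + zpow 1 (V (e j))).
  by exists (pickle (i, j)); [exact: Logic.I|rewrite /d pickleK].
rewrite wE -hE opprD addrACA -constL2B -zpowB -(linear_subE model_map_linear).
apply: le_lt_trans (nrmD _ _) _; rewrite nrm_zpow [r]splitr.
have nV x : nrm (V x) = nrm x by apply: nrm_eq_sqnorm; exact: model_map_sqnorm.
have nc x : nrm (constL2 x) = nrm x.
  by apply: nrm_eq_sqnorm; rewrite !sqnorm_dot dot_const.
by rewrite nV nc ltrD.
Qed.

Lemma stable_has_model : exists N0 : set L2H,
  [/\ model_space N0, full_range (ominus (hardy H) N0)
    & similar_on T N0 (shift_compression N0)].
Proof.
have Nm := range_model_space; exists N; split => //.
  have [d dd] := model_wandering_dense.
  apply: (stable_full_range Nm dd) => _ [x _ <-].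
  have it n : iter n (shift_compression N) (V x) = V (iter n T x).
    by elim: n => // n IHn; rewrite !iterS IHn model_compression.
  apply/cvg_sqnormP; under eq_fun do rewrite subr0 it model_map_sqnorm.
  by have /cvg_sqnormP := T_stable x; under eq_fun do rewrite subr0.
pose U : {linear H -> L2H} :=
  HB.pack V (GRing.isLinear.Build R[i] H L2H *:%R V model_map_linear).
have nV x : `|V x| = `|x|.
  by rewrite !nrmE; congr (_%:C%C); apply: nrm_eq_sqnorm; exact: model_map_sqnorm.
have Vinj x y : V x = V y -> x = y.
  move=> xy; apply: dot_inj => z; by rewrite -!model_map_dot xy.
pose U' f := xget 0 [set x | V x = f].
have UU' f : N f -> V (U' f) = f.
  by move=> [x _ xf]; apply: (xgetPex 0 (P := [set x | V x = f])); exists x.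
have U'U x : U' (V x) = x by apply: Vinj; apply: UU'; exists x.
exists U, U'; split => //.
- split; first by exists 1 => x; rewrite mul1r -nV.
  by exists 1 => f Nf; rewrite mul1r -nV UU'.
- by move=> _ [x _ <-]; rewrite U'U model_compression.
Qed.

End CanonicalModel.

Theorem theorem5p10 (R : realType) (H : sepHilbertType R) (T : {linear H -> H})
    (H_infinite : infinite_dimensional H) (T_contraction : contractive T) :
  joint_strong_stability T <->
  exists (K : sepHilbertType R) (N : set (L2circle K)),
    [/\ model_space N, full_range (ominus (hardy K) N)
      & similar_on T N (shift_compression N)].
Proof.
split=> [[T_stable Ts_stable]|[K [N [Nm fr sim]]]].
  have [D D_linear DD] := defect_operator T_contraction.
  exists H; exact: (stable_has_model T_contraction T_stable Ts_stable D_linear DD).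
exact: similar_joint_stability sim.
Qed.
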